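(* Let $-\infty<a<b\le\infty$, let $\chi$ be a locally finite signed Borel measure on $[a,b)$, and let $S$ be the self-adjoint operator in $L^2(a,b)$ associated with $\tau f=\left(-f'+\int f\,d\chi\right)'$ with Dirichlet boundary condition at $a$ and, if $\tau$ is in the limit-circle case at $b$, a fixed boundary condition at $b$ (as defined in the context). For $t\in[a,b)$ denote by $m(z,t)$ the Weyl function associated with this operator restricted to the interval $(t,b)$ with a Dirichlet boundary condition at $t$ and keeping the boundary condition at $b$ (if any) fixed. Then for any test function $\phi\in C_c^\infty(a,b)$ we have $$\int_a^b m(z,t)\phi(t)\,dt = -\sqrt{-z}\int_a^b\phi(t)\,dt - \frac{1}{2\sqrt{-z}}\int_a^b\phi(s)\,d\chi(s) + o(z^{-1/2})$$ as $\operatorname{Im}(z)\to\infty$.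
   Context: Setting. $\chi$ is a signed (real-valued) Borel measure on $[a,b)$ with $|\chi|([a,x))<\infty$ for every $x\in(a,b)$, where $|\chi|$ denotes the total variation measure; point masses are allowed. For $t\in[a,b)$ consider on $[t,b)$ the differential expression $\tau f=\left(-f'+\int f\,d\chi\right)'$, meaning $\tau f(x)=\frac{d}{dx}\left(-f'(x)+\int_{[t,x)}f\,d\chi\right)$. Its maximal domain consists of all $f\in AC_{\mathrm{loc}}[t,b)$ such that $x\mapsto -f'(x)+\int_{[t,x)} f\,d\chi$ is (after choosing the representative of $f'$) in $AC_{\mathrm{loc}}[t,b)$. Thus $f'$ satisfies the jump condition $f'(x+)-f'(x-)=\chi(\{x\})f(x)$; $f'$ is always taken left continuous, and at the left endpoint $x=t$ the jump condition defines the left limit $f'(t)=f'(t-):=f'(t+)-\chi(\{t\})f(t)$. A solution of $\tau u=zu$ is an element of the maximal domain satisfying this equation almost everywhere. A prime denotes the derivative in $x$; $^*$ denotes complex conjugation. Wronskian: $W_x(f,g)=f(x)g'(x)-f'(x)g(x)$, with $W_b$ the limit as $x\nearrow b$. Operators: $\operatorname{dom}(T_{\max})$ is the set of $f$ in the maximal domain on $[a,b)$ with $f,\tau f\in L^2(a,b)$. $\tau$ is in the limit-circle case at $b$ if all solutions of $\tau u=zu$ are square integrable near $b$, and in the limit-point case at $b$ otherwise. $S$ is the restriction of $f\mapsto\tau f$ to $\{f\in\operatorname{dom}(T_{\max}): f(a)=0\}$ in the limit-point case, and to $\{f\in\operatorname{dom}(T_{\max}): f(a)=0,\ W_b(f,w^*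 )=0\}$ in the limit-circle case, where $w\in\operatorname{dom}(T_{\max})$ is fixed with $W_b(w,w^* )=0$ and $W_b(h,w^* )\ne0$ for some $h\in\operatorname{dom}(T_{\max})$. The operator on $(t,b)$ is defined in the same way with $a$ replaced by $t$ and with the same condition $W_b(f,w^* )=0$ at $b$ in the limit-circle case. Weyl function on $(t,b)$: let $c_t(z,x),s_t(z,x)$ be the solutions of $\tau u=zu$ on $[t,b)$ with $c_t(z,t)=1$, $c_t'(z,t)=0$, $s_t(z,t)=0$, $s_t'(z,t)=1$. For $z\in\mathbb C\setminus\mathbb R$, $m(z,t)$ is the number such that $c_t(z,x)+m(z,t)s_t(z,x)$ is square integrable near $b$ and satisfies the boundary condition at $b$ (if there is one), i.e. its Wronskian with $w^*$ vanishes at $b$ in the limit-circle case. $\sqrt{\cdot}$ is the standard branch of the square root with branch cut along $(-\infty,0)$. The notation $o(z^{-1/2})$ means a term whose modulus divided by $|z|^{-1/2}$ tends to $0$.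
   Formalization: The limit Im(z)→∞ is taken with Re√(−z)→∞ as well (true on vertical lines, nonreal rays and sectors); without this the expansion fails, e.g. a=0, b=2, χ=δ₁, Dirichlet condition at b, φ(1)≠0, √(−z)=1−iT, T→∞. *)

(* Defs.v *)
From HB Require Import structures.
From mathcomp Require Import all_boot all_order all_algebra.
From mathcomp Require Import all_classical all_reals all_analysis.
From mathcomp.real_closed Require Import complex.
Set Implicit Arguments.
Unset Strict Implicit.
Unset Printing Implicit Defensive.
Import Order.TTheory GRing.Theory Num.Theory.
Import numFieldNormedType.Exports.
Local Open Scope classical_set_scope.
Local Open Scope ring_scope.
Local Open Scope complex_scope.

(* Half-open interval [t, b) whose right endpoint may be +oo. *)
Definition co_itv (R : realType) (t : R) (b : \bar R) : set R :=
  [set x | t <= x /\ (x%:E < b)%E].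

Definition oo_itv (R : realType) (t : R) (b : \bar R) : set R :=
  [set x | t < x /\ (x%:E < b)%E].

(* The filter x -> b from the left. *)
Definition left_nbhs (R : realType) (b : \bar R) : set_system R :=
  filter_from [set c : R | (c%:E < b)%E] (fun c => oo_itv c b).

(* A signed Borel measure chi on [a, b) with |chi|([a, x)) < oo for all x in
   (a, b).  The positive and the negative part of chi may both have infinite
   mass near b, so chi itself need not be a set function on all Borel subsets
   of [a, b); it is given by the compatible family of its restrictions to the
   intervals [a, c), a < c < b.  A charge is finite-valued, hence has finite
   total variation.  The charges with index outside (a, b) are irrelevant. *)
Record signed_measure (R : realType) (a : R) (b : \bar R) := SignedMeasure {
  restr_to :> R -> {charge set (measurableTypeR R) -> \bar R} ;
  restr_to_compat : forall c d : R, a < c -> c <= d -> (d%:E < b)%E ->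
    forall A : set (measurableTypeR R), measurable A ->
      restr_to c A = restr_to d (A `&` `[a, c[%classic)
}.

(* Integral against a charge through its Jordan decomposition, which does not
   depend on the Hahn decomposition that is picked. *)
Definition charge_Rintegral (R : realType)
    (nu : {charge set (measurableTypeR R) -> \bar R})
    (D : set (measurableTypeR R)) (f : R -> R) : R :=
  let P := cid (Hahn_decomposition nu) in
  let N := cid (projT2 P) in
  let nuPN := projT2 N in
  \int[jordan_pos nuPN]_(x in D) f x - \int[jordan_neg nuPN]_(x in D) f x.

Section complex_valued.
Context {R : realType}.
Implicit Types (f g : R -> R[i]) (D : set R).

Definition charge_integral (nu : {charge set (measurableTypeR R) -> \bar R})
    D f : R[i] :=
  charge_Rintegral nu D (fun x => complex.Re (f x))
  +i* charge_Rintegral nu D (fun x => complex.Im (f x)).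

Definition leb_integral D f : R[i] :=
  (\int[@lebesgue_measure R]_(x in D) complex.Re (f x))
  +i* (\int[@lebesgue_measure R]_(x in D) complex.Im (f x)).

(* The library puts no topology on R[i]. *)
Definition has_limit (F : set_system R) f (l : R[i]) : Prop :=
  Normc.normc (f x - l) @[x --> F] --> (0 : R).

Definition is_deriv f (x : R) (v : R[i]) : Prop :=
  is_derive x 1 (fun y => complex.Re (f y)) (complex.Re v) /\
  is_derive x 1 (fun y => complex.Im (f y)) (complex.Im v).

Definition has_deriv_ae D f g : Prop :=
  {ae @lebesgue_measure R, forall x, D x -> is_deriv f x (g x)}.

Definition abs_cont (c d : R) f : Prop :=
  forall eps : R, 0 < eps -> exists2 delta : R, 0 < delta &
    forall (n : nat) (u v : 'I_n -> R),
      (forall i, c <= u i /\ u i <= v i /\ v i <= d) ->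
      trivIset setT (fun i => `]u i, v i[%classic) ->
      \sum_(i < n) (v i - u i) < delta ->
      \sum_(i < n) Normc.normc (f (v i) - f (u i)) < eps.

Definition abs_cont_loc (t : R) (b : \bar R) f : Prop :=
  forall d : R, t <= d -> (d%:E < b)%E -> abs_cont t d f.

Definition L2 D f : Prop :=
  [/\ measurable_fun D (fun x => complex.Re (f x) : R),
      measurable_fun D (fun x => complex.Im (f x) : R) &
      (\int[@lebesgue_measure R]_(x in D) (Normc.normc (f x) ^+ 2)%:E < +oo)%E].

Definition L2_near (t : R) (b : \bar R) f : Prop :=
  exists2 c : R, co_itv t b c & L2 (oo_itv c b) f.

Definition test_function (a : R) (b : \bar R) (phi : R -> R[i]) : Prop :=
  [/\ forall n x, derivable (derive1n n (fun y => complex.Re (phi y))) x 1,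
      forall n x, derivable (derive1n n (fun y => complex.Im (phi y))) x 1 &
      exists K : set R,
        [/\ compact K, K `<=` oo_itv a b & forall x, ~ K x -> phi x = 0]].

End complex_valued.

Section differential_expression.
Context {R : realType} {a : R} {b : \bar R}.
Variable chi : signed_measure a b.
Implicit Types (t x : R) (z : R[i]) (f df g dg h u du w dw : R -> R[i]).

(* Functions in the maximal domain come with the left continuous
   representative of their derivative, denoted by the prefix d.  It is pinned
   down on [t, b), the endpoint t included, by the local absolute continuity of
   [quasi_deriv t f df] together with df = f' a.e. *)
Definition quasi_deriv t f df x : R[i] :=
  - df x + charge_integral (chi x) `[t, x[%classic f.

Definition max_domain t f df : Prop :=
  [/\ abs_cont_loc t b f,
      has_deriv_ae (co_itv t b) f df &
      abs_cont_loc t b (quasi_deriv t f df)].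

(* tau f = h on [t, b). *)
Definition tau_is t f df h : Prop :=
  max_domain t f df /\ has_deriv_ae (co_itv t b) (quasi_deriv t f df) h.

Definition solution t z u du : Prop := tau_is t u du (fun x => z * u x).

Definition dom_Tmax f df : Prop :=
  exists h, [/\ tau_is a f df h, L2 (oo_itv a b) f & L2 (oo_itv a b) h].

Definition wronskian f df g dg x : R[i] := f x * dg x - df x * g x.

(* W_b(f, conj w) = l. *)
Definition wronskian_conj_lim f df w dw (l : R[i]) : Prop :=
  has_limit (left_nbhs b)
    (wronskian f df (fun x => conjc (w x)) (fun x => conjc (dw x))) l.

Definition limit_circle : Prop :=
  forall z u du, solution a z u du -> L2_near a b u.

(* w determines a boundary condition at b in the limit-circle case. *)
Definition boundary_function w dw : Prop :=
  [/\ dom_Tmax w dw, wronskian_conj_lim w dw w dw 0 &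
      exists h dh l, [/\ dom_Tmax h dh, wronskian_conj_lim h dh w dw l & l != 0]].

(* The boundary condition at b, void in the limit-point case. *)
Definition bc_at_b w dw f df : Prop :=
  limit_circle -> wronskian_conj_lim f df w dw 0.

(* M = m(z, t); c and s are the solutions c_t(z, .) and s_t(z, .). *)
Definition is_weyl_number w dw z t (M : R[i]) : Prop :=
  exists c dc s ds,
    [/\ [/\ solution t z c dc, c t = 1 & dc t = 0],
        [/\ solution t z s ds, s t = 0 & ds t = 1],
        L2_near t b (fun x => c x + M * s x) &
        bc_at_b w dw (fun x => c x + M * s x) (fun x => dc x + M * ds x)].

Definition is_weyl_function w dw (m : R[i] -> R -> R[i]) : Prop :=
  forall z t, complex.Im z != 0 -> co_itv a b t -> is_weyl_number w dw z t (m z t).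

(* Integral over (a, b) of a function with compact support in (a, b): the
   integral over (a, c) does not depend on c for c close to b. *)
Definition chi_integral f : R[i] :=
  lim (charge_Rintegral (chi c) `]a, c[%classic (fun x => complex.Re (f x))
       @[c --> left_nbhs b])
  +i* lim (charge_Rintegral (chi c) `]a, c[%classic (fun x => complex.Im (f x))
       @[c --> left_nbhs b]).

End differential_expression.

(* The filter Im z -> oo, within the region where Re sqrt(-z) -> oo as well,
   i.e. where exp(- sqrt(-z)) -> 0.  It is coarser than Im z -> oo along any
   vertical line, any ray in the open upper half-plane, or any sector
   |Re z| <= C Im z.  If Re sqrt(-z) stays bounded, which forces
   Re z >= c (Im z)^2 for some c > 0, waves reflected at b do not decay and the
   expansion of the Weyl function breaks down: for a = 0, b = 2, chi the Dirac
   measure at 1, a Dirichlet condition at b and sqrt(-z) = 1 - iT with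
   T -> +oo, the remainder is phi(1) exp(- 2 sqrt(-z)) / (2 sqrt(-z)) up to
   o(1/T).  Here [sqrtc] is the branch of the square root with Re >= 0. *)
Definition Im_to_infty (R : realType) : set_system R[i] :=
  filter_from [set: R]
    (fun K => [set z : R[i] | K < complex.Im z /\ K < complex.Re (sqrtc (- z))]).

(* r(z) = o(z^(-1/2)) along F. *)
Definition little_o_rsqrt (R : realType) (F : set_system R[i])
    (r : R[i] -> R[i]) : Prop :=
  Normc.normc (r z) / (Num.sqrt (Normc.normc z))^-1 @[z --> F] --> (0 : R).

(* Main.v *)
Require Import Defs.
From HB Require Import structures.
From mathcomp Require Import all_boot all_order all_algebra.
From mathcomp Require Import all_classical all_reals all_analysis.
From mathcomp Require Import measurable_realfun.
From mathcomp.real_closed Require Import complex.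
From mathcomp Require Import ring lra.
Set Implicit Arguments.
Unset Strict Implicit.
Unset Printing Implicit Defensive.
Import Order.TTheory GRing.Theory Num.Theory.
Import numFieldNormedType.Exports.
Local Open Scope classical_set_scope.
Local Open Scope ring_scope.
Local Open Scope complex_scope.

(* Put k = sqrt(-z).  For Im z > 0 one has m(z, t) = u'(t) / u(t) for a single
   solution u of tau u = z u that is nonvanishing on [a, b) and satisfies
   Im z int_x^b |u|^2 <= Im (u'(x) conj u(x)) for all x.
   Fix beta < x1 < x2 < b with phi = 0 on [beta, b) and put p = u'(x1) + k u(x1),
   q = u'(x1) - k u(x1).  The last inequality forces |p| <= 4 |q| once Re k and
   Im z are large, since otherwise u would grow like exp(Re k (x - x1)) on
   [x1, x2].  To the left of x1, u is then a small perturbation of the solution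
   u0 of u0'' = k^2 u0 with the same data at x1, and with r0 = (p/q) exp(2k(t - x1)),
   which is exponentially small on [a, beta],
     u'/u = -k - 2k r0 / (1 - r0) + d,   d = W(u0, u) / (u0 u).
   Since W(u0, u)' = u0 u chi and W(u0, u)(x1) = 0, d is bounded by the integral of
   exp(-2 Re k (s - t)) against |chi| over [t, x1), so that int |d| = O(1 / Re k).
   Integrating W(u0, u) by parts against phi exp(k(t - x1)) / u gives the identity
     2k int phi d = - int phi (1 - r0) dchi - int (1 - r0)(phi' d - phi d^2),
   whose first term is the second order term of the expansion. *)

(** Two obstacles shape the estimates. At an atom of [chi] the function m(z, .) jumps by the mass of
    the atom, so [d] is not small pointwise; only its integral is, and this is why the expansion is
    tested against [phi]. Moreover nothing bounds |k| by Re k in the region considered, so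
    exponential smallness of r0 in Re k does not absorb powers of |k|. The term with the factor k^2
    r0 / (1 - r0) is therefore controlled by its oscillation, at the price of two derivatives of
    [phi]. The quantity estimated is 2k times the remainder, and it is bounded by a constant over Re
    k; as |k| = |z|^(1/2), this is the claim. No asymptotics of the Weyl function are presupposed:
    the behaviour at [b] enters only through the sign of Im (u' conj u). Reflection from the right
    is excluded by playing this energy inequality against exponential growth on the fixed interval
    [x1, x2]. As [chi] may have infinite mass near [b], every perturbative estimate stays on [a,
    x2[. *)

Local Notation N := Normc.normc.

(* [lra] is slow in large contexts: keep only the order hypotheses. *)
Ltac flra :=
  repeat match goal with
  | H : is_true (Order.le _ _) |- _ => revert H
  | H : is_true (Order.lt _ _) |- _ => revert H
  | H : is_true (_ && _) |- _ => revert H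
  | H : @eq (Real.sort _) _ _ |- _ => revert H
  end; clear; intros; lra.

Lemma le_of_eq (R : numDomainType) (x y : R) : x = y -> x <= y.
Proof. by move=> ->. Qed.

(** Cousin's lemma in supremum form: good points accumulate at their supremum, and the step taken
    there carries a good point from its left beyond it, unless [d] is reached. The step allows any
    [y] and [w] on the two sides of the tag [s], so [P] need not be known at [s] itself. *)
Lemma real_induction (R : realType) (t d : R) (P : R -> Prop) :
  t <= d -> P t ->
  (forall s, t <= s <= d -> exists2 e, 0 < e &
     forall y w, t <= y -> y <= s -> s <= w -> w <= d -> s - e < y -> w < s + e ->
       P y -> P w) ->
  P d.
Proof.
move=> td Pt step.
pose S := [set x | t <= x <= d /\ P x].
have S0 : S !=set0 by exists t; split => //; rewrite lexx.
have Sub : has_ubound S by exists d => x [/andP[]].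
have hs : has_sup S by split.
have ts : t <= sup S by apply: ub_le_sup => //; split => //; rewrite lexx.
have sd : sup S <= d by apply: ge_sup => // x [/andP[]].
have [|e e0 he] := step (sup S); first by rewrite ts sd.
have [y [/andP[ty yd] Py] yS] := sup_adherent e0 hs.
have ys : y <= sup S by apply: ub_le_sup => //; split => //; rewrite ty.
have hw w : sup S <= w -> w <= d -> w < sup S + e -> P w.
  by move=> h1 h2 h3; apply: (he y w).
have [dle|dgt] := ltP d (sup S + e); first exact: hw.
have h : P (sup S + e / 2).
  by apply: hw; rewrite ?lerDl ?ltrD2l; lra.
have : sup S + e / 2 <= sup S.
  apply: ub_le_sup => //; split => //; apply/andP; split; lra.
lra.
Qed.

(** * Integrals over half-open intervals *)

Section interval_integrals.
Context (R : realType) (mu : {measure set (measurableTypeR R) -> \bar R}).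
Implicit Types (f : R -> R) (x y z : R).

Lemma itvco_setU x y z : x <= y -> y <= z ->
  `[x, z[%classic = (`[x, y[ `|` `[y, z[)%classic :> set R.
Proof.
move=> xy yz; apply/seteqP; split => s /=; rewrite !in_itv /=; last first.
  by move=> [|] /andP[h1 h2]; apply/andP; split; lra.
move=> /andP[h1 h2]; have [h|h] := ltP s y; [left|right]; lra.
Qed.

Lemma subset_itvco x y x' y' : x' <= x -> y <= y' ->
  (`[x, y[ `<=` `[x', y'[)%classic.
Proof.
by move=> h1 h2 s /=; rewrite !in_itv/= => /andP[h3 h4]; apply/andP; split; lra.
Qed.

(* All integrals run over [x, y[: with the left continuous derivative, the jump
   at x counts and the one at y does not. *)
Definition RI f x y : R := \int[mu]_(s in `[x, y[) f s.

Lemma RI_add f x y z : x <= y -> y <= z ->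
  mu.-integrable `[x, z[ (EFin \o f) -> RI f x z = RI f x y + RI f y z.
Proof.
move=> xy yz fi; rewrite /RI (itvco_setU xy yz) Rintegral_setU //.
- by rewrite -itvco_setU.
- apply/disj_setPS => s [/=]; rewrite !in_itv/= => /andP[_ h1] /andP[h2 _]; lra.
Qed.

Lemma RI0 f x : RI f x x = 0.
Proof. by rewrite /RI set_itvco0 Rintegral_set0. Qed.

Lemma eq_RI f g x y : (forall s, x <= s -> s < y -> f s = g s) -> RI f x y = RI g x y.
Proof.
move=> fg; apply: eq_Rintegral => s; rewrite inE/= in_itv/= => /andP[h1 h2].
exact: fg.
Qed.

Lemma RI_ge0 f x y : (forall s, x <= s -> s < y -> 0 <= f s) -> 0 <= RI f x y.
Proof.
move=> fg; apply: Rintegral_ge0 => s; rewrite /= in_itv/= => /andP[h1 h2].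
exact: fg.
Qed.

Lemma measurable_itvco x y : measurable (`[x, y[%classic : set (measurableTypeR R)).
Proof. exact: measurable_itv. Qed.

Lemma le_norm_RI f x y : mu.-integrable `[x, y[ (EFin \o f) ->
  `|RI f x y| <= RI (fun s => `|f s|) x y.
Proof. by move=> fi; apply: le_normr_Rintegral => //; exact: measurable_itvco. Qed.

Lemma le_RI f g x y : mu.-integrable `[x, y[ (EFin \o f) ->
  mu.-integrable `[x, y[ (EFin \o g) ->
  (forall s, x <= s -> s < y -> f s <= g s) -> RI f x y <= RI g x y.
Proof.
move=> fi gi fg; apply: le_Rintegral => //.
by move=> s /=; rewrite in_itv/= => /andP[h1 h2]; exact: fg.
Qed.

Lemma RIZ f (c : R) x y : mu.-integrable `[x, y[ (EFin \o f) ->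
  RI (fun s => c * f s) x y = c * RI f x y.
Proof. by move=> fi; apply: RintegralZl => //; exact: measurable_itvco. Qed.

Lemma RID f g x y : mu.-integrable `[x, y[ (EFin \o f) ->
  mu.-integrable `[x, y[ (EFin \o g) ->
  RI (fun s => f s + g s) x y = RI f x y + RI g x y.
Proof. by move=> fi gi; apply: RintegralD => //; exact: measurable_itvco. Qed.

Lemma RIB f g x y : mu.-integrable `[x, y[ (EFin \o f) ->
  mu.-integrable `[x, y[ (EFin \o g) ->
  RI (fun s => f s - g s) x y = RI f x y - RI g x y.
Proof. by move=> fi gi; apply: RintegralB => //; exact: measurable_itvco. Qed.

Lemma RI_cst (c : R) x y : RI (fun=> c) x y = c * fine (mu `[x, y[%classic).
Proof. by rewrite /RI Rintegral_cst //; exact: measurable_itvco. Qed.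

Lemma integrable_itvcoS f x y x' y' : x' <= x -> y <= y' ->
  mu.-integrable `[x', y'[ (EFin \o f) -> mu.-integrable `[x, y[ (EFin \o f).
Proof.
move=> h1 h2; apply: integrableS; [exact: measurable_itvco|exact: measurable_itvco|].
exact: subset_itvco.
Qed.

Lemma integrable_restrictT (h : R -> R) (D U : set (measurableTypeR R)) :
  measurable D -> measurable U ->
  mu.-integrable D (EFin \o h) -> mu.-integrable D (EFin \o (h \_ U)).
Proof.
move=> mD mU hi; rewrite -restrict_EFin.
apply/(integrable_restrict mu mU mD (EFin \o h)).
by apply: integrableS hi => //; exact: measurableI.
Qed.

Lemma integrable_patchT (h : R -> R) (D : set (measurableTypeR R)) :
  measurable D ->
  mu.-integrable D (EFin \o h) -> mu.-integrable setT (EFin \o (h \_ D)).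
Proof.
move=> mD hi; rewrite -restrict_EFin; exact: ((integrable_mkcond _ mD).1 hi).
Qed.

End interval_integrals.

(** * The fundamental theorem of calculus for absolutely continuous functions *)

Lemma is_derive_near (R : realType) (H : R -> R) (s l : R) : is_derive s 1 H l ->
  forall eps, 0 < eps -> exists2 e, 0 < e &
   forall w, `|w - s| < e -> `|H w - H s - l * (w - s)| <= eps * `|w - s|.
Proof.
move=> [dH eH] eps eps0.
have := dH; rewrite /derivable => /cvg_ex[l' hl'].
have el : l' = l.
  by rewrite -eH /derive; apply/esym; apply: (cvg_lim _ hl'); exact: Rhausdorff.
move: hl'; rewrite el => /cvgrPdist_le /(_ _ eps0).
rewrite near_withinE => /nbhs_ballP[e /= e0 he].
exists e => // w hw.
have [->|ws] := eqVneq w s; first by rewrite !subrr mulr0 subrr normr0 mulr0.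
have ws0 : w - s != 0 by rewrite subr_eq0.
have := he (w - s); rewrite /ball/= sub0r normrN => /(_ hw ws0).
rewrite /= scaler1 subrK => h.
rewrite -ler_pdivrMr ?normr_gt0//.
rewrite -normfV -normrM.
rewrite (_ : _ * _ = - (l - (w - s)^-1 *: (H w - H s))) ?normrN//.
rewrite /GRing.scale/=; field.
by [].
Qed.

Section ftc.
Context (R : realType).
Notation leb := (@lebesgue_measure R).

(** Real version of [abs_cont], to be applied to real and imaginary parts separately. *)
Definition acR (c d : R) (F : R -> R) : Prop :=
  forall eps : R, 0 < eps -> exists2 delta : R, 0 < delta &
    forall (n : nat) (u v : 'I_n -> R),
      (forall i, c <= u i /\ u i <= v i /\ v i <= d) ->
      trivIset setT (fun i => `]u i, v i[%classic) ->
      \sum_(i < n) (v i - u i) < delta ->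
      \sum_(i < n) `|F (v i) - F (u i)| < eps.

Lemma leb_itvco_lty (x y : R) : (leb `[x, y[%classic < +oo)%E.
Proof. by rewrite lebesgue_measure_itv/= lte_fin; case: ifP => _; rewrite ?ltry. Qed.

Lemma leb_itvco (x y : R) : x <= y -> leb `[x, y[%classic = (y - x)%:E.
Proof.
move=> xy; rewrite lebesgue_measure_itv/= lte_fin; case: ltP => // h.
by rewrite (@le_anti _ _ x y) ?subrr// xy h.
Qed.

(* Cousin-type covering argument: outside a null set the increments of
   F - int g are o(length); the null set is covered by an open set U of small
   length, where the absolute continuity of F takes over. *)
Lemma ftc_ac (F g : R -> R) (t d : R) : t <= d -> acR t d F ->
  {ae leb, forall x, t <= x <= d -> is_derive x 1 F (g x)} ->
  leb.-integrable `[t, d[ (EFin \o g) ->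
  F d - F t = RI leb g t d.
Proof.
move=> td acF dF gi.
have mI (x y : R) : measurable (`[x, y[%classic : set (measurableTypeR R)).
  exact: measurable_itv.
pose gD := g \_ (`[t, d[%classic).
have gDi : leb.-integrable setT (EFin \o gD).
  exact: integrable_patchT.
pose Phi x := \int[leb]_(s in `[t, x]) gD s.
have iD (E : set (measurableTypeR R)) : measurable E -> leb.-integrable E (EFin \o gD).
  by move=> mE; apply: integrableS gDi.
have PhiE x y : t <= x -> x <= y -> Phi y - Phi x = RI leb gD x y.
  move=> tx xy.
  have h z : Phi z = RI leb gD t z by rewrite /Phi -Rintegral_itv_bndo_bndc//; exact: iD.
  rewrite !h (RI_add tx xy); first by rewrite addrC addKr.
  exact: iD.
pose H x := F x - Phi x.
suff HH : forall eps, 0 < eps -> `|H d - H t| <= eps.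
  have : H d - H t = 0.
    apply/eqP; rewrite -normr_le0; apply/ler_addgt0Pr => e e0; rewrite add0r.
    exact: HH.
  rewrite /H (_ : F d - Phi d - _ = (F d - F t) - (Phi d - Phi t)); last by ring.
  move/eqP; rewrite subr_eq0 => /eqP ->; rewrite PhiE//.
  apply: eq_RI => s s1 s2; rewrite /gD patchE mem_set//=.
  by rewrite in_itv/= s1 s2.
move=> eps0 eps00.
(* The error consists of [eps * (d - t)] from the good tags, [eps] from [F] on the exceptional
   intervals and [eps] from the integral of [|gD|] over [U]. *)
pose eps := eps0 / (d - t + 2).
have e0 : 0 < eps by rewrite divr_gt0//; flra.
have [del1 del10 hac] := acF _ e0.
have [del2 [del20 hB]] := integral_normr_continuous gDi e0.
have dPhi : {ae leb, forall x, t < x -> is_derive x 1 Phi (gD x)}.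
  have := @FTC1 R gD (BLeft t) _ _.
  move=> /(_ (fun y => iD _ (measurable_itv _))) /=.
  have -> : gD = gD \_ setT by rewrite patch_setT.
  move=> /(_ (integrable_locally measurableT _)).
  rewrite patch_setT => /(_ gDi); apply: (@filterS _ _ (ae_filter_ringOfSetsType _)) => x h tx.
  have [|h1 h2] := h; first by rewrite lte_fin.
  have h3 : 'D_1 Phi x = gD x by rewrite -derive1E; exact: h2.
  exact: (DeriveDef h1 h3).
have dH : {ae leb, forall x, t <= x <= d -> x != t -> x != d -> is_derive x 1 H 0}.
  move: dF dPhi; apply: (@filterS2 _ _ (ae_filter_ringOfSetsType _)) => x h1 h2 xtd xt xd.
  have tx : t < x by rewrite lt_neqAle eq_sym xt; case/andP: xtd.
  have xd' : x < d by rewrite lt_neqAle xd; case/andP: xtd.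
  have h3 := h1 xtd; have h4 := h2 tx.
  have -> : (0 : R) = g x - gD x.
    rewrite /gD patchE mem_set ?subrr//= in_itv/= xd'; flra.
  exact: is_deriveB.
case: dH => A0 [mA0 A00 hA0].
(* The endpoints join the null set: [Phi] is differentiated only at points [t < x], and [gD] agrees
   with [g] only on [[t, d[]. *)
pose A := A0 `|` [set t] `|` [set d].
have mA : measurable A.
  by apply: measurableU; [apply: measurableU|].
have A0' : leb A = 0%E.
  rewrite /A measureU0//; last exact: lebesgue_measure_set1.
  - by rewrite measureU0//; exact: lebesgue_measure_set1.
  - exact: measurableU.
have hA x : t <= x <= d -> ~ A x -> is_derive x 1 H 0.
  move=> xtd nA; apply: contrapT => nd; apply: nA.
  have [->|xt] := eqVneq x t; first by left; right.
  have [->|xd] := eqVneq x d; first by right.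
  by left; left; apply: hA0 => /= /(_ xtd xt xd).
pose del := Num.min del1 del2.
have del0 : 0 < del by rewrite lt_min del10 del20.
have Alt : (leb A < +oo)%E by rewrite A0' ltry.
have [U [oU AU hU]] := lebesgue_regularity_outer mA Alt del0.
have mU : measurable U by exact: open_measurable.
have lU : (leb U < del%:E)%E.
  rewrite -(setDUK AU); apply: (le_lt_trans (measureU2 _ mA (measurableD mU mA))).
  by have -> : (leb A + leb (U `\` A) = leb (U `\` A))%E by rewrite A0' add0e.
(* [L] and [B] are the length of [U] and the mass of [|gD|] on [U] to the left of [x]: monotone
   budgets to which each exceptional interval is charged. *)
pose L x := RI leb ((fun=> 1 : R) \_ U) t x.
pose B x := RI leb ((fun s => `|gD s|) \_ U) t x.
have i1 x y : leb.-integrable `[x, y[ (EFin \o ((fun=> 1 : R) \_ U)).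
  apply: integrable_restrictT => //.
  apply: measurable_bounded_integrable => //; first exact: leb_itvco_lty.
  by exists 1; split => // M hM s _ /=; rewrite normr1 ltW.
have i2 x y : leb.-integrable `[x, y[ (EFin \o ((fun s => `|gD s|) \_ U)).
  apply: integrable_restrictT => //.
  exact: (integrable_norm (iD _ (mI x y))).
have LE x y : t <= x -> x <= y -> (`[x, y[ `<=` U)%classic -> L y = L x + (y - x).
  move=> tx xy xyU; rewrite /L (RI_add tx xy)//; congr (_ + _).
  rewrite (_ : y - x = RI leb (fun=> 1) x y); last first.
    by rewrite RI_cst mul1r; exact: (esym (congr1 fine (leb_itvco xy))).
  apply: eq_RI => s s1 s2; rewrite patchE mem_set//; apply: xyU.
  by rewrite /= in_itv/= s1 s2.
have Lmono x y : t <= x -> x <= y -> L x <= L y.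
  move=> tx xy; rewrite /L (RI_add tx xy)// lerDl RI_ge0// => s _ _.
  by rewrite patchE; case: ifP.
have Bmono x y : t <= x -> x <= y -> B x <= B y.
  move=> tx xy; rewrite /B (RI_add tx xy)// lerDl RI_ge0// => s _ _.
  by rewrite patchE; case: ifP.
have BE x y : t <= x -> x <= y -> (`[x, y[ `<=` U)%classic -> `|Phi y - Phi x| <= B y - B x.
  move=> tx xy xyU; rewrite /B (RI_add tx xy)// [X in _ <= X]addrC addKr PhiE//.
  apply: (le_trans (le_norm_RI _)); first exact: iD.
  rewrite [leRHS](@eq_RI _ _ _ (fun s => `|gD s|))// => s s1 s2.
  by rewrite patchE mem_set//; apply: xyU; rewrite /= in_itv/= s1 s2.
(* The invariant carries the whole list of exceptional intervals met so far, because the absolute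
   continuity of [F] has to be applied to all of them at once. *)
pose P x := exists n (u v : nat -> R),
  [/\ forall i, (i < n)%N -> t <= u i /\ u i <= v i /\ v i <= x,
      forall i j, (i < j < n)%N -> v i <= u j,
      \sum_(i < n) (v i - u i) <= L x &
      `|H x - H t| <= eps * (x - t) + \sum_(i < n) `|F (v i) - F (u i)| + B x].
suff [n [u [v [uv disj lL hH]]]] : P d.
  have Ud : (leb (`[t, d[ `&` U)%classic < del%:E)%E.
    apply: le_lt_trans lU; apply: le_measure; rewrite ?inE//; exact: measurableI.
  have Ld : L d < del.
    rewrite /L /RI -Rintegral_mkcondr (Rintegral_cst _ (measurableI _ _ (mI _ _) mU)) mul1r.
    rewrite -lte_fin fineK// ge0_fin_numE//.
    by apply: lt_trans Ud _; rewrite ltry.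
  have Bd : B d < eps.
    rewrite /B /RI -Rintegral_mkcondr; apply: hB; first exact: measurableI.
    by apply: lt_le_trans Ud _; rewrite lee_fin ge_min lexx orbT.
  have hF : \sum_(i < n) `|F (v i) - F (u i)| < eps.
    apply: (hac n (fun i => u i) (fun i => v i)).
    - by move=> i; apply: uv.
    - move=> i j _ _ [s [/=]]; rewrite !in_itv/= => /andP[a1 a2] /andP[a3 a4].
      apply/val_inj/eqP; rewrite eqn_leq; apply/andP; split; rewrite leqNgt; apply/negP => ij.
      + have := disj j i; rewrite ij/= ltn_ord => /(_ isT); flra.
      + have := disj i j; rewrite ij/= ltn_ord => /(_ isT); flra.
    - apply: le_lt_trans lL _; apply: lt_le_trans Ld _; by rewrite ge_min lexx.
  apply: (le_trans hH).
  have -> : eps0 = eps * (d - t + 2) by rewrite /eps divfK//; flra.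
  rewrite mulrDr; flra.
apply: (@real_induction R t d P td).
  exists 0%N, (fun=> 0), (fun=> 0); split => //.
  - by rewrite big_ord0 /L RI0 lexx.
  - by rewrite !subrr normr0 mulr0 big_ord0 /B RI0 !addr0 lexx.
(* A tag in [A] appends the interval from [y] to [w], which lies in [U], to the list. At any other
   tag [H] has derivative 0, and its increment is at most [eps * (w - y)]. *)
move=> s std; have [sA|sA] := pselect (A s).
  have [/= e e0' he] := (nbhs_ballP _ _).1 (open_nbhs_nbhs (conj oU (AU _ sA))).
  exists e => // y w ty ys sw wd h1 h2 [n [u [v [uv disj lL hH]]]].
  have yw : y <= w by flra.
  have ywU : (`[y, w[ `<=` U)%classic.
    move=> r /=; rewrite in_itv/= => /andP[h3 h4]; apply: he.
    by rewrite /ball/= ltr_norml; apply/andP; split; flra.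
  exists n.+1, (fun i => if (i < n)%N then u i else y), (fun i => if (i < n)%N then v i else w).
  split.
  - move=> i; rewrite ltnS leq_eqVlt => /orP[/eqP ->|h].
      by rewrite ltnn; split => //.
    rewrite h; have [? [? ?]] := uv i h; do 2!split => //; flra.
  - move=> i j /andP[ij]; rewrite ltnS leq_eqVlt => /orP[/eqP ejn|h].
      rewrite ejn ltnn -ejn ij; have [? [? ?]] := uv i (eq_rect _ (fun k => (i < k)%N) ij _ ejn); flra.
    by rewrite h (ltn_trans ij h); apply: disj; rewrite ij.
  - rewrite big_ord_recr/= ltnn (LE y w)// lerD2r.
    by under eq_bigr => i _ do rewrite ltn_ord.
  - rewrite big_ord_recr/= ltnn.
    under eq_bigr => i _ do rewrite ltn_ord.
    have hb := BE y w ty yw ywU.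
    rewrite (_ : H w - H t = (H y - H t) + ((F w - F y) - (Phi w - Phi y))); last by rewrite /H; ring.
    apply: (le_trans (ler_normD _ _)).
    have := ler_normB (F w - F y) (Phi w - Phi y).
    have : eps * (y - t) <= eps * (w - t) by rewrite ler_pM2l//; flra.
    flra.
have [e e0' he] := is_derive_near (hA s std sA) e0.
exists e => // y w ty ys sw wd h1 h2 [n [u [v [uv disj lL hH]]]].
have yw : y <= w by flra.
exists n, u, v; split => //.
- by move=> i h; have [? [? ?]] := uv i h; do 2!split => //; flra.
- by apply: le_trans lL _; apply: Lmono.
- rewrite (_ : H w - H t = (H y - H t) + ((H w - H s) - (H y - H s))); last by ring.
  apply: (le_trans (ler_normD _ _)).
  have b1 : `|H w - H s| <= eps * (w - s).
    have := he w; rewrite mul0r subr0 ger0_norm; last by flra.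
    apply; flra.
  have b2 : `|H y - H s| <= eps * (s - y).
    have := he y; rewrite mul0r subr0 ler0_norm; last by flra.
    rewrite opprB; apply; flra.
  have := ler_normB (H w - H s) (H y - H s).
  have := Bmono y w ty yw.
  rewrite (_ : w - t = (y - t) + (s - y) + (w - s)); last by ring.
  rewrite !mulrDr; flra.
Qed.

End ftc.

(** * Modulus and integrals of complex-valued functions *)

Section complex_norm.
Context (R : realType).
Implicit Types (x y : R[i]) (r : R).

Lemma cReM x y : complex.Re (x * y) =
  complex.Re x * complex.Re y - complex.Im x * complex.Im y.
Proof. by case: x y => [a b] [c d]. Qed.
Lemma cImM x y : complex.Im (x * y) =
  complex.Re x * complex.Im y + complex.Im x * complex.Re y.
Proof. by case: x y => [a b] [c d]. Qed.
Lemma cReD x y : complex.Re (x + y) = complex.Re x + complex.Re y.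
Proof. by case: x y => [a b] [c d]. Qed.
Lemma cImD x y : complex.Im (x + y) = complex.Im x + complex.Im y.
Proof. by case: x y => [a b] [c d]. Qed.
Lemma cReN x : complex.Re (- x) = - complex.Re x.
Proof. by case: x. Qed.
Lemma cImN x : complex.Im (- x) = - complex.Im x.
Proof. by case: x. Qed.
Lemma cReJ x : complex.Re (conjc x) = complex.Re x.
Proof. by case: x. Qed.
Lemma cImJ x : complex.Im (conjc x) = - complex.Im x.
Proof. by case: x. Qed.
Definition reim := (cReM, cImM, cReD, cImD, cReN, cImN, cReJ, cImJ).

Lemma complex_ext x y : complex.Re x = complex.Re y -> complex.Im x = complex.Im y -> x = y.
Proof. by case: x y => [a b] [c d] /= -> ->. Qed.

Lemma N_ge0 x : 0 <= N x.
Proof. by case: x => a b /=; apply: sqrtr_ge0. Qed.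
Lemma N0 : N (0 : R[i]) = 0.
Proof. exact: Normc.normc0. Qed.
Lemma N1 : N (1 : R[i]) = 1.
Proof. exact: Normc.normc1. Qed.
Lemma NM x y : N (x * y) = N x * N y.
Proof. exact: Normc.normcM. Qed.
Lemma NV x : N (x^-1) = (N x)^-1.
Proof. exact: Normc.normcV. Qed.
Lemma ND x y : N (x + y) <= N x + N y.
Proof. exact: le_normcD. Qed.
Lemma NN x : N (- x) = N x.
Proof. exact: normcN. Qed.
Lemma NB x y : N (x - y) <= N x + N y.
Proof. by rewrite -(NN y); exact: ND. Qed.
Lemma NBC x y : N (x - y) = N (y - x).
Proof. by rewrite -NN opprB. Qed.
Lemma N_eq0 x : N x = 0 -> x = 0.
Proof. exact: Normc.eq0_normc. Qed.
Lemma N_gt0 x : x != 0 -> 0 < N x.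
Proof.
move=> x0; rewrite lt_neqAle N_ge0 andbT eq_sym.
by apply: contra x0 => /eqP /N_eq0 ->.
Qed.
Lemma Nsq x : N x ^+ 2 = complex.Re x ^+ 2 + complex.Im x ^+ 2.
Proof. by case: x => a b /=; rewrite sqr_sqrtr// addr_ge0// sqr_ge0. Qed.
Lemma NJ x : N (conjc x) = N x.
Proof. by case: x => a b /=; rewrite sqrrN. Qed.
Lemma NR r : N (r%:C) = `|r|.
Proof. by rewrite /= expr0n/= addr0 sqrtr_sqr. Qed.
Lemma N_Re x : `|complex.Re x| <= N x.
Proof.
rewrite -(ler_pXn2r (n := 2))// ?nnegrE ?N_ge0// Nsq real_normK ?num_real// lerDl.
exact: sqr_ge0.
Qed.
Lemma N_Im x : `|complex.Im x| <= N x.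
Proof.
rewrite -(ler_pXn2r (n := 2))// ?nnegrE ?N_ge0// Nsq real_normK ?num_real// lerDr.
exact: sqr_ge0.
Qed.
Lemma N_le x : N x <= `|complex.Re x| + `|complex.Im x|.
Proof.
rewrite -(ler_pXn2r (n := 2))// ?nnegrE ?N_ge0 ?addr_ge0// Nsq sqrrD !real_normK ?num_real//.
by rewrite -addrA lerD2l lerDr mulrn_wge0// mulr_ge0.
Qed.
Lemma N_geB x y : N x - N y <= N (x - y).
Proof. by rewrite lerBlDr; apply: le_trans (ND _ _); rewrite subrK. Qed.
Lemma mulcJ x : x * conjc x = (N x ^+ 2)%:C.
Proof. by apply: complex_ext; rewrite !reim ?Nsq /=; ring. Qed.

End complex_norm.

Section complex_integrals.
Context (R : realType).

Definition meas (x y : R) (f : R -> R) :=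
  measurable_fun (`[x, y[%classic : set (measurableTypeR R)) f.

Definition cmeas (x y : R) (f : R -> R[i]) :=
  meas x y (fun s => complex.Re (f s)) /\ meas x y (fun s => complex.Im (f s)).

(** Boundedness makes the class stable under products and integrable against every measure that is
    finite on bounded intervals, atoms included. *)
Definition bmeas (x y : R) (f : R -> R[i]) :=
  cmeas x y f /\ exists M, forall s, x <= s -> s < y -> N (f s) <= M.

Lemma meas_sub x y x' y' f : x' <= x -> y <= y' -> meas x' y' f -> meas x y f.
Proof.
move=> h1 h2; apply: measurable_funS; [exact: measurable_itvco|exact: subset_itvco].
Qed.

Lemma eq_meas x y f g : (forall s, x <= s -> s < y -> f s = g s) ->
  meas x y f -> meas x y g.
Proof.
move=> fg; apply: eq_measurable_fun => s; rewrite inE/= in_itv/= => /andP[h1 h2].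
exact: fg.
Qed.

Lemma cmeas_sub x y x' y' f : x' <= x -> y <= y' -> cmeas x' y' f -> cmeas x y f.
Proof. by move=> h1 h2 [m1 m2]; split; [apply: meas_sub m1|apply: meas_sub m2]. Qed.

Lemma bmeas_sub x y x' y' f : x' <= x -> y <= y' -> bmeas x' y' f -> bmeas x y f.
Proof.
move=> h1 h2 [m1 [M hM]]; split; first by apply: cmeas_sub m1.
by exists M => s s1 s2; apply: hM; flra.
Qed.

Lemma eq_cmeas x y f g : (forall s, x <= s -> s < y -> f s = g s) ->
  cmeas x y f -> cmeas x y g.
Proof.
by move=> fg [m1 m2]; split; [apply: eq_meas m1|apply: eq_meas m2] => s s1 s2;
  rewrite fg.
Qed.

Lemma eq_bmeas x y f g : (forall s, x <= s -> s < y -> f s = g s) ->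
  bmeas x y f -> bmeas x y g.
Proof.
move=> fg [m [M hM]]; split; first exact: eq_cmeas m.
by exists M => s s1 s2; rewrite -fg//; exact: hM.
Qed.

Lemma cmeasM x y f g : cmeas x y f -> cmeas x y g -> cmeas x y (fun s => f s * g s).
Proof.
move=> [f1 f2] [g1 g2]; split.
  under eq_fun do rewrite cReM.
  by apply: measurable_funB; apply: measurable_funM.
under eq_fun do rewrite cImM.
by apply: measurable_funD; apply: measurable_funM.
Qed.

Lemma cmeasD x y f g : cmeas x y f -> cmeas x y g -> cmeas x y (fun s => f s + g s).
Proof.
move=> [f1 f2] [g1 g2]; split.
  by under eq_fun do rewrite cReD; apply: measurable_funD.
by under eq_fun do rewrite cImD; apply: measurable_funD.
Qed.

Lemma cmeas_cst x y c : cmeas x y (fun=> c).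
Proof. by split; apply: measurable_cst. Qed.

Lemma cmeasJ x y f : cmeas x y f -> cmeas x y (fun s => conjc (f s)).
Proof.
move=> [f1 f2]; split.
  by under eq_fun do rewrite cReJ.
under eq_fun do rewrite cImJ.
exact: measurable_funN.
Qed.

Lemma meas_sqN x y f : cmeas x y f -> meas x y (fun s => N (f s) ^+ 2).
Proof.
move=> [f1 f2]; under eq_fun do rewrite Nsq.
by apply: measurable_funD; apply: measurable_funX.
Qed.

Lemma measN x y f : cmeas x y f -> meas x y (fun s => N (f s)).
Proof.
move=> /meas_sqN; set g := fun s => _ => mg.
have -> : (fun s => N (f s)) = (@Num.sqrt R) \o g.
  by apply/funext => s; rewrite /g/= sqrtr_sqr ger0_norm// N_ge0.
apply: measurableT_comp => //.
exact: continuous_measurable_fun (@sqrt_continuous R).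
Qed.

Lemma bmeasM x y f g : bmeas x y f -> bmeas x y g -> bmeas x y (fun s => f s * g s).
Proof.
move=> [f1 [M hM]] [g1 [M' hM']]; split; first exact: cmeasM.
exists (M * M') => s s1 s2; rewrite NM; apply: ler_pM; rewrite ?N_ge0 ?hM ?hM'//.
Qed.

Lemma bmeasD x y f g : bmeas x y f -> bmeas x y g -> bmeas x y (fun s => f s + g s).
Proof.
move=> [f1 [M hM]] [g1 [M' hM']]; split; first exact: cmeasD.
exists (M + M') => s s1 s2; apply: (le_trans (ND _ _)); apply: lerD; rewrite ?hM ?hM'//.
Qed.

Lemma bmeas_cst x y c : bmeas x y (fun=> c).
Proof. by split; [exact: cmeas_cst|exists (N c)]. Qed.

Lemma bmeasN x y f : bmeas x y f -> bmeas x y (fun s => - f s).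
Proof.
move=> /(bmeasM (bmeas_cst x y (-1))); apply: eq_bmeas => s _ _.
by rewrite mulN1r.
Qed.

Lemma bmeasB x y f g : bmeas x y f -> bmeas x y g -> bmeas x y (fun s => f s - g s).
Proof. by move=> h1 /bmeasN; exact: bmeasD. Qed.

Lemma bmeasJ x y f : bmeas x y f -> bmeas x y (fun s => conjc (f s)).
Proof.
move=> [f1 [M hM]]; split; first exact: cmeasJ.
by exists M => s s1 s2; rewrite NJ hM.
Qed.

Lemma bmeasZ x y c f : bmeas x y f -> bmeas x y (fun s => c * f s).
Proof. by apply: bmeasM; exact: bmeas_cst. Qed.

Section fixed_measure.
Variable mu : {measure set (measurableTypeR R) -> \bar R}.

Definition CI (f : R -> R[i]) (x y : R) : R[i] :=
  RI mu (fun s => complex.Re (f s)) x y +i* RI mu (fun s => complex.Im (f s)) x y.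

Definition cI (x y : R) (f : R -> R[i]) :=
  mu.-integrable `[x, y[ (EFin \o (fun s => complex.Re (f s))) /\
  mu.-integrable `[x, y[ (EFin \o (fun s => complex.Im (f s))).

Lemma ReCI f x y : complex.Re (CI f x y) = RI mu (fun s => complex.Re (f s)) x y.
Proof. by []. Qed.
Lemma ImCI f x y : complex.Im (CI f x y) = RI mu (fun s => complex.Im (f s)) x y.
Proof. by []. Qed.

Lemma cI_sub x y x' y' f : x' <= x -> y <= y' -> cI x' y' f -> cI x y f.
Proof. by move=> h1 h2 [m1 m2]; split; [apply: integrable_itvcoS m1|apply: integrable_itvcoS m2]. Qed.

Lemma eq_integrable_itvco x y (f g : R -> R) : (forall s, x <= s -> s < y -> f s = g s) ->
  mu.-integrable `[x, y[ (EFin \o f) -> mu.-integrable `[x, y[ (EFin \o g).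
Proof.
move=> fg; apply: eq_integrable => [|s]; first exact: measurable_itvco.
by rewrite inE/= in_itv/= => /andP[h1 h2]; rewrite fg.
Qed.

Lemma eq_cI x y f g : (forall s, x <= s -> s < y -> f s = g s) -> cI x y f -> cI x y g.
Proof.
by move=> fg [m1 m2]; split; [apply: eq_integrable_itvco m1|apply: eq_integrable_itvco m2] => s s1 s2;
  rewrite fg.
Qed.

Lemma eq_CI f g x y : (forall s, x <= s -> s < y -> f s = g s) -> CI f x y = CI g x y.
Proof. by move=> fg; apply: complex_ext; apply: eq_RI => s s1 s2; rewrite fg. Qed.

Lemma cI_meas x y f : cI x y f -> cmeas x y f.
Proof.
by move=> [m1 m2]; split; apply/measurable_EFinP; [case/integrableP: m1|case/integrableP: m2].
Qed.

Lemma CI_add f x y z : x <= y -> y <= z -> cI x z f -> CI f x z = CI f x y + CI f y z.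
Proof.
by move=> xy yz [m1 m2]; apply: complex_ext; rewrite !reim; apply: RI_add.
Qed.

Lemma CI0 f x : CI f x x = 0.
Proof. by apply: complex_ext; apply: RI0. Qed.

Lemma integrableD_itvco x y (f g : R -> R) :
  mu.-integrable `[x, y[ (EFin \o f) -> mu.-integrable `[x, y[ (EFin \o g) ->
  mu.-integrable `[x, y[ (EFin \o (fun s => f s + g s)).
Proof. by move=> fi gi; exact: (integrableD (measurable_itvco x y) fi gi). Qed.

Lemma integrableZ_itvco x y (c : R) (f : R -> R) :
  mu.-integrable `[x, y[ (EFin \o f) ->
  mu.-integrable `[x, y[ (EFin \o (fun s => c * f s)).
Proof. by move=> fi; exact: (integrableZl (measurable_itvco x y) c fi). Qed.

Lemma integrableB_itvco x y (f g : R -> R) :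
  mu.-integrable `[x, y[ (EFin \o f) -> mu.-integrable `[x, y[ (EFin \o g) ->
  mu.-integrable `[x, y[ (EFin \o (fun s => f s - g s)).
Proof. by move=> fi gi; exact: (integrableB (measurable_itvco x y) fi gi). Qed.

Lemma cID x y f g : cI x y f -> cI x y g -> cI x y (fun s => f s + g s).
Proof.
move=> [f1 f2] [g1 g2]; split.
  by apply: eq_integrable_itvco (integrableD_itvco f1 g1) => s _ _; rewrite cReD.
by apply: eq_integrable_itvco (integrableD_itvco f2 g2) => s _ _; rewrite cImD.
Qed.

Lemma cIZ x y c f : cI x y f -> cI x y (fun s => c * f s).
Proof.
move=> [f1 f2]; split.
  apply: eq_integrable_itvco (integrableB_itvco (integrableZ_itvco (complex.Re c) f1)
    (integrableZ_itvco (complex.Im c) f2)) => s _ _; by rewrite cReM.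
apply: eq_integrable_itvco (integrableD_itvco (integrableZ_itvco (complex.Re c) f2)
    (integrableZ_itvco (complex.Im c) f1)) => s _ _; by rewrite cImM.
Qed.

Lemma cIN x y f : cI x y f -> cI x y (fun s => - f s).
Proof. by move=> /(cIZ (-1)); apply: eq_cI => s _ _; rewrite mulN1r. Qed.

Lemma cIB x y f g : cI x y f -> cI x y g -> cI x y (fun s => f s - g s).
Proof. by move=> h /cIN; exact: cID. Qed.

Lemma CID f g x y : cI x y f -> cI x y g -> CI (fun s => f s + g s) x y = CI f x y + CI g x y.
Proof.
move=> [f1 f2] [g1 g2]; apply: complex_ext; rewrite !reim /= -RID//; apply: eq_RI => s _ _;
  by rewrite reim.
Qed.

Lemma CIZ f c x y : cI x y f -> CI (fun s => c * f s) x y = c * CI f x y.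
Proof.
move=> [f1 f2]; apply: complex_ext; rewrite !reim/= -!RIZ//.
  by rewrite -RIB; [apply: eq_RI => s _ _; rewrite reim|apply: integrableZ_itvco..].
by rewrite -RID; [apply: eq_RI => s _ _; rewrite reim|apply: integrableZ_itvco..].
Qed.

Lemma CIN f x y : cI x y f -> CI (fun s => - f s) x y = - CI f x y.
Proof.
by move=> fi; rewrite -mulN1r -CIZ//; apply: eq_CI => s _ _; rewrite mulN1r.
Qed.

Lemma CIB f g x y : cI x y f -> cI x y g -> CI (fun s => f s - g s) x y = CI f x y - CI g x y.
Proof. by move=> fi gi; rewrite CID ?CIN//; exact: cIN. Qed.

Lemma cI_bounded x y f (g : R -> R) : cmeas x y f ->
  mu.-integrable `[x, y[ (EFin \o g) ->
  (forall s, x <= s -> s < y -> N (f s) <= g s) -> cI x y f.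
Proof.
move=> [m1 m2] gi fg; split.
  apply: (le_integrable _ _ _ gi); first exact: measurable_itvco.
    exact/measurable_EFinP.
  move=> s /=; rewrite in_itv/= => /andP[s1 s2]; rewrite lee_fin.
  apply: (le_trans (N_Re _)); apply: (le_trans (fg s s1 s2)); exact: ler_norm.
apply: (le_integrable _ _ _ gi); first exact: measurable_itvco.
  exact/measurable_EFinP.
move=> s /=; rewrite in_itv/= => /andP[s1 s2]; rewrite lee_fin.
apply: (le_trans (N_Im _)); apply: (le_trans (fg s s1 s2)); exact: ler_norm.
Qed.

Lemma cI_norm x y f : cI x y f -> mu.-integrable `[x, y[ (EFin \o (fun s => N (f s))).
Proof.
move=> fi; have [f1 f2] := fi.
have mI := measurable_itvco x y.
apply: (le_integrable mI _ _ (integrableD_itvco (integrable_norm f1) (integrable_norm f2))).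
  by apply/measurable_EFinP; exact: measN (cI_meas fi).
move=> s _ /=; rewrite lee_fin ger0_norm ?N_ge0//; apply: (le_trans (N_le _)).
exact: ler_norm.
Qed.

(* The factor 2 is crude but spares a rotation of the integrand. *)
Lemma N_CI f (g : R -> R) x y : cmeas x y f ->
  mu.-integrable `[x, y[ (EFin \o g) ->
  (forall s, x <= s -> s < y -> N (f s) <= g s) -> N (CI f x y) <= 2 * RI mu g x y.
Proof.
move=> mf gi fg; have [f1 f2] := cI_bounded mf gi fg.
apply: (le_trans (N_le _)); rewrite mulr2n mulrDl mul1r; apply: lerD.
  apply: (le_trans (le_norm_RI f1)); apply: le_RI => //; first exact: integrable_norm.
  by move=> s s1 s2; apply: (le_trans (N_Re _)); exact: fg.
apply: (le_trans (le_norm_RI f2)); apply: le_RI => //; first exact: integrable_norm.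
by move=> s s1 s2; apply: (le_trans (N_Im _)); exact: fg.
Qed.

Section locally_finite.
Hypothesis mufin : forall x y, (mu `[x, y[%classic < +oo)%E.

Lemma meas_bounded_integrable x y (f : R -> R) M : meas x y f ->
  (forall s, x <= s -> s < y -> `|f s| <= M) -> mu.-integrable `[x, y[ (EFin \o f).
Proof.
move=> mf fM; apply: measurable_bounded_integrable => //.
exists M; split; first exact: num_real.
move=> M' MM' s /=; rewrite in_itv/= => /andP[s1 s2].
exact: (le_trans (fM s s1 s2) (ltW MM')).
Qed.

Lemma cst_integrable x y (c : R) : mu.-integrable `[x, y[ (EFin \o (fun=> c)).
Proof. by apply: (@meas_bounded_integrable _ _ _ `|c|) => //; exact: measurable_cst. Qed.

Lemma bmeas_cI x y f : bmeas x y f -> cI x y f.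
Proof. by move=> [mf [M fM]]; apply: (cI_bounded mf (cst_integrable x y M)). Qed.

Lemma cI_mulb x y f g : cI x y f -> bmeas x y g -> cI x y (fun s => f s * g s).
Proof.
move=> fi [mg [M gM]].
apply: (@cI_bounded _ _ _ (fun s => M * N (f s))).
- by apply: cmeasM => //; exact: cI_meas.
- by apply: integrableZ_itvco; exact: cI_norm.
- by move=> s s1 s2; rewrite NM mulrC ler_wpM2r ?N_ge0 ?gM.
Qed.

Lemma N_CI_cst f M x y : cmeas x y f ->
  (forall s, x <= s -> s < y -> N (f s) <= M) ->
  N (CI f x y) <= 2 * (M * fine (mu `[x, y[%classic)).
Proof. by move=> mf fM; rewrite -RI_cst; apply: N_CI => //; exact: cst_integrable. Qed.

End locally_finite.
End fixed_measure.
End complex_integrals.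

(** * Fubini's theorem on a triangle *)

Section fubini_triangle.
Context (R : realType).
Notation leb := (@lebesgue_measure R).
Notation mR := (measurableTypeR R).

Lemma integral_patch_RI (mu : {measure set mR -> \bar R}) (k : R -> R) x y :
  mu.-integrable `[x, y[ (EFin \o k) ->
  (\int[mu]_s ((k \_ (`[x, y[%classic)) s)%:E = (RI mu k x y)%:E)%E.
Proof.
move=> ki; rewrite /RI Rintegral_mkcond /Rintegral fineK//.
apply: integrable_fin_num => //.
exact: (integrable_patchT (measurable_itvco x y) ki).
Qed.

Variables (mu : {sigma_finite_measure set mR -> \bar R}) (f k : R -> R) (t x : R).
Hypotheses (fi : leb.-integrable `[t, x[ (EFin \o f))
  (ki : mu.-integrable `[t, x[ (EFin \o k)).

Let D : set mR := `[t, x[%classic.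
Let fD := f \_ D.
Let kD := k \_ D.
Let mD : measurable D. Proof. exact: measurable_itvco. Qed.

Let fDi : leb.-integrable setT (EFin \o fD).
Proof. exact: integrable_patchT. Qed.
Let kDi : mu.-integrable setT (EFin \o kD).
Proof. exact: integrable_patchT. Qed.

(** The strict inequality matches the half-open interval [[t, s[]: an atom of [mu] at [s] is not
    counted. *)
Let h (p : mR * mR) : R := fD p.1 * (if p.2 < p.1 then kD p.2 else 0).

Let mh : measurable_fun setT (EFin \o h).
Proof.
have mf : measurable_fun setT fD by apply/measurable_EFinP; case/integrableP : fDi.
have mk : measurable_fun setT kD by apply/measurable_EFinP; case/integrableP : kDi.
apply/measurable_EFinP; apply: measurable_funM.
  exact: measurableT_comp mf measurable_fst.
apply: measurable_fun_ifT.
- exact: measurable_fun_ltr measurable_snd measurable_fst.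
- exact: measurableT_comp mk measurable_snd.
- exact: measurable_cst.
Qed.

Let hi : (leb \x mu)%E.-integrable setT (EFin \o h).
Proof.
apply/(integrable12ltyP leb mu mh) => /=.
have mf : measurable_fun setT fD by apply/measurable_EFinP; case/integrableP : fDi.
have mk : measurable_fun setT kD by apply/measurable_EFinP; case/integrableP : kDi.
have mfn : measurable_fun setT (fun s => `|fD s|).
  by apply/measurable_EFinP; case/integrableP : (integrable_norm fDi).
pose Ck := fine (\int[mu]_y `|(kD y)%:E|)%E.
have CkE : (\int[mu]_y `|(kD y)%:E|)%E = Ck%:E.
  rewrite fineK// ge0_fin_numE; last exact: integral_ge0.
  by case/integrableP : kDi.
(* Dropping the constraint [p.2 < p.1] bounds the inner integral by [Ck * |fD s|]. *)
apply: (@le_lt_trans _ _ (\int[leb]_s ((Ck * `|fD s|)%:E))%E).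
  apply: ge0_le_integral => //.
  - by move=> s _; apply: integral_ge0.
  - have mah : measurable_fun setT (abse \o (EFin \o h)) by exact: measurableT_comp.
    have := measurable_fun_fubini_tonelli_F (m2 := mu) _ mah; apply => z.
    exact: abse_ge0.
  - apply/measurable_EFinP; apply: measurable_funM; first exact: measurable_cst.
    exact: mfn.
  - move=> s _; rewrite mulrC EFinM -CkE -ge0_integralZl//; last first.
      by case/integrableP : kDi => mk' _; exact: measurableT_comp mk'.
    apply: ge0_le_integral => //.
    + have m1 : measurable_fun setT (fun y => (h (s, y))%:E).
        exact: (measurableT_comp mh (pair1_measurable s)).
      have m2 : measurable_fun setT (fun y => `|(h (s, y))%:E|%E).
        exact: measurableT_comp m1.
      exact: m2.
    + apply: emeasurable_funM; first exact: measurable_cst.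
      by case/integrableP : kDi => mk' _; exact: measurableT_comp mk'.
    + move=> y _; rewrite /h /= -EFinM lee_fin normrM ler_wpM2l//.
      by case: ifP => _ //; rewrite normr0.
have fabs : leb.-integrable setT (EFin \o (fun s => Ck * `|fD s|)).
  exact: (integrableZl measurableT Ck (integrable_norm fDi)).
case/integrableP : fabs => _; apply: le_lt_trans.
apply: ge0_le_integral => //.
- by move=> s _; rewrite lee_fin mulr_ge0// fine_ge0// integral_ge0.
- apply/measurable_EFinP; apply: measurable_funM; first exact: measurable_cst.
  exact: mfn.
- apply: measurableT_comp => //.
  apply/measurable_EFinP; apply: measurable_funM; first exact: measurable_cst.
  exact: mfn.
- by move=> s _ /=; rewrite lee_fin ler_norm.
Qed.

Let FE s : fubini_F mu (EFin \o h) s = (((fun s => f s * RI mu k t s) \_ D) s)%:E.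
Proof.
rewrite /fubini_F /h /= /fD !patchE; case: ifPn => [sD|_]; last first.
  by under eq_integral do rewrite mul0r; rewrite integral0.
have /andP[ts sx] : t <= s < x by have := set_mem sD; rewrite /D /= in_itv.
have ks : mu.-integrable `[t, s[ (EFin \o k) by apply: integrable_itvcoS ki => //; exact: ltW.
rewrite EFinM -integral_patch_RI// -integralZl//; last first.
  exact: (integrable_patchT (measurable_itvco t s) ks).
apply: eq_integral => y _; rewrite -EFinM; congr (_ * _)%:E.
rewrite /kD !patchE /D !mem_setE !in_itv/=.
have [ys|ys] := ltP y s; last by rewrite andbF.
by rewrite (lt_trans ys sx) andbT.
Qed.

Let GE y : fubini_G leb (EFin \o h) y = (((fun y => k y * RI leb f y x) \_ D) y)%:E.
Proof.
rewrite /fubini_G /h /= patchE; case: ifPn => [sD|sD]; last first.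
  rewrite /kD patchE (negbTE sD).
  by under eq_integral do rewrite if_same mulr0; rewrite integral0.
have /andP[ty yx] : t <= y < x by have := set_mem sD; rewrite /D /= in_itv.
have fs : leb.-integrable `[y, x[ (EFin \o f) by apply: integrable_itvcoS fi.
have mo : measurable (`]y, x[%classic : set mR) by exact: measurable_itv.
have fs' : leb.-integrable `]y, x[ (EFin \o f).
  apply: integrableS fs => //.
  by move=> r /=; rewrite !in_itv/= => /andP[h1 ->]; rewrite ltW.
(* The section of the triangle at [y] is []y, x[]; it may be replaced by [[y, x[] because Lebesgue
   measure has no atoms. With atoms in both measures a diagonal term would appear. *)
have -> : RI leb f y x = \int[leb]_(s in `]y, x[) f s.
  by rewrite /RI -Rintegral_itv_obnd_cbnd.
rewrite Rintegral_mkcond EFinM fineK; last first.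
  apply: integrable_fin_num => //; exact: (integrable_patchT mo fs').
rewrite -integralZl//; last exact: (integrable_patchT mo fs').
apply: eq_integral => s _; rewrite -EFinM; congr (_%:E).
rewrite /fD /kD [in X in if _ then X else _]patchE sD !patchE /D !mem_setE !in_itv/=.
have [ys|ys] := ltP y s; last by rewrite !mulr0.
by rewrite mulrC (le_trans ty (ltW ys)).
Qed.

Lemma RI_fubini :
  leb.-integrable `[t, x[ (EFin \o (fun s => f s * RI mu k t s)) /\
      RI leb (fun s => f s * RI mu k t s) t x = RI mu (fun y => k y * RI leb f y x) t x.
Proof.
have i1 : leb.-integrable `[t, x[ (EFin \o (fun s => f s * RI mu k t s)).
  have := integrable_fubini_F hi.
  have -> : fubini_F mu (EFin \o h) = (EFin \o (fun s => f s * RI mu k t s)) \_ D.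
    by apply/funext => s; rewrite FE restrict_EFin.
  exact: (integrable_mkcond _ mD).2.
split => //.
rewrite /RI Rintegral_mkcond [RHS]Rintegral_mkcond /Rintegral; congr fine.
under eq_integral do rewrite -FE.
under [RHS]eq_integral do rewrite -GE.
exact: (Fubini hi).
Qed.

End fubini_triangle.

(** * Functions of bounded variation and integration by parts *)

Section representations.
Context (R : realType).
Notation leb := (@lebesgue_measure R).
Notation mR := (measurableTypeR R).
Implicit Types (t d x y : R) (F G k h : R -> R[i]).

Lemma fine_leb_itvco x y : x <= y -> fine (leb `[x, y[%classic) = y - x.
Proof. by move=> xy; rewrite leb_itvco. Qed.

Lemma leb_lf x y : (leb `[x, y[%classic < +oo)%E.
Proof. exact: leb_itvco_lty. Qed.

Lemma leb_cI f t d : bmeas t d f -> cI leb t d f.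
Proof. exact: (bmeas_cI leb_lf). Qed.

(** Fubini with the constant function 1: the integrability that it provides contains the
    measurability of the inner integral. *)
Lemma meas_RI (mu : {sigma_finite_measure set mR -> \bar R}) (k : R -> R) t d :
  mu.-integrable `[t, d[ (EFin \o k) -> meas t d (RI mu k t).
Proof.
move=> ki.
have [+ _] := RI_fubini (cst_integrable (mu := leb) leb_lf t d 1) ki.
move=> /integrableP[/measurable_EFinP + _]; apply: eq_meas => s _ _.
by rewrite mul1r.
Qed.

Lemma cmeas_CI (mu : {sigma_finite_measure set mR -> \bar R}) k t d :
  cI mu t d k -> cmeas t d (CI mu k t).
Proof. by move=> [k1 k2]; split; apply: meas_RI. Qed.

Lemma bmeas_CI (mu : {sigma_finite_measure set mR -> \bar R}) k t d :
  cI mu t d k -> bmeas t d (CI mu k t).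
Proof.
move=> ki; split; first exact: cmeas_CI.
exists (2 * RI mu (fun s => N (k s)) t d) => s ts sd.
have ni := cI_norm ki.
apply: (le_trans (N_CI (g := fun s => N (k s)) _ _ _)) => //.
- by apply: cmeas_sub (cI_meas ki) => //; exact: ltW.
- by apply: integrable_itvcoS ni => //; exact: ltW.
- rewrite ler_pM2l// (RI_add ts (ltW sd) ni) lerDl; apply: RI_ge0 => r _ _.
  exact: N_ge0.
Qed.

Lemma CI_rest (mu : {measure set mR -> \bar R}) f t s x : t <= s -> s <= x ->
  cI mu t x f -> CI mu f s x = CI mu f t x - CI mu f t s.
Proof. by move=> ts sx fi; rewrite (CI_add ts sx fi) addrC addKr. Qed.

(** A complex product is made of four real ones, hence four uses of the real theorem. The tails
    [CI leb f y x] are bounded in [y], which keeps the recombined integrands integrable. *)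
Lemma CI_fubini (mu : {sigma_finite_measure set mR -> \bar R})
    (lf : forall x y, (mu `[x, y[%classic < +oo)%E) f k t x : t <= x ->
  bmeas t x f -> cI mu t x k ->
  CI leb (fun s => f s * CI mu k t s) t x = CI mu (fun y => k y * CI leb f y x) t x.
Proof.
move=> tx bf ki.
have fi : cI leb t x f := leb_cI bf.
have bfx : bmeas t x (fun y => CI leb f y x).
  apply: (@eq_bmeas _ _ _ (fun s => CI leb f t x - CI leb f t s)).
    by move=> s ts sx; rewrite [RHS](CI_rest ts (ltW sx) fi).
  by apply: bmeasB; [exact: bmeas_cst|exact: bmeas_CI].
have kfi : cI mu t x (fun y => k y * CI leb f y x) by exact: cI_mulb.
have [[f1 f2] [k1 k2]] := (fi, ki).
have [i11 e11] := RI_fubini f1 k1.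
have [i12 e12] := RI_fubini f1 k2.
have [i21 e21] := RI_fubini f2 k1.
have [i22 e22] := RI_fubini f2 k2.
pose cr (r : R -> R) := fun s => (r s)%:C.
have mulb (r g : R -> R) : mu.-integrable `[t, x[ (EFin \o r) ->
    bmeas t x (cr g) -> mu.-integrable `[t, x[ (EFin \o (fun s => r s * g s)).
  move=> ri gi.
  have ri' : cI mu t x (cr r) by split => //; exact: cst_integrable.
  have [+ _] := cI_mulb ri' gi; apply: eq_integrable_itvco => s _ _.
  by rewrite reim /= mulr0 subr0.
have b1 : bmeas t x (cr (fun y => RI leb (fun s => complex.Re (f s)) y x)).
  have [[m1 m2] [M hM]] := bfx; split.
    by split => //; exact: measurable_cst.
  by exists M => s ts sx; rewrite NR; apply: le_trans (hM s ts sx); exact: (N_Re (CI leb f s x)).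
have b2 : bmeas t x (cr (fun y => RI leb (fun s => complex.Im (f s)) y x)).
  have [[m1 m2] [M hM]] := bfx; split.
    by split => //; exact: measurable_cst.
  by exists M => s ts sx; rewrite NR; apply: le_trans (hM s ts sx); exact: (N_Im (CI leb f s x)).
apply: complex_ext; rewrite ?ReCI ?ImCI.
  rewrite (@eq_RI _ leb _ (fun s => complex.Re (f s) * RI mu (fun y => complex.Re (k y)) t s
     - complex.Im (f s) * RI mu (fun y => complex.Im (k y)) t s)); last first.
    by move=> s _ _; rewrite reim ReCI ImCI.
  rewrite RIB// e11 e22 -RIB; [|exact: mulb|exact: mulb].
  by apply: eq_RI => s _ _; rewrite reim ReCI ImCI.
rewrite (@eq_RI _ leb _ (fun s => complex.Re (f s) * RI mu (fun y => complex.Im (k y)) t s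
     + complex.Im (f s) * RI mu (fun y => complex.Re (k y)) t s)); last first.
  by move=> s _ _; rewrite reim ReCI ImCI.
rewrite RID// e12 e21 -RID; [|exact: mulb|exact: mulb].
by apply: eq_RI => s _ _; rewrite reim ReCI ImCI addrC.
Qed.

(* [F] is absolutely continuous on [t, d] with derivative [F']. *)
Definition acrep t d F F' :=
  bmeas t d F' /\ forall x, t <= x -> x <= d -> F x = F t + CI leb F' t x.

Lemma acrepE t d F F' x y : acrep t d F F' -> t <= x -> x <= y -> y <= d ->
  F y = F x + CI leb F' x y.
Proof.
move=> [bF eF] tx xy yd; rewrite (eF y) ?(eF x)//; [|flra..].
rewrite -addrA -CI_add//; apply: cI_sub (leb_cI bF) => //; flra.
Qed.

Lemma acrep_sub t d t' d' F F' : t <= t' -> d' <= d -> acrep t d F F' -> acrep t' d' F F'.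
Proof.
move=> h1 h2 aF; split; first by apply: bmeas_sub aF.1.
by move=> x h3 h4; apply: (acrepE aF) => //; flra.
Qed.

Lemma acrep_lip t d F F' : acrep t d F F' -> exists2 M, 0 <= M &
  forall x y, t <= x -> x <= y -> y <= d -> N (F y - F x) <= M * (y - x).
Proof.
move=> aF; have [[mF [M hM]] eF] := aF.
exists (2 * `|M|) => // x y tx xy yd.
rewrite (acrepE aF tx xy yd) addrC addKr.
apply: (le_trans (N_CI_cst leb_lf (M := `|M|) _ _)).
- by apply: cmeas_sub mF.
- move=> s xs sy; apply: (le_trans (hM s _ _)); rewrite ?ler_norm//; flra.
- by rewrite fine_leb_itvco// mulrA.
Qed.

Lemma acrep_bounded t d F F' : acrep t d F F' -> exists2 M, 0 < M &
  forall x, t <= x -> x <= d -> N (F x) <= M.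
Proof.
move=> aF; have [M M0 hM] := acrep_lip aF.
exists (N (F t) + M * `|d - t| + 1).
  by rewrite ltr_wpDl// addr_ge0 ?N_ge0// mulr_ge0.
move=> x tx xd; rewrite -(subrK (F t) (F x)); apply: (le_trans (ND _ _)).
have := hM t x (lexx t) tx xd.
have : M * (x - t) <= M * `|d - t|.
  by apply: ler_wpM2l => //; apply: le_trans (ler_norm _); flra.
move: (N (F t)) (N _) (M * _) (M * _) => a b c e; flra.
Qed.

Lemma acrep_bmeas t d F F' : acrep t d F F' -> bmeas t d F.
Proof.
move=> aF; have [bF eF] := aF.
apply: (@eq_bmeas _ _ _ (fun x => F t + CI leb F' t x)).
  by move=> s ts sd; rewrite (eF s ts (ltW sd)).
have Fi : cI leb t d F' := leb_cI bF.
by apply: bmeasD; [exact: bmeas_cst|exact: bmeas_CI].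
Qed.

Lemma acrepD t d F F' G G' : acrep t d F F' -> acrep t d G G' ->
  acrep t d (fun x => F x + G x) (fun x => F' x + G' x).
Proof.
move=> [bF eF] [bG eG]; split; first exact: bmeasD.
move=> x tx xd; rewrite CID; first by rewrite eF// eG//; ring.
- by apply: leb_cI; apply: bmeas_sub bF.
- by apply: leb_cI; apply: bmeas_sub bG.
Qed.

Lemma acrepZ t d F F' c : acrep t d F F' ->
  acrep t d (fun x => c * F x) (fun x => c * F' x).
Proof.
move=> [bF eF]; split; first exact: bmeasZ.
move=> x tx xd; rewrite CIZ; first by rewrite eF// mulrDr.
by apply: leb_cI; apply: bmeas_sub bF.
Qed.

Lemma CIJ (mu : {measure set mR -> \bar R}) F x y : cI mu x y F ->
  CI mu (fun s => conjc (F s)) x y = conjc (CI mu F x y).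
Proof.
move=> [f1 f2]; apply: complex_ext; rewrite !reim /=.
  by apply: eq_RI => s _ _; rewrite reim.
rewrite -mulN1r -RIZ//; apply: eq_RI => s _ _; by rewrite reim mulN1r.
Qed.

Lemma acrepJ t d F F' : acrep t d F F' ->
  acrep t d (fun x => conjc (F x)) (fun x => conjc (F' x)).
Proof.
move=> [bF eF]; split; first exact: bmeasJ.
move=> x tx xd; rewrite CIJ; first by rewrite eF// rmorphD.
by apply: leb_cI; apply: bmeas_sub bF.
Qed.

Section signed.
Variables mu1 mu2 : {finite_measure set mR -> \bar R}.

Lemma finite_lf (mu : {finite_measure set mR -> \bar R}) x y :
  (mu `[x, y[%classic < +oo)%E.
Proof.
have mI := measurable_itvco x y.
by rewrite -ge0_fin_numE//; exact: fin_num_measure.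
Qed.

Lemma fin_cI (mu : {finite_measure set mR -> \bar R}) f x y : bmeas x y f -> cI mu x y f.
Proof. exact: (bmeas_cI (finite_lf mu)). Qed.

Definition SI k x y := CI mu1 k x y - CI mu2 k x y.

Lemma eq_SI f g x y : (forall s, x <= s -> s < y -> f s = g s) -> SI f x y = SI g x y.
Proof. by move=> fg; rewrite /SI !(eq_CI _ fg). Qed.

Lemma SI_add k x y z : x <= y -> y <= z -> bmeas x z k -> SI k x z = SI k x y + SI k y z.
Proof.
move=> xy yz bk; rewrite /SI !(CI_add xy yz); first by ring.
- exact: fin_cI.
- exact: fin_cI.
Qed.

Lemma SIZ k c x y : bmeas x y k -> SI (fun s => c * k s) x y = c * SI k x y.
Proof.
move=> bk; rewrite /SI !CIZ; first by ring.
- exact: fin_cI.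
- exact: fin_cI.
Qed.

Lemma SID k k' x y : bmeas x y k -> bmeas x y k' ->
  SI (fun s => k s + k' s) x y = SI k x y + SI k' x y.
Proof.
move=> bk bk'; rewrite /SI !CID; first by ring.
- exact: fin_cI.
- exact: fin_cI.
- exact: fin_cI.
- exact: fin_cI.
Qed.

Lemma SIB k k' x y : bmeas x y k -> bmeas x y k' ->
  SI (fun s => k s - k' s) x y = SI k x y - SI k' x y.
Proof.
move=> bk bk'; rewrite -[RHS]/(SI k x y + - SI k' x y) -mulN1r -SIZ// -SID//; last exact: bmeasZ.
by apply: eq_SI => s _ _; rewrite mulN1r.
Qed.

Lemma SI_0 x y : SI (fun=> 0) x y = 0.
Proof.
rewrite -[RHS](mul0r (SI (fun=> 0) x y)) -(SIZ _ (bmeas_cst x y 0)).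
by apply: eq_SI => s _ _; rewrite mulr0.
Qed.

Lemma N_SI k (g : R -> R) x y : bmeas x y k ->
  mu1.-integrable `[x, y[ (EFin \o g) -> mu2.-integrable `[x, y[ (EFin \o g) ->
  (forall s, x <= s -> s < y -> N (k s) <= g s) ->
  N (SI k x y) <= 2 * (RI mu1 g x y + RI mu2 g x y).
Proof.
move=> bk g1 g2 kg; apply: (le_trans (NB _ _)); rewrite mulrDr.
by apply: lerD; apply: N_CI => //; exact: bk.1.
Qed.

Lemma N_SI_cst k M x y : bmeas x y k -> (forall s, x <= s -> s < y -> N (k s) <= M) ->
  N (SI k x y) <= 2 * M * (fine (mu1 `[x, y[%classic) + fine (mu2 `[x, y[%classic)).
Proof.
move=> bk kM; apply: (le_trans (N_SI (g := fun=> M) bk _ _ kM)).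
- exact: cst_integrable (finite_lf mu1) _ _ _.
- exact: cst_integrable (finite_lf mu2) _ _ _.
- by rewrite !RI_cst -mulrDr mulrA.
Qed.

(* [dG = k d(mu1 - mu2) - h dx] on [t, d], with [G] left continuous. *)
Definition bvrep t d G k h :=
  [/\ bmeas t d k, cI leb t d h &
  forall x, t <= x -> x <= d -> G x = G t + SI k t x - CI leb h t x].

Lemma bvrepE t d G k h x y : bvrep t d G k h -> t <= x -> x <= y -> y <= d ->
  G y = G x + SI k x y - CI leb h x y.
Proof.
move=> [bk hi eG] tx xy yd; rewrite (eG y) ?(eG x)//; [|flra..].
rewrite (SI_add tx xy) ?(CI_add tx xy); first by ring.
- by apply: cI_sub hi.
- by apply: bmeas_sub bk.
Qed.

Lemma bvrep_sub t d t' d' G k h : t <= t' -> d' <= d -> bvrep t d G k h -> bvrep t' d' G k h.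
Proof.
move=> h1 h2 aG; have [bk hi eG] := aG; split.
- by apply: bmeas_sub bk.
- by apply: cI_sub hi.
- by move=> x h3 h4; apply: (bvrepE aG) => //; flra.
Qed.

Lemma bvrep_bmeas t d G k h : bvrep t d G k h -> bmeas t d G.
Proof.
move=> [bk hi eG].
apply: (@eq_bmeas _ _ _ (fun x => G t + SI k t x - CI leb h t x)).
  by move=> s ts sd; rewrite (eG s ts (ltW sd)).
apply: bmeasB; last exact: bmeas_CI.
apply: bmeasD; first exact: bmeas_cst.
have k1 := fin_cI mu1 bk; have k2 := fin_cI mu2 bk.
by apply: bmeasB; exact: bmeas_CI.
Qed.

Lemma bvrepD t d G k h G' k' h' : bvrep t d G k h -> bvrep t d G' k' h' ->
  bvrep t d (fun x => G x + G' x) (fun x => k x + k' x) (fun x => h x + h' x).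
Proof.
move=> [bk hi eG] [bk' hi' eG']; split; [exact: bmeasD|exact: cID|].
move=> x tx xd; rewrite CID ?SID; first by rewrite eG// eG'//; ring.
- by apply: bmeas_sub bk.
- by apply: bmeas_sub bk'.
- by apply: cI_sub hi.
- by apply: cI_sub hi'.
Qed.

Lemma bvrepZ t d G k h c : bvrep t d G k h ->
  bvrep t d (fun x => c * G x) (fun x => c * k x) (fun x => c * h x).
Proof.
move=> [bk hi eG]; split; [exact: bmeasZ|exact: cIZ|].
move=> x tx xd; rewrite CIZ ?SIZ; first by rewrite eG//; ring.
- by apply: bmeas_sub bk.
- by apply: cI_sub hi.
Qed.

Lemma bvrepJ t d G k h : bvrep t d G k h ->
  bvrep t d (fun x => conjc (G x)) (fun x => conjc (k x)) (fun x => conjc (h x)).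
Proof.
move=> [bk hi eG]; split; [exact: bmeasJ| |].
  have [[h1 h2] [m1 m2]] := (hi, cI_meas hi); split.
    by apply: eq_integrable_itvco h1 => s _ _; rewrite reim.
  apply: eq_integrable_itvco (integrableZ_itvco (-1) h2) => s _ _.
  by rewrite reim mulN1r.
move=> x tx xd; rewrite /SI !CIJ; first by rewrite eG// rmorphB rmorphD rmorphB.
- by apply: cI_sub hi.
- by apply: cI_sub (fin_cI _ bk).
- by apply: cI_sub (fin_cI _ bk).
Qed.

Lemma acrep_bvrep t d F F' : acrep t d F F' ->
  bvrep t d F (fun=> 0) (fun x => - F' x).
Proof.
move=> [bF eF]; have Fi := leb_cI bF; split.
- exact: bmeas_cst.
- exact: cIN.
move=> x tx xd; rewrite SI_0 addr0 (eF x tx xd).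
have Fx : cI leb t x F' by apply: cI_sub Fi.
by rewrite (CIN Fx) opprK.
Qed.

(* Fubini's theorem on the triangle [t <= y < s < x]. *)
Lemma integration_by_parts t d F F' G k h x : acrep t d F F' -> bvrep t d G k h ->
  t <= x -> x <= d ->
  F x * G x - F t * G t = CI leb (fun s => F' s * G s) t x
    + SI (fun s => F s * k s) t x - CI leb (fun s => F s * h s) t x.
Proof.
move=> aF bG tx xd.
have aF' := acrep_sub (lexx t) xd aF.
have [bF' eF] := aF'.
have [bk hi eG] := bvrep_sub (lexx t) xd bG.
have bF := acrep_bmeas aF'.
have Fi := leb_cI bF'.
(* Used once for each of the three parts of [dG]. The integral of [F'] over [[s, x[] is [F x - F s],
   and as [F] is continuous there is no term from common jumps. *)
have part (mu : {sigma_finite_measure set mR -> \bar R}) l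
    (lf : forall x y, (mu `[x, y[%classic < +oo)%E) : cI mu t x l ->
    CI leb (fun s => F' s * CI mu l t s) t x =
    F x * CI mu l t x - CI mu (fun s => F s * l s) t x.
  move=> li; rewrite CI_fubini//.
  rewrite (@eq_CI _ _ _ (fun s => F x * l s - F s * l s)); last first.
    move=> s ts sx; rewrite -mulrBl mulrC; congr (_ * _).
    by rewrite (acrepE aF' ts (ltW sx) (lexx x)) addrC addKr.
  have Fl : cI mu t x (fun s => F s * l s).
    apply: (@eq_cI _ mu _ _ (fun s => l s * F s)); last exact: cI_mulb.
    by move=> s _ _; rewrite mulrC.
  by rewrite CIB ?CIZ//; exact: cIZ.
have k1 := fin_cI mu1 bk.
have k2 := fin_cI mu2 bk.
have e1 := part mu1 k (finite_lf mu1) k1.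
have e2 := part mu2 k (finite_lf mu2) k2.
have e3 := part leb h leb_lf hi.
have i (mu : {sigma_finite_measure set mR -> \bar R}) l : cI mu t x l ->
    cI leb t x (fun s => F' s * CI mu l t s).
  move=> li; apply: leb_cI; apply: bmeasM => //; exact: bmeas_CI.
have i1 := i mu1 k k1; have i2 := i mu2 k k2; have i3 := i leb h hi.
have -> : CI leb (fun s => F' s * G s) t x = CI leb (fun s => G t * F' s) t x +
   (CI leb (fun s => F' s * CI mu1 k t s) t x - CI leb (fun s => F' s * CI mu2 k t s) t x
   - CI leb (fun s => F' s * CI leb h t s) t x).
  rewrite -!CIB//; last exact: cIB.
  rewrite -CID; [|exact: cIZ|by apply: cIB => //; exact: cIB].
  by apply: eq_CI => s ts sx; rewrite (eG s ts (ltW sx)) /SI; ring.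
rewrite e1 e2 e3 CIZ// (eF x tx (lexx x)) (eG x tx (lexx x)) /SI; ring.
Qed.

(** The product rule is integration by parts for an integrator [G] without singular part, that is
    with [k = 0]. *)
Lemma acrepM_signed t d F F' G G' : acrep t d F F' -> acrep t d G G' ->
  acrep t d (fun x => F x * G x) (fun x => F' x * G x + F x * G' x).
Proof.
move=> aF aG; have bF := acrep_bmeas aF; have bG := acrep_bmeas aG.
have [[bF' _] [bG' _]] := (aF, aG).
split; first by apply: bmeasD; apply: bmeasM.
move=> x tx xd; rewrite -[LHS](subrK (F t * G t)) addrC; congr (_ + _).
rewrite (integration_by_parts aF (acrep_bvrep aG) tx xd).
rewrite CID; last 2 first.
- by apply: leb_cI; apply: bmeas_sub (bmeasM bF' bG).
- by apply: leb_cI; apply: bmeas_sub (bmeasM bF bG').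
rewrite (eq_SI (g := fun=> 0)) ?SI_0 ?addr0; last by move=> s _ _; rewrite mulr0.
rewrite -CIN; last by apply: cI_sub (leb_cI (bmeasM bF (bmeasN bG'))).
by congr (_ + _); apply: eq_CI => s _ _; rewrite mulrN opprK.
Qed.

End signed.

Lemma acrepM t d F F' G G' : acrep t d F F' -> acrep t d G G' ->
  acrep t d (fun x => F x * G x) (fun x => F' x * G x + F x * G' x).
Proof. exact: (acrepM_signed (@mzero _ mR R) (@mzero _ mR R)). Qed.
End representations.

(** * From the differential expression to integral equations *)

Section absolutely_continuous.
Context (R : realType).
Notation leb := (@lebesgue_measure R).
Notation mR := (measurableTypeR R).

Lemma acR_sub (c d c' d' : R) F : c <= c' -> d' <= d -> acR c d F -> acR c' d' F.
Proof.
move=> h1 h2 aF eps e0; have [del del0 h] := aF _ e0; exists del => // n u v uv.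
apply: h => i; have [h3 [h4 h5]] := uv i; split; [flra|split; flra].
Qed.

Lemma acR1 (c d : R) F eps : acR c d F -> 0 < eps -> exists2 delta, 0 < delta &
  forall u v, c <= u -> v <= d -> u <= v -> v - u < delta -> `|F v - F u| < eps.
Proof.
move=> aF e0; have [del del0 h] := aF _ e0; exists del => // u v cu vd uv uvd.
have := h 1%N (fun=> u) (fun=> v); rewrite !big_ord1; apply => //.
by move=> i j _ _ _; rewrite (ord1 i) (ord1 j).
Qed.

Lemma acR_meas_bounded (c d : R) F : c <= d -> acR c d F ->
  meas c d F /\ exists M, forall s, c <= s -> s <= d -> `|F s| <= M.
Proof.
move=> cd aF.
(* Clamping to [[c, d]] does not increase distances, so [F \o cl] is continuous on the whole line,
   whence measurability and the extreme value theorem. *)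
pose cl x := Num.max c (Num.min x d).
have clE x : c <= x -> x <= d -> cl x = x.
  by move=> cx xd; rewrite /cl (min_idPl xd) (max_idPr cx).
have clb x : c <= cl x <= d.
  by rewrite /cl le_max lexx /= ge_max cd ge_min lexx orbT.
have clm x y : x <= y -> cl x <= cl y /\ cl y - cl x <= y - x.
  move=> xy; rewrite /cl /Num.max /Num.min.
  by do 4!case: ifP => //; move=> *; split; lra.
have cg : continuous (F \o cl).
  move=> x; apply/cvgrPdist_lt => eps e0.
  have [del del0 h] := acR1 aF e0.
  apply/nbhs_ballP; exists del => //= y; rewrite /ball/= => xy.
  have /andP[x1 x2] := clb x; have /andP[y1 y2] := clb y.
  have [le|/ltW le] := leP x y; have [m1 m2] := clm _ _ le.
    rewrite distrC; apply: h => //; apply: le_lt_trans m2 _.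
    by apply: le_lt_trans xy; rewrite distrC ler_norm.
  apply: h => //; apply: le_lt_trans m2 _.
  by apply: le_lt_trans xy; rewrite ler_norm.
split.
  apply: (@eq_meas _ _ _ (F \o cl)) => [s cs sd|]; first by rewrite /= clE// ltW.
  apply: (measurable_funS _ _ (continuous_measurable_fun cg)) => //.
have cg' : {within `[c, d], continuous (F \o cl)} by exact: continuous_subspaceT.
have [x1 _ h1] := EVT_max cd cg'; have [x2 _ h2] := EVT_min cd cg'.
exists (`|(F \o cl) x1| + `|(F \o cl) x2|) => s cs sd.
have sI : s \in `[c, d] by rewrite in_itv/= cs sd.
have := h1 s sI; have := h2 s sI; rewrite /= (clE s)//.
move: (F s) (F (cl x1)) (F (cl x2)) => p q r pr pq.
have := ler_norm q; have := ler_norm (- r); rewrite normrN => r1 r2.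
have n1 := normr_ge0 q; have n2 := normr_ge0 r.
by rewrite ler_norml; apply/andP; split; flra.
Qed.

Lemma abs_cont_Re (c d : R) f : abs_cont c d f -> acR c d (fun s => complex.Re (f s)).
Proof.
move=> af eps e0; have [del del0 h] := af _ e0; exists del => // n u v uv t1 s1.
apply: le_lt_trans (h n u v uv t1 s1); apply: ler_sum => i _.
by rewrite -cReN -cReD; exact: N_Re.
Qed.

Lemma abs_cont_Im (c d : R) f : abs_cont c d f -> acR c d (fun s => complex.Im (f s)).
Proof.
move=> af eps e0; have [del del0 h] := af _ e0; exists del => // n u v uv t1 s1.
apply: le_lt_trans (h n u v uv t1 s1); apply: ler_sum => i _.
by rewrite -cImN -cImD; exact: N_Im.
Qed.

Lemma abs_cont_bmeas (c d : R) f : c <= d -> abs_cont c d f -> bmeas c d f.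
Proof.
move=> cd af.
have [m1 [M1 h1]] := acR_meas_bounded cd (abs_cont_Re af).
have [m2 [M2 h2]] := acR_meas_bounded cd (abs_cont_Im af).
split => //; exists (M1 + M2) => s cs sd; apply: (le_trans (N_le _)).
by apply: lerD; [apply: h1|apply: h2] => //; exact: ltW.
Qed.

Lemma ftc_abs_cont (c d : R) f g x : abs_cont c d f -> cI leb c d g ->
  c <= x -> x <= d ->
  {ae leb, forall s, c <= s <= d -> is_deriv f s (g s)} ->
  f x = f c + CI leb g c x.
Proof.
move=> af gi cx xd dfg.
have [g1 g2] := cI_sub (lexx c) xd gi.
rewrite -[LHS](subrK (f c)) addrC; congr (_ + _).
apply: complex_ext; rewrite ?ReCI ?ImCI reim.
  rewrite cReN; apply: (ftc_ac cx (acR_sub (lexx c) xd (abs_cont_Re af))) => //.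
  apply: (@filterS _ _ (ae_filter_ringOfSetsType _)) dfg => s h /andP[h1 h2].
  have [|//] := h; apply/andP; split; flra.
rewrite cImN; apply: (ftc_ac cx (acR_sub (lexx c) xd (abs_cont_Im af))) => //.
apply: (@filterS _ _ (ae_filter_ringOfSetsType _)) dfg => s h /andP[h1 h2].
have [|//] := h; apply/andP; split; flra.
Qed.

End absolutely_continuous.

Section charges.
Context (R : realType).
Notation leb := (@lebesgue_measure R).
Notation mR := (measurableTypeR R).
Implicit Types nu : {charge set mR -> \bar R}.

Definition posm nu : {finite_measure set mR -> \bar R} :=
  jordan_pos (projT2 (cid (projT2 (cid (Hahn_decomposition nu))))).

Definition negm nu : {finite_measure set mR -> \bar R} :=
  jordan_neg (projT2 (cid (projT2 (cid (Hahn_decomposition nu))))).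

Lemma charge_integral_SI nu f t x :
  charge_integral nu `[t, x[%classic f = SI (posm nu) (negm nu) f t x.
Proof. by apply: complex_ext; rewrite cReD cReN || rewrite cImD cImN. Qed.

Lemma posm_negm nu A : measurable A -> nu A = (posm nu A - negm nu A)%E.
Proof.
move=> mA.
rewrite [LHS](jordan_decomp (projT2 (cid (projT2 (cid (Hahn_decomposition nu)))))  mA).
by rewrite /cadd/= /cscale/= mulN1e.
Qed.

(** The Hahn decompositions picked for [nu] and [nu'] are unrelated, so their Jordan parts cannot be
    matched one by one. Moving the negative parts across gives two sums of finite measures that
    agree on the subsets of [D]. *)
Lemma eq_charge_Rintegral nu nu' (D : set mR) (f : R -> R) M : measurable D ->
  measurable_fun D f -> (forall s, D s -> `|f s| <= M) ->
  (forall A, measurable A -> A `<=` D -> nu A = nu' A) ->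
  charge_Rintegral nu D f = charge_Rintegral nu' D f.
Proof.
move=> mD mf fM e.
have fi (mu : {finite_measure set mR -> \bar R}) : mu.-integrable D (EFin \o f).
  apply: measurable_bounded_integrable => //.
    by rewrite -ge0_fin_numE//; exact: fin_num_measure.
  exists M; split; first exact: num_real.
  by move=> M' MM' s Ds; apply: le_trans (fM s Ds) (ltW MM').
rewrite -[LHS]/(\int[posm nu]_(x in D) f x - \int[negm nu]_(x in D) f x).
rewrite -[RHS]/(\int[posm nu']_(x in D) f x - \int[negm nu']_(x in D) f x).
suff : \int[posm nu]_(x in D) f x + \int[negm nu']_(x in D) f x =
       \int[posm nu']_(x in D) f x + \int[negm nu]_(x in D) f x.
  move: (Rintegral _ _ _) (Rintegral _ _ _) (Rintegral _ _ _) (Rintegral _ _ _) => p q r s.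
  by flra.
rewrite /Rintegral -!fineD; last first.
all: try exact: (integrable_fin_num mD (fi _)).
rewrite -!integral_measure_add//; [|exact: fi..].
congr fine; apply: eq_measure_integral => A mA AD.
rewrite /measure_add/= /msum !big_ord_recl !big_ord0 /= !adde0.
have := e A mA AD; rewrite (posm_negm nu mA) (posm_negm nu' mA).
have F (mu : {finite_measure set mR -> \bar R}) : mu A \is a fin_num.
  exact: fin_num_measure.
rewrite -[X in _ -> X]/(posm nu A + negm nu' A = posm nu' A + negm nu A)%E.
rewrite -(fineK (F (posm nu))) -(fineK (F (posm nu'))) -(fineK (F (negm nu))) -(fineK (F (negm nu'))).
rewrite -!EFinB -!EFinD => -[h]; congr (_%:E).
by move: h; move: (fine _) (fine _) (fine _) (fine _) => p q r s h; lra.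
Qed.

End charges.

Section representation_of_tau.
Context (R : realType) (a : R) (b : \bar R) (chi : signed_measure a b).
Notation leb := (@lebesgue_measure R).
Notation mR := (measurableTypeR R).

Lemma eq_chi_Rintegral (D : set mR) (f : R -> R) M c d :
  measurable D -> measurable_fun D f -> (forall s, D s -> `|f s| <= M) ->
  D `<=` `[a, c[%classic -> a < c -> c <= d -> (d%:E < b)%E ->
  charge_Rintegral (chi c) D f = charge_Rintegral (chi d) D f.
Proof.
move=> mD mf fM Dc ac cd db; apply: (eq_charge_Rintegral mD mf fM) => A mA AD.
rewrite (restr_to_compat chi ac cd db mA) setIidl//.
by move=> s /AD /Dc.
Qed.

(** In [quasi_deriv] the charge [chi x] changes with [x]. Compatibility replaces all of them by
    [chi d] for a single [d], so that integration by parts applies. *)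
Lemma chi_SI f t x d : a <= t -> t <= x -> x <= d -> (d%:E < b)%E -> bmeas t x f ->
  charge_integral (chi x) `[t, x[%classic f = SI (posm (chi d)) (negm (chi d)) f t x.
Proof.
move=> at_ tx xd db bf; rewrite -charge_integral_SI.
(* Compatibility concerns indices above [a] only; for [x <= a] the interval is empty and both sides
   vanish. *)
have [ax|xa] := ltP a x; last first.
  have -> : t = x by apply/eqP; rewrite eq_le tx (le_trans xa at_).
  by rewrite !charge_integral_SI /SI !CI0.
have [[m1 m2] [M hM]] := bf.
have sub : (`[t, x[ `<=` `[a, x[)%classic by exact: subset_itvco.
rewrite /charge_integral; congr (_ +i* _).
  apply: (@eq_chi_Rintegral _ _ M) => //.
  move=> s /=; rewrite in_itv/= => /andP[ts sx].
  by apply: le_trans (hM s ts sx); exact: N_Re.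
apply: (@eq_chi_Rintegral _ _ M) => //.
move=> s /=; rewrite in_itv/= => /andP[ts sx].
by apply: le_trans (hM s ts sx); exact: N_Im.
Qed.

(** Integrated form of [tau f = h]: [h] being the derivative of [- df] plus the integral of [f], the
    increments of [df] are those of [f dchi - h dx]. Nothing here is stated almost everywhere. *)
Definition ode (t d : R) (f df h : R -> R[i]) :=
  acrep t d f df /\ bvrep (posm (chi d)) (negm (chi d)) t d df f h.

Lemma tau_is_ode t d f df h : a <= t -> t <= d -> (d%:E < b)%E ->
  tau_is chi t f df h -> cI leb t d h -> ode t d f df h.
Proof.
move=> at_ td db [[acf aedf acq] aeq] hi.
have af := acf d td db; have aq := acq d td db.
have bf := abs_cont_bmeas td af.
have restr g k : has_deriv_ae (co_itv t b) g k ->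
    {ae leb, forall s, t <= s <= d -> is_deriv g s (k s)}.
  apply: (@filterS _ _ (ae_filter_ringOfSetsType _)) => s hs /andP[ts sd].
  by apply: hs; split => //; apply: le_lt_trans db; rewrite lee_fin.
(* This precedes the equation for [f], because it supplies the boundedness of [df] required
   there. *)
have bv : bvrep (posm (chi d)) (negm (chi d)) t d df f h.
  split => // x tx xd.
  have := ftc_abs_cont aq hi tx xd (restr _ _ aeq).
  rewrite /quasi_deriv (chi_SI at_ tx xd db); last by apply: bmeas_sub bf.
  rewrite (chi_SI at_ (lexx t) (le_trans tx xd) db); last by apply: bmeas_sub bf.
  rewrite [in X in _ = X]/SI !CI0 subrr addr0 => e.
  have -> : CI leb h t x = (- df x + SI (posm (chi d)) (negm (chi d)) f t x) + df t.
    by rewrite e addrC addrA subrr add0r.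
  ring.
split => //; split; first exact: bvrep_bmeas bv.
move=> x tx xd; apply: (ftc_abs_cont af) => //; last exact: restr.
exact: leb_cI (bvrep_bmeas bv).
Qed.

Lemma solution_ode t d z u du : a <= t -> t <= d -> (d%:E < b)%E ->
  solution chi t z u du -> ode t d u du (fun x => z * u x).
Proof.
move=> at_ td db su; apply: tau_is_ode => //.
have [[acf _ _] _] := su.
by apply: leb_cI; apply: bmeasZ; apply: abs_cont_bmeas => //; exact: acf.
Qed.

End representation_of_tau.

(** * Square integrability near [b] *)

Section square_integrability.
Context (R : realType) (b : \bar R).
Notation leb := (@lebesgue_measure R).
Notation mR := (measurableTypeR R).
Implicit Types (f g : R -> R[i]).

Lemma lt_dense (x : R) : (x%:E < b)%E -> exists2 y, x < y & (y%:E < b)%E.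
Proof.
case: b => [r||//]; last by exists (x + 1); rewrite ?ltry// ltrDl.
rewrite lte_fin => xr; exists ((x + r) / 2); rewrite ?lte_fin; flra.
Qed.

Lemma oo_itvE (c : R) : exists i : interval R, oo_itv c b = [set` i].
Proof.
case: b => [r||].
- exists `]c, r[; apply/seteqP; split => s /=; rewrite in_itv/= ?lte_fin.
    by move=> [h1 h2]; apply/andP.
  by move=> /andP[h1 h2].
- exists `]c, +oo[; apply/seteqP; split => s /=; rewrite in_itv/= andbT.
    by move=> [-> _].
  by move=> h; split => //=; rewrite ltry.
- exists `]c, c[; apply/seteqP; split => s /=; rewrite in_itv/=.
    by move=> [_].
  by move=> /andP[h1 h2]; have := lt_trans h1 h2; rewrite ltxx.
Qed.

Lemma measurable_oo_itv (c : R) : measurable (oo_itv c b : set mR).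
Proof. by have [i ->] := oo_itvE c; exact: measurable_itv. Qed.

Lemma open_oo_itv (c : R) : open (oo_itv c b).
Proof.
have -> : oo_itv c b = [set x | c < x] `&` [set x | (x%:E < b)%E] by [].
apply: openI; first exact: open_gt.
case: b => [r||].
- rewrite (_ : [set _ | _] = [set x | x < r]); first exact: open_lt.
  by apply/seteqP; split => s /=; rewrite lte_fin.
- rewrite (_ : [set _ | _] = setT); first exact: openT.
  by apply/seteqP; split => s //= _; rewrite ltry.
- rewrite (_ : [set _ | _] = set0); first exact: open0.
  by apply/seteqP; split => s.
Qed.

(** A bound uniform over the intervals below [b] treats finite and infinite [b] alike and avoids
    integrals up to [b]. *)
Definition L2b (c : R) f := exists K, forall x y, c <= x -> x <= y -> (y%:E < b)%E ->
  [/\ cmeas x y f, leb.-integrable `[x, y[ (EFin \o (fun s => N (f s) ^+ 2)) &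
      RI leb (fun s => N (f s) ^+ 2) x y <= K].

Lemma L2b_sub c c' f : c <= c' -> L2b c f -> L2b c' f.
Proof.
move=> cc [K h]; exists K => x y cx xy yb; apply: h => //; exact: le_trans cx.
Qed.

(** Square integrability is stated on an open interval while integrals run over [[x, y[], so the
    left endpoint, a measurable single point, has to be restored. *)
Lemma measurable_fun_itvco x y (f : R -> R) :
  measurable_fun (`]x, y[%classic : set mR) f -> meas x y f.
Proof.
move=> mf; have [xy|yx] := ltP x y; last first.
  rewrite /meas set_itv_ge; first exact: measurable_fun_set0.
  by rewrite bnd_simp -leNgt.
have e : (`[x, y[ = [set x] `|` `]x, y[)%classic.
  apply/seteqP; split => s /=; rewrite !in_itv/=.
    by rewrite le_eqVlt => /andP[/orP[/eqP ->|xs] sy]; [left|right; rewrite xs].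
  by move=> [->|/andP[xs sy]]; rewrite ?lexx// (ltW xs).
rewrite /meas e; apply/measurable_funU => //.
by split => //; exact: measurable_fun_set1.
Qed.

Lemma L2_L2b c f : L2 (oo_itv c b) f -> L2b c f.
Proof.
move=> [m1 m2 fin].
have mo := measurable_oo_itv c.
pose g s := N (f s) ^+ 2.
have mg : measurable_fun (oo_itv c b : set mR) g.
  rewrite /g; under eq_fun do rewrite Nsq.
  by apply: measurable_funD; apply: measurable_funX.
exists (fine (\int[leb]_(x in oo_itv c b) (g x)%:E)%E) => x y cx xy yb.
have sub : (`]x, y[ `<=` oo_itv c b)%classic.
  move=> s /=; rewrite in_itv/= => /andP[xs sy]; split; first exact: le_lt_trans xs.
  by apply: lt_trans yb; rewrite lte_fin.
have mI : measurable (`]x, y[%classic : set mR) by exact: measurable_itv.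
have mf : cmeas x y f.
  by split; apply: measurable_fun_itvco; [apply: measurable_funS m1|apply: measurable_funS m2].
have mg' : measurable_fun (`]x, y[%classic : set mR) g by apply: measurable_funS mg.
have g0 s : (0 <= (g s)%:E)%E by rewrite lee_fin sqr_ge0.
have le : (\int[leb]_(s in `[x, y[) (g s)%:E <= \int[leb]_(s in oo_itv c b) (g s)%:E)%E.
  rewrite -(@integral_itv_obnd_cbnd _ x (BLeft y) (EFin \o g)); last exact/measurable_EFinP.
  apply: ge0_subset_integral => //; first exact/measurable_EFinP.
  by move=> s _; exact: g0.
have lty : (\int[leb]_(s in `[x, y[) (g s)%:E < +oo)%E by apply: le_lt_trans fin.
split => //.
- apply/integrableP; split; first by apply/measurable_EFinP; exact: (meas_sqN mf).
  apply: le_lt_trans lty.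
  apply: ge0_le_integral => //.
  + by apply: measurableT_comp => //; apply/measurable_EFinP; exact: (meas_sqN mf).
  + by apply/measurable_EFinP; exact: (meas_sqN mf).
  + by move=> s _ /=; rewrite lee_fin ger0_norm // sqr_ge0.
- rewrite /RI /Rintegral; apply: fine_le; last exact: le.
  + rewrite ge0_fin_numE; first exact: lty.
    by apply: integral_ge0 => s _; exact: g0.
  + rewrite ge0_fin_numE; first exact: fin.
    by apply: integral_ge0 => s _; exact: g0.
Qed.

Lemma L2bZ c z f : L2b c f -> L2b c (fun s => z * f s).
Proof.
move=> [K h]; exists (N z ^+ 2 * K) => x y cx xy yb; have [m1 i1 K1] := h x y cx xy yb.
have e : (fun s => N (z * f s) ^+ 2) = (fun s => N z ^+ 2 * N (f s) ^+ 2).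
  by apply/funext => s; rewrite NM exprMn.
split; rewrite ?e.
- by apply: cmeasM => //; exact: cmeas_cst.
- exact: integrableZ_itvco.
- by rewrite RIZ// ler_wpM2l// sqr_ge0.
Qed.

Lemma L2bJ c f : L2b c f -> L2b c (fun s => conjc (f s)).
Proof.
move=> [K h]; exists K => x y cx xy yb; have [m1 i1 K1] := h x y cx xy yb.
have e : (fun s => N (conjc (f s)) ^+ 2) = (fun s => N (f s) ^+ 2).
  by apply/funext => s; rewrite NJ.
by split; rewrite ?e//; exact: cmeasJ.
Qed.

Lemma L2b_cI c f x y : L2b c f -> c <= x -> x <= y -> (y%:E < b)%E -> cI leb x y f.
Proof.
move=> [K h] cx xy yb; have [m1 i1 K1] := h x y cx xy yb.
(* On a bounded interval r <= 1 + r^2 replaces the Cauchy-Schwarz inequality. *)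
apply: (cI_bounded m1 (integrableD_itvco (cst_integrable (mu := leb) (@leb_lf R) x y 1) i1)).
move=> s _ _; have := N_ge0 (f s); move: (N _) => r r0; nra.
Qed.

Lemma L2_sub c c' f : c <= c' -> L2 (oo_itv c b) f -> L2 (oo_itv c' b) f.
Proof.
move=> cc [m1 m2 fin]; have mo := measurable_oo_itv c; have mo' := measurable_oo_itv c'.
have sub : oo_itv c' b `<=` oo_itv c b.
  by move=> s [h1 h2]; split => //; exact: le_lt_trans h1.
split; [exact: measurable_funS m1|exact: measurable_funS m2|].
apply: le_lt_trans fin; apply: ge0_subset_integral => //.
  apply/measurable_EFinP; under eq_fun do rewrite Nsq.
  by apply: measurable_funD; apply: measurable_funX.
by move=> s _; rewrite lee_fin sqr_ge0.
Qed.

Lemma le_L2 c f (g : R -> R[i]) C :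
  measurable_fun (oo_itv c b : set mR) (fun x => complex.Re (f x)) ->
  measurable_fun (oo_itv c b : set mR) (fun x => complex.Im (f x)) ->
  L2 (oo_itv c b) g ->
  (forall s, oo_itv c b s -> N (f s) ^+ 2 <= C * N (g s) ^+ 2) -> L2 (oo_itv c b) f.
Proof.
move=> f1 f2 [g1 g2 gfin] fg; split => //; have mo := measurable_oo_itv c.
have mf : measurable_fun (oo_itv c b : set mR) (fun s => N (f s) ^+ 2).
  by under eq_fun do rewrite Nsq; apply: measurable_funD; apply: measurable_funX.
have mg : measurable_fun (oo_itv c b : set mR) (fun s => N (g s) ^+ 2).
  by under eq_fun do rewrite Nsq; apply: measurable_funD; apply: measurable_funX.
apply: (@le_lt_trans _ _ (\int[leb]_(x in oo_itv c b) (`|C|%:E * (N (g x) ^+ 2)%:E))%E).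
  apply: ge0_le_integral => //.
  - by move=> s _; rewrite lee_fin sqr_ge0.
  - exact/measurable_EFinP.
  - by apply/measurable_EFinP; apply: measurable_funM => //; exact: measurable_cst.
  - move=> s sI; rewrite -EFinM lee_fin; apply: (le_trans (fg s sI)).
    by rewrite ler_wpM2r ?sqr_ge0// ler_norm.
rewrite ge0_integralZl//.
- by apply: lte_mul_pinfty.
- exact/measurable_EFinP.
- by move=> s _; rewrite lee_fin sqr_ge0.
Qed.

Lemma le_sqD (p q r : R) : 0 <= p -> p <= q + r -> p ^+ 2 <= 2 * (q ^+ 2 + r ^+ 2).
Proof.
move=> p0 pqr; apply: (@le_trans _ _ ((q + r) ^+ 2)).
  by rewrite !expr2; apply: ler_pM.
by have := sqr_ge0 (q - r); rewrite sqrrB sqrrD; flra.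
Qed.

Lemma L2D c f g : L2 (oo_itv c b) f -> L2 (oo_itv c b) g ->
  L2 (oo_itv c b) (fun s => f s + g s).
Proof.
move=> [f1 f2 ffin] [g1 g2 gfin]; have mo := measurable_oo_itv c.
have m1 : measurable_fun (oo_itv c b : set mR) (fun s => complex.Re (f s + g s)).
  by under eq_fun do rewrite cReD; apply: measurable_funD.
have m2 : measurable_fun (oo_itv c b : set mR) (fun s => complex.Im (f s + g s)).
  by under eq_fun do rewrite cImD; apply: measurable_funD.
have mf : measurable_fun (oo_itv c b : set mR) (fun s => N (f s) ^+ 2).
  by under eq_fun do rewrite Nsq; apply: measurable_funD; apply: measurable_funX.
have mg : measurable_fun (oo_itv c b : set mR) (fun s => N (g s) ^+ 2).
  by under eq_fun do rewrite Nsq; apply: measurable_funD; apply: measurable_funX.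
split => //.
apply: (@le_lt_trans _ _ (\int[leb]_(x in oo_itv c b)
   (2%:E * ((N (f x) ^+ 2)%:E + (N (g x) ^+ 2)%:E)))%E).
  apply: ge0_le_integral => //.
  - by move=> s _; rewrite lee_fin sqr_ge0.
  - by apply/measurable_EFinP; under eq_fun do rewrite Nsq;
      apply: measurable_funD; apply: measurable_funX.
  - apply/measurable_EFinP; apply: measurable_funM; first exact: measurable_cst.
    exact: measurable_funD.
  - move=> s sI; rewrite -EFinD -EFinM lee_fin.
    exact: le_sqD (N_ge0 _) (ND _ _).
rewrite ge0_integralZl//; last 2 first.
- by apply: emeasurable_funD; exact/measurable_EFinP.
- by move=> s _; rewrite adde_ge0// lee_fin sqr_ge0.
rewrite ge0_integralD//; last 4 first.
- by move=> s _; rewrite lee_fin sqr_ge0.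
- exact/measurable_EFinP.
- by move=> s _; rewrite lee_fin sqr_ge0.
- exact/measurable_EFinP.
by apply: lte_mul_pinfty => //; exact: lte_add_pinfty.
Qed.

Lemma L2Z c z f : L2 (oo_itv c b) f -> L2 (oo_itv c b) (fun s => z * f s).
Proof.
move=> fL; have [f1 f2 _] := fL.
apply: (@le_L2 _ _ f (N z ^+ 2)) => //.
- by under eq_fun do rewrite cReM; apply: measurable_funB; apply: measurable_funM => //;
    exact: measurable_cst.
- by under eq_fun do rewrite cImM; apply: measurable_funD; apply: measurable_funM => //;
    exact: measurable_cst.
- by move=> s _; rewrite NM exprMn.
Qed.

Lemma L2_nearD t f g : L2_near t b f -> L2_near t b g -> L2_near t b (fun s => f s + g s).
Proof.
move=> [c1 [tc1 c1b] h1] [c2 [tc2 c2b] h2].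
exists (Num.max c1 c2).
  split; first by rewrite le_max tc1.
  by rewrite /Num.max; case: ifP.
by apply: L2D; [apply: L2_sub h1|apply: L2_sub h2]; rewrite le_max lexx ?orbT.
Qed.

Lemma L2_nearZ t z f : L2_near t b f -> L2_near t b (fun s => z * f s).
Proof. by move=> [c tc h]; exists c => //; exact: L2Z. Qed.

Lemma L2_near_sub t t' f : t <= t' -> (t'%:E < b)%E -> L2_near t b f -> L2_near t' b f.
Proof.
move=> tt tb [c [tc cb] h]; exists (Num.max c t').
  split; first by rewrite le_max lexx orbT.
  by rewrite /Num.max; case: ifP.
by apply: L2_sub h; rewrite le_max lexx.
Qed.

End square_integrability.

(** The crude bound [B] makes the supremum M finite; then M <= A + M / 2 gives M <= 2 A, in which
    [B] has disappeared. *)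
Lemma bootstrap (R : realType) (P : set R) (g : R -> R) (A B : R) :
  (forall x, P x -> g x <= B) ->
  (forall M, (forall x, P x -> g x <= M) -> forall x, P x -> g x <= A + M / 2) ->
  forall x, P x -> g x <= 2 * A.
Proof.
move=> gB step x Px.
have hs : has_sup (g @` P).
  by split; [exists (g x), x|exists B => _ [y Py <-]; exact: gB].
have ub y : P y -> g y <= sup (g @` P) by move=> Py; apply: ub_le_sup; [case: hs|exists y].
have : sup (g @` P) <= A + sup (g @` P) / 2.
  apply: ge_sup; first by case: hs.
  by move=> _ [y Py <-]; exact: step.
have := ub x Px; flra.
Qed.

(** * Solutions and Wronskians *)

Section lagrange.
Context (R : realType) (a : R) (b : \bar R) (chi : signed_measure a b).
Notation leb := (@lebesgue_measure R).
Notation mR := (measurableTypeR R).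
Implicit Types (f df g dg h u du v dv : R -> R[i]).

(** Lagrange's identity: both integrations by parts produce the same integral of [f * g] against
    [chi], which cancels together with that of [df * dg]. *)
Lemma wronskian_ode t d f df hf g dg hg x y :
  ode chi t d f df hf -> ode chi t d g dg hg -> t <= x -> x <= y -> y <= d ->
  wronskian f df g dg y - wronskian f df g dg x =
  CI leb (fun s => hf s * g s - f s * hg s) x y.
Proof.
move=> [af bf] [ag bg] tx xy yd.
have af' := acrep_sub tx yd af; have ag' := acrep_sub tx yd ag.
have bf' := bvrep_sub tx yd bf; have bg' := bvrep_sub tx yd bg.
have e1 := integration_by_parts af' bg' xy (lexx y).
have e2 := integration_by_parts ag' bf' xy (lexx y).
have [_ fi _] := bf'; have [_ gi _] := bg'.
have i1 : cI leb x y (fun s => hf s * g s).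
  exact: cI_mulb fi (acrep_bmeas ag').
have i2 : cI leb x y (fun s => f s * hg s).
  apply: eq_cI (cI_mulb gi (acrep_bmeas af')) => s _ _; exact: mulrC.
rewrite CIB// /wronskian.
have -> : f y * dg y - df y * g y - (f x * dg x - df x * g x) =
  (f y * dg y - f x * dg x) - (g y * df y - g x * df x) by ring.
rewrite e1 e2.
have -> : CI leb (fun s => dg s * df s) x y = CI leb (fun s => df s * dg s) x y.
  by apply: eq_CI => s _ _; exact: mulrC.
have -> : SI (posm (chi d)) (negm (chi d)) (fun s => g s * f s) x y =
  SI (posm (chi d)) (negm (chi d)) (fun s => f s * g s) x y.
  by apply: eq_SI => s _ _; exact: mulrC.
have -> : CI leb (fun s => g s * hf s) x y = CI leb (fun s => hf s * g s) x y.
  by apply: eq_CI => s _ _; exact: mulrC.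
ring.
Qed.

Definition rep t f df h := forall d, t <= d -> (d%:E < b)%E -> ode chi t d f df h.

Lemma ode_sub t t' d f df h : t <= t' -> ode chi t d f df h -> ode chi t' d f df h.
Proof. by move=> tt [h1 h2]; split; [apply: acrep_sub h1|apply: bvrep_sub h2]. Qed.

Lemma rep_sub t t' f df h : t <= t' -> rep t f df h -> rep t' f df h.
Proof. by move=> tt rf d td db; apply: (ode_sub tt); apply: rf => //; exact: le_trans td. Qed.

Lemma repJ t f df h : rep t f df h ->
  rep t (fun s => conjc (f s)) (fun s => conjc (df s)) (fun s => conjc (h s)).
Proof. by move=> rf d td db; have [h1 h2] := rf d td db; split; [exact: acrepJ|exact: bvrepJ]. Qed.

Lemma repD t f df h g dg k : rep t f df h -> rep t g dg k ->
  rep t (fun s => f s + g s) (fun s => df s + dg s) (fun s => h s + k s).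
Proof.
move=> rf rg d td db; have [h1 h2] := rf d td db; have [h3 h4] := rg d td db.
by split; [exact: acrepD|exact: bvrepD].
Qed.

Lemma repZ t c f df h : rep t f df h ->
  rep t (fun s => c * f s) (fun s => c * df s) (fun s => c * h s).
Proof. by move=> rf d td db; have [h1 h2] := rf d td db; split; [exact: acrepZ|exact: bvrepZ]. Qed.

Lemma rep_bounded t d f df h : rep t f df h -> t <= d -> (d%:E < b)%E ->
  exists2 M, 0 <= M & forall x, t <= x -> x < d -> N (f x) <= M /\ N (df x) <= M.
Proof.
move=> rf td db; have [h1 h2] := rf d td db.
have [_ [M1 H1]] := acrep_bmeas h1; have [_ [M2 H2]] := bvrep_bmeas h2.
exists (`|M1| + `|M2|) => [|x tx xd]; first by rewrite addr_ge0.
have := H1 x tx xd; have := H2 x tx xd; have := ler_norm M1; have := ler_norm M2.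
have := normr_ge0 M1; have := normr_ge0 M2; by move=> *; split; flra.
Qed.

(** By Lagrange's identity the increments are integrals of [h * g - f * k], which is dominated by
    the sum of the four squared moduli. *)
Lemma wronskian_bounded t c f df h g dg k : rep t f df h -> rep t g dg k ->
  t <= c -> (c%:E < b)%E -> L2b b c f -> L2b b c h -> L2b b c g -> L2b b c k ->
  exists2 B, 0 <= B & forall x, c <= x -> (x%:E < b)%E -> N (wronskian f df g dg x) <= B.
Proof.
move=> rf rg tc cb [K1 l1] [K2 l2] [K3 l3] [K4 l4].
have KK l K : (forall x y, c <= x -> x <= y -> (y%:E < b)%E ->
  [/\ cmeas x y l, leb.-integrable `[x, y[ (EFin \o (fun s => N (l s) ^+ 2)) &
      RI leb (fun s => N (l s) ^+ 2) x y <= K]) -> 0 <= K.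
  by move=> H; have [_ _] := H c c (lexx c) (lexx c) cb; rewrite RI0.
have K10 := KK _ _ l1; have K20 := KK _ _ l2; have K30 := KK _ _ l3; have K40 := KK _ _ l4.
exists (N (wronskian f df g dg c) + 2 * (K1 + K2 + K3 + K4)).
  by rewrite addr_ge0 ?N_ge0// mulr_ge0// !addr_ge0.
move=> x cx xb.
have tx : t <= x by exact: le_trans cx.
have e := wronskian_ode (rf x tx xb) (rg x tx xb) tc cx (lexx x).
rewrite -[X in N X](subrK (wronskian f df g dg c)) e addrC.
apply: (le_trans (ND _ _)); rewrite lerD2l.
have [m1 i1 b1] := l1 c x (lexx c) cx xb; have [m2 i2 b2] := l2 c x (lexx c) cx xb.
have [m3 i3 b3] := l3 c x (lexx c) cx xb; have [m4 i4 b4] := l4 c x (lexx c) cx xb.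
have i12 := integrableD_itvco i1 i2; have i34 := integrableD_itvco i3 i4.
apply: (le_trans (N_CI (g := fun s => (N (f s) ^+ 2 + N (h s) ^+ 2) +
   (N (g s) ^+ 2 + N (k s) ^+ 2)) _ (integrableD_itvco i12 i34) _)).
- apply: cmeasD; first exact: cmeasM.
  have := cmeasM (cmeas_cst c x (-1)) (cmeasM m1 m4).
  by apply: eq_cmeas => s _ _; rewrite mulN1r.
- move=> s _ _; apply: (le_trans (NB _ _)); rewrite !NM.
  have := sqr_ge0 (N (h s) - N (g s)); have := sqr_ge0 (N (f s) - N (k s)).
  have := sqr_ge0 (N (h s)); have := sqr_ge0 (N (g s)).
  have := sqr_ge0 (N (f s)); have := sqr_ge0 (N (k s)).
  rewrite !sqrrB.
  move: (N (h s) * N (g s)) (N (f s) * N (k s)) => p q.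
  move: (N (h s) ^+ 2) (N (g s) ^+ 2) (N (f s) ^+ 2) (N (k s) ^+ 2) => *.
  flra.
- rewrite RID// (RID i1 i2) (RID i3 i4) ler_pM2l//; flra.
Qed.

Lemma wronskian_cycle (p dp q dq r dr : R[i]) :
  p * (q * dr - dq * r) = q * (p * dr - dp * r) - r * (p * dq - dp * q).
Proof. ring. Qed.

Lemma plucker f df g dg h dh k dk x :
  wronskian f df g dg x * wronskian h dh k dk x =
  wronskian f df h dh x * wronskian g dg k dk x - wronskian f df k dk x * wronskian g dg h dh x.
Proof. rewrite /wronskian; ring. Qed.

Lemma wronskianJ f df g dg x :
  wronskian (fun s => conjc (f s)) (fun s => conjc (df s))
    (fun s => conjc (g s)) (fun s => conjc (dg s)) x = conjc (wronskian f df g dg x).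
Proof. by rewrite /wronskian -!rmorphM -rmorphB. Qed.

Definition isol t z u du := rep t u du (fun s => z * u s).

(** Where [u] does not vanish this is |u|^2 Im (u' / u), so its sign for Weyl solutions is the
    Herglotz property of the Weyl function. *)
Definition J u du x : R := complex.Im (du x * conjc (u x)).

Lemma wronskian_conj u du x :
  wronskian u du (fun s => conjc (u s)) (fun s => conjc (du s)) x = 0 +i* (- 2 * J u du x).
Proof.
rewrite /wronskian /J; apply: complex_ext; rewrite !reim /=; ring.
Qed.

(** Lagrange's identity for [u] and its conjugate, where the integrand is 2i Im z |u|^2. *)
Lemma J_decrease t z u du x y : isol t z u du -> t <= x -> x <= y -> (y%:E < b)%E ->
  J u du y = J u du x - complex.Im z * RI leb (fun s => N (u s) ^+ 2) x y.
Proof.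
move=> su tx xy yb; have ty := le_trans tx xy.
have e := wronskian_ode (su y ty yb) (repJ su ty yb) tx xy (lexx y).
move: e; rewrite !wronskian_conj.
have -> : CI leb (fun s => z * u s * conjc (u s) - u s * conjc (z * u s)) x y =
  0 +i* (2 * complex.Im z * RI leb (fun s => N (u s) ^+ 2) x y).
  have [au _] := su y ty yb; have bu := bmeas_sub tx (lexx y) (acrep_bmeas au).
  have ni : leb.-integrable `[x, y[ (EFin \o (fun s => N (u s) ^+ 2)).
    have [i1 _] := leb_cI (bmeasM bu (bmeasJ bu)).
    by apply: eq_integrable_itvco i1 => s _ _; rewrite mulcJ.
  apply: complex_ext; rewrite ?ReCI ?ImCI.
    transitivity (RI leb (fun=> 0) x y).
      apply: eq_RI => s _ _; rewrite !reim; ring.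
    by rewrite RI_cst mul0r.
  rewrite /= -RIZ//; apply: eq_RI => s _ _.
  rewrite Nsq !reim; ring.
move=> /(congr1 (@complex.Im R)); rewrite cImD cImN /=.
move: (RI _ _ _ _) => r; move: (J u du y) (J u du x) (complex.Im z) => p q w.
rewrite -mulrA; move: (w * r) => m; lra.
Qed.

End lagrange.

(** * Boundary behaviour of Wronskians at [b] *)

Section weyl_solutions.
Context (R : realType) (a : R) (b : \bar R) (chi : signed_measure a b).
Notation leb := (@lebesgue_measure R).
Notation mR := (measurableTypeR R).
Implicit Types (f df g dg h u du v dv w dw : R -> R[i]).

Lemma has_limit_leftP f (l : R[i]) : has_limit (left_nbhs b) f l <->
  forall e, 0 < e -> exists2 c, (c%:E < b)%E &
    forall x, c < x -> (x%:E < b)%E -> N (f x - l) < e.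
Proof.
split=> [fl e e0|fl A /nbhs_ballP[e /= e0 eA]].
  have [c cb h] := fl _ (nbhsx_ballx 0 e e0).
  exists c => // x cx xb; have := h x (conj cx xb).
  by rewrite /= /ball/= sub0r normrN ger0_norm ?N_ge0.
have [c cb h] := fl e e0; exists c => // x [cx xb]; apply: eA.
by rewrite /ball/= sub0r normrN ger0_norm ?N_ge0//; exact: h.
Qed.

Lemma lt_maxb (x y : R) : (x%:E < b)%E -> (y%:E < b)%E -> ((Num.max x y)%:E < b)%E.
Proof. by move=> xb yb; rewrite /Num.max; case: ifP. Qed.

Lemma dom_Tmax_rep f df : dom_Tmax chi f df ->
  exists h, [/\ rep chi a f df h, L2b b a f & L2b b a h].
Proof.
move=> [h [tf fL hL]]; exists h; split; try exact: L2_L2b.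
move=> d ad db; apply: tau_is_ode => //.
by apply: (L2b_cI (L2_L2b hL)).
Qed.

(** Local Lipschitz continuity gives continuity on the open interval, hence measurability all the
    way to [b], where no single representation on a compact interval reaches. *)
Lemma rep_measurable t c f df h : rep chi t f df h -> t <= c ->
  measurable_fun (oo_itv c b : set mR) (fun x => complex.Re (f x)) /\
  measurable_fun (oo_itv c b : set mR) (fun x => complex.Im (f x)).
Proof.
move=> rf tc.
have lip x : oo_itv c b x -> exists M, exists2 e, 0 < e &
    forall y, `|x - y| < e -> N (f x - f y) <= M * `|x - y|.
  move=> [cx xb]; have [d xd db] := lt_dense xb.
  have [af _] := rf d (le_trans tc (ltW (lt_trans cx xd))) db.
  have [M M0 hM] := acrep_lip af.
  exists M; exists (Num.min (d - x) (x - c)).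
    by rewrite lt_min !subr_gt0 xd cx.
  move=> y; rewrite lt_min => /andP[h1 h2].
  have := ler_norm (x - y); have := ler_norm (y - x); rewrite (distrC y x) => h3 h4.
  have [xy|yx] := leP x y.
    rewrite NBC distrC (ger0_norm (x := y - x)); last by flra.
    by apply: hM => //; flra.
  rewrite (ger0_norm (x := x - y)); last by flra.
  by apply: hM; flra.
have cont (g : R -> R) : (forall x y, `|g x - g y| <= N (f x - f y)) ->
    measurable_fun (oo_itv c b : set mR) g.
  move=> gf; apply: open_continuous_measurable_fun; first exact: open_oo_itv.
  move=> x; rewrite inE => xI; have [M [e e0 hM]] := lip x xI.
  apply/cvgrPdist_lt => eps eps0.
  have d0 : 0 < Num.min e (eps / (`|M| + 1)).
    by rewrite lt_min e0 divr_gt0// ltr_wpDl.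
  apply/nbhs_ballP; exists (Num.min e (eps / (`|M| + 1))) => //= y.
  rewrite /ball/= lt_min => /andP[h1 h2].
  apply: (le_lt_trans (gf x y)); apply: (le_lt_trans (hM y h1)).
  move: h2; rewrite ltr_pdivlMr ?ltr_wpDl// => h2; apply: le_lt_trans h2.
  rewrite mulrC ler_wpM2l//; have := ler_norm M; flra.
split; apply: cont => x y.
  by rewrite -cReN -cReD; exact: N_Re.
by rewrite -cImN -cImD; exact: N_Im.
Qed.

(* [u] and [w] have vanishing boundary values, hence so does [W(u, conj u)], by
   the Pluecker identity with a second function [h] such that
   [W_b(h, conj w) != 0]. *)
Lemma limit_circle_contra w dw t u du hu c0 x0 c : boundary_function chi w dw ->
  a <= t -> rep chi t u du hu -> t <= c0 -> (c0%:E < b)%E ->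
  L2b b c0 u -> L2b b c0 hu ->
  wronskian_conj_lim (b := b) u du w dw 0 -> 0 < c -> (x0%:E < b)%E ->
  (forall y, x0 <= y -> (y%:E < b)%E ->
    c <= N (wronskian u du (fun s => conjc (u s)) (fun s => conjc (du s)) y)) -> False.
Proof.
move=> [dw1 ww [h [dh [l [dh1 hl l0]]]]] at_ ru tc0 c0b lu lhu uw c0' x0b hc.
have [tw [rw lw ltw]] := dom_Tmax_rep dw1.
have [th [rh lh lth]] := dom_Tmax_rep dh1.
have ac0 := le_trans at_ tc0.
have rwt := rep_sub at_ rw; have rht := rep_sub at_ rh.
have sw := L2b_sub ac0 lw; have stw := L2b_sub ac0 ltw.
have sh := L2b_sub ac0 lh; have sth := L2b_sub ac0 lth.
have [B1 B10 hB1] := wronskian_bounded ru rht tc0 c0b lu lhu sh sth.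
have [B2 B20 hB2] := wronskian_bounded rwt rht tc0 c0b sw stw sh sth.
have [B3 B30 hB3] := wronskian_bounded (repJ ru) rht tc0 c0b (L2bJ lu) (L2bJ lhu) sh sth.
pose B := B1 + B2 + B3.
have B0 : 0 <= B by rewrite !addr_ge0.
pose L := N l.
have L0 : 0 < L by exact: N_gt0.
(* The argument ends with c L / 2 <= e (D - 1), whereas [e] is chosen with e D <= c L / 4. *)
pose D := 4 * B ^+ 2 / L + B + 1.
have D0 : 0 < D.
  by rewrite ltr_wpDl// addr_ge0// divr_ge0 ?mulr_ge0 ?sqr_ge0// ltW.
pose e := Num.min (L / 2) (c * L / (4 * D)).
have e0 : 0 < e by rewrite lt_min !divr_gt0// ?mulr_gt0.
have [c1 c1b h1] := (has_limit_leftP _ _).1 ww e e0.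
have [c2 c2b h2] := (has_limit_leftP _ _).1 hl e e0.
have [c3 c3b h3] := (has_limit_leftP _ _).1 uw e e0.
have mb := lt_maxb (lt_maxb c1b c2b) (lt_maxb c3b (lt_maxb c0b x0b)).
have [x + xb] := lt_dense mb.
rewrite !gt_max => /andP[/andP[x1 x2] /andP[x3 /andP[x4 x5]]].
have := h1 x x1 xb; have := h2 x x2 xb; have := h3 x x3 xb; rewrite !subr0.
have := hB1 x (ltW x4) xb; have := hB2 x (ltW x4) xb; have := hB3 x (ltW x4) xb.
have := hc x (ltW x5) xb.
(* [p1] yields W(u, w) -> 0 from the vanishing limits of W(w, conj w) and W(u, conj w). Then [p2]
   yields W(u, conj u) -> 0, as W(conj u, conj w) is the conjugate of W(u, w). In both, W(h, conj w)
   stays away from 0. *)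
have p1 := plucker u du w dw h dh (fun s => conjc (w s)) (fun s => conjc (dw s)) x.
have p2 := plucker u du (fun s => conjc (u s)) (fun s => conjc (du s)) h dh
  (fun s => conjc (w s)) (fun s => conjc (dw s)) x.
move: p1 p2; rewrite wronskianJ.
move: (wronskian _ _ _ _ x) (wronskian _ _ _ _ x) (wronskian _ _ _ _ x)
 (wronskian _ _ _ _ x) (wronskian _ _ _ _ x) (wronskian _ _ _ _ x) (wronskian _ _ _ _ x)
 (wronskian _ _ _ _ x) => Wu'h Wuu' Wwh Wuw' Www' Wuh Whw' Wuw p1 p2 k1 k2 k3 k4 k5 k6 k7.
have kB1 : N Wuh <= B by rewrite /B; flra.
have kB2 : N Wwh <= B by rewrite /B; flra.
have kB3 : N Wu'h <= B by rewrite /B; flra.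
have eL : e <= L / 2 by rewrite ge_min lexx.
have eD : e * (4 * D) <= c * L.
  by rewrite -ler_pdivlMr ?mulr_gt0// ge_min lexx orbT.
have nL : L / 2 <= N Whw'.
  have := N_geB l Whw'; rewrite NBC -/L; move: k6 eL; clear; lra.
have q1 : N Wuw * (L / 2) <= 2 * B * e.
  apply: (@le_trans _ _ (N Wuw * N Whw')); first by rewrite ler_wpM2l// N_ge0.
  rewrite -NM p1; apply: (le_trans (NB _ _)); rewrite !NM.
  apply: (@le_trans _ _ (B * e + e * B)); last by rewrite (mulrC e) -mulrA mulr_natl mulr2n.
  by apply: lerD; apply: ler_pM; rewrite ?N_ge0//; exact: ltW.
have q2 : N Wuu' * (L / 2) <= B * N Wuw + e * B.
  apply: (@le_trans _ _ (N Wuu' * N Whw')); first by rewrite ler_wpM2l// N_ge0.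
  rewrite -NM p2; apply: (le_trans (NB _ _)); rewrite !NM NJ.
  by apply: lerD; apply: ler_pM; rewrite ?N_ge0//; exact: ltW.
have q3 : N Wuw <= 4 * B * e / L.
  rewrite ler_pdivlMr//; move: q1; rewrite mulrA; move: (N Wuw * L) => s; lra.
have q4 : c * L / 2 <= e * (D - 1).
  apply: (@le_trans _ _ (N Wuu' * (L / 2))).
    by rewrite -mulrA ler_wpM2r// divr_ge0// ltW.
  apply: (le_trans q2).
  have -> : e * (D - 1) = e * (4 * B ^+ 2 / L) + e * B by rewrite /D; ring.
  rewrite lerD2r.
  apply: (@le_trans _ _ (B * (4 * B * e / L))); first by rewrite ler_wpM2l.
  by apply: le_of_eq; field; rewrite gt_eqF.
have cL : 0 < c * L by exact: mulr_gt0.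
move: q4 eD cL D0 e0; rewrite mulrBr mulr1 mulrCA; move: (e * D) (c * L) => s r; clear; lra.
Qed.

(* Since [v W(u, conj u) = u W(v, conj u) - conj u W(v, u)] for every solution
   [v], possibly at another spectral parameter, and since the Wronskians on the
   right stay bounded (absorption argument), [v] inherits the square
   integrability of [u]. *)
Lemma limit_point_contra t z u du c0 x0 c :
  a <= t -> isol chi t z u du -> t <= c0 -> (c0%:E < b)%E ->
  L2 (oo_itv c0 b) u -> 0 < c -> (x0%:E < b)%E ->
  (forall y, x0 <= y -> (y%:E < b)%E ->
    c <= N (wronskian u du (fun s => conjc (u s)) (fun s => conjc (du s)) y)) ->
  limit_circle chi.
Proof.
move=> at_ su tc0 c0b Lu cp x0b hc z' v dv solv.
have lu := L2_L2b Lu.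
have sv : isol chi a z' v dv.
  by move=> d ad db; apply: solution_ode.
pose x2 := Num.max c0 x0.
have x2b : (x2%:E < b)%E by exact: lt_maxb.
have c0x2 : c0 <= x2 by rewrite le_max lexx.
have x0x2 : x0 <= x2 by rewrite le_max lexx orbT.
pose D := N z' + N z.
have D0 : 0 <= D by rewrite addr_ge0 ?N_ge0.
(* Beyond [x1] each of the two Wronskians then changes by at most [2 * (D * M / c * eta) <= M / 4];
   together they give the M / 2 of the absorption argument. *)
pose eta := c / (8 * (D + 1)).
have eta0 : 0 < eta by rewrite divr_gt0// mulr_gt0// ltr_wpDl.
have [K hK] := lu.
pose I y := RI leb (fun s => N (u s) ^+ 2) x2 y.
pose S := [set r | exists y, [/\ x2 <= y, (y%:E < b)%E & r = I y]].
have hS : has_sup S.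
  split; first by exists (I x2), x2.
  by exists K => _ [y [h1 h2 ->]]; have [] := hK x2 y c0x2 h1 h2.
have [_ [x1 [x21 x1b ->]] Ix1] := sup_adherent eta0 hS.
have tail y : x1 <= y -> (y%:E < b)%E -> RI leb (fun s => N (u s) ^+ 2) x1 y <= eta.
  move=> x1y yb; have x2y := le_trans x21 x1y.
  have [_ i1 _] := hK x2 y c0x2 x2y yb.
  have IyS : I y <= sup S by apply: ub_le_sup; [case: hS|exists y].
  by move: IyS; rewrite /I (RI_add x21 x1y i1); move: Ix1; rewrite /I; flra.
have c0x1 := le_trans c0x2 x21.
have tx1 := le_trans tc0 c0x1; have ax1 := le_trans at_ tx1.
pose A x := wronskian v dv u du x.
pose Bb x := wronskian v dv (fun s => conjc (u s)) (fun s => conjc (du s)) x.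
pose n x := N (A x) + N (Bb x).
have n0 x : 0 <= n x by rewrite addr_ge0 ?N_ge0.
have vn x : x1 <= x -> (x%:E < b)%E -> N (v x) <= N (u x) * n x / c.
  move=> x1x xb; rewrite ler_pdivlMr//.
  have := hc x (le_trans x0x2 (le_trans x21 x1x)) xb.
  move=> /(ler_wpM2l (N_ge0 (v x))) h; apply: (le_trans h).
  rewrite -NM /wronskian (wronskian_cycle (v x) (dv x)); apply: (le_trans (NB _ _)).
  by rewrite !NM NJ -mulrDr addrC.
(* Stopping at [X] below [b] provides the a priori bound needed for absorption; the resulting bound
   does not depend on [X]. *)
have key X : x1 <= X -> (X%:E < b)%E -> forall x, x1 <= x < X -> n x <= 2 * n x1.
  move=> x1X Xb.
  have [M1 M10 hM1] := rep_bounded (rep_sub ax1 sv) x1X Xb.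
  have [M2 M20 hM2] := rep_bounded (rep_sub tx1 su) x1X Xb.
  apply: (@bootstrap _ (fun x => x1 <= x < X) n (n x1) (4 * (M1 * M2))).
    move=> x /andP[x1x xX]; have [v1 v2] := hM1 x x1x xX; have [u1 u2] := hM2 x x1x xX.
    have b1 : N (A x) <= M1 * M2 + M1 * M2.
      apply: (le_trans (NB _ _)); rewrite !NM.
      by apply: lerD; apply: ler_pM; rewrite ?N_ge0.
    have b2 : N (Bb x) <= M1 * M2 + M1 * M2.
      apply: (le_trans (NB _ _)); rewrite !NM !NJ.
      by apply: lerD; apply: ler_pM; rewrite ?N_ge0.
    by rewrite /n; flra.
  move=> M hM x /andP[x1x xX].
  have xb : (x%:E < b)%E by apply: lt_trans Xb; rewrite lte_fin.
  have M0 : 0 <= M by apply: le_trans (n0 x) _; apply: hM; rewrite x1x xX.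
  have [mu i1 _] := hK x1 x c0x1 x1x xb.
  have [av _] := sv x (le_trans ax1 x1x) xb.
  have mv : cmeas x1 x v.
    by have [m1 _] := bmeas_sub ax1 (lexx x) (acrep_bmeas av).
  have est (F : R -> R[i]) : cmeas x1 x F ->
     (forall s, N (F s) <= D * (N (v s) * N (u s))) ->
     N (CI leb F x1 x) <= M / 4.
    move=> mF hF.
    apply: (le_trans (N_CI (g := fun s => (D * M / c) * N (u s) ^+ 2) mF _ _)).
    - exact: integrableZ_itvco.
    - move=> s s1 s2; apply: (le_trans (hF s)).
      have sb : (s%:E < b)%E by apply: lt_trans xb; rewrite lte_fin.
      rewrite -!mulrA ler_wpM2l//.
      apply: (@le_trans _ _ (N (u s) * n s / c * N (u s))).
        by rewrite ler_wpM2r ?N_ge0// vn.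
      have -> : N (u s) * n s / c * N (u s) = n s * (c^-1 * N (u s) ^+ 2) by ring.
      apply: ler_wpM2r; last by apply: hM; rewrite s1 (lt_trans s2 xX).
      by apply: mulr_ge0; [rewrite invr_ge0 ltW|exact: sqr_ge0].
    - rewrite RIZ//.
      apply: (@le_trans _ _ (2 * ((D * M / c) * eta))).
        rewrite ler_pM2l// ler_wpM2l ?tail// divr_ge0 ?mulr_ge0//; exact: ltW.
      have -> : 2 * (D * M / c * eta) = M / 4 * (D / (D + 1)).
        by rewrite /eta; field; rewrite gt_eqF ?gt_eqF// ltr_wpDl.
      rewrite ler_piMr ?divr_ge0// ler_pdivrMr ?ltr_wpDl// mul1r lerDl//.
  have tx := le_trans tx1 x1x.
  have eA : A x = A x1 + CI leb (fun s => z' * v s * u s - v s * (z * u s)) x1 x.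
    rewrite -(wronskian_ode (rep_sub at_ sv tx xb) (su x tx xb) tx1 x1x (lexx x)).
    by rewrite addrC subrK.
  have eB : Bb x = Bb x1 +
      CI leb (fun s => z' * v s * conjc (u s) - v s * conjc (z * u s)) x1 x.
    rewrite -(wronskian_ode (rep_sub at_ sv tx xb) (repJ su tx xb) tx1 x1x (lexx x)).
    by rewrite addrC subrK.
  have mm (g : R -> R[i]) y : cmeas x1 x g -> cmeas x1 x (fun s => y * g s).
    by apply: cmeasM; exact: cmeas_cst.
  have mB (g k : R -> R[i]) : cmeas x1 x g -> cmeas x1 x k -> cmeas x1 x (fun s => g s - k s).
    move=> mg /(mm _ (-1)) mk; apply: eq_cmeas (cmeasD mg mk) => s _ _.
    by rewrite mulN1r.
  have hA := est _ (mB _ _ (cmeasM (mm _ z' mv) mu) (cmeasM mv (mm _ z mu))).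
  have hB := est _ (mB _ _ (cmeasM (mm _ z' mv) (cmeasJ mu)) (cmeasM mv (cmeasJ (mm _ z mu)))).
  have : n x <= n x1 + (M / 4 + M / 4).
    rewrite /n eA eB; apply: (@le_trans _ _ ((N (A x1) + M / 4) + (N (Bb x1) + M / 4))).
      apply: lerD; apply: (le_trans (ND _ _)); rewrite lerD2l.
        apply: hA => s; apply: (le_trans (NB _ _)); rewrite !NM /D.
        by apply: le_of_eq; ring.
      apply: hB => s; apply: (le_trans (NB _ _)); rewrite !NM !NJ !NM /D.
      by apply: le_of_eq; ring.
    by move: (N (A x1)) (N (Bb x1)) => r s; flra.
  flra.
have nx x : x1 <= x -> (x%:E < b)%E -> n x <= 2 * n x1.
  move=> x1x xb; have [X xX Xb] := lt_dense xb.
  by apply: (key X) => //; [exact: ltW (le_lt_trans x1x xX)|rewrite x1x xX].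
exists x1; first by [].
have [m1 m2] := rep_measurable sv ax1.
apply: (@le_L2 _ _ _ _ u ((2 * n x1 / c) ^+ 2)) => //; first exact: L2_sub Lu.
move=> s [x1s sb]; rewrite -exprMn ler_pXn2r ?nnegrE ?N_ge0//.
  apply: (le_trans (vn s (ltW x1s) sb)); rewrite mulrC -mulrA [X in _ <= X]mulrC.
  rewrite (mulrC (c^-1)) -!mulrA; apply: ler_wpM2l; first exact: N_ge0.
  by rewrite !mulrA ler_wpM2r ?invr_ge0 ?(ltW cp)// nx// ltW.
by rewrite mulr_ge0 ?N_ge0// divr_ge0 ?mulr_ge0// ltW.
Qed.

End weyl_solutions.

(** * The Weyl solution *)

Section weyl_function.
Context (R : realType) (a : R) (b : \bar R) (chi : signed_measure a b).
Notation leb := (@lebesgue_measure R).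
Notation mR := (measurableTypeR R).
Implicit Types (f df g dg h u du v dv : R -> R[i]).
Variables (w dw : R -> R[i]).
Hypothesis hw : limit_circle chi -> boundary_function chi w dw.

(* The solutions among which the Weyl function selects. *)
Definition Wsol t z u du := [/\ isol chi t z u du, L2_near t b u & bc_at_b chi w dw u du].

Lemma WsolD t z u du v dv : Wsol t z u du -> Wsol t z v dv ->
  Wsol t z (fun s => u s + v s) (fun s => du s + dv s).
Proof.
move=> [u1 u2 u3] [v1 v2 v3]; split.
- move=> d td db; have [h1 h2] := repD u1 v1 td db.
  have e : (fun s => z * (u s + v s)) = (fun s => z * u s + z * v s).
    by apply/funext => s; rewrite mulrDr.
  by split => //; rewrite e.
- exact: L2_nearD.
- move=> lc; apply/has_limit_leftP => e e0.
  have e20 : 0 < e / 2 by rewrite divr_gt0.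
  have [c1 c1b h1] := (has_limit_leftP _ _ _).1 (u3 lc) _ e20.
  have [c2 c2b h2] := (has_limit_leftP _ _ _).1 (v3 lc) _ e20.
  exists (Num.max c1 c2); first exact: lt_maxb.
  move=> x; rewrite gt_max => /andP[x1 x2] xb.
  have := h1 x x1 xb; have := h2 x x2 xb; rewrite !subr0 => k1 k2.
  have -> : wronskian (fun s => u s + v s) (fun s => du s + dv s)
     (fun s => conjc (w s)) (fun s => conjc (dw s)) x =
     wronskian u du (fun s => conjc (w s)) (fun s => conjc (dw s)) x +
     wronskian v dv (fun s => conjc (w s)) (fun s => conjc (dw s)) x.
    by rewrite /wronskian; ring.
  by apply: (le_lt_trans (ND _ _)); flra.
Qed.

Lemma WsolZ t z c u du : Wsol t z u du -> Wsol t z (fun s => c * u s) (fun s => c * du s).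
Proof.
move=> [u1 u2 u3]; split.
- move=> d td db; have [h1 h2] := repZ c u1 td db.
  have e : (fun s => z * (c * u s)) = (fun s => c * (z * u s)).
    by apply/funext => s; rewrite mulrCA.
  by split => //; rewrite e.
- exact: L2_nearZ.
- move=> lc; apply/has_limit_leftP => e e0.
  have e20 : 0 < e / (N c + 1) by rewrite divr_gt0// ltr_wpDl ?N_ge0.
  have [c1 c1b h1] := (has_limit_leftP _ _ _).1 (u3 lc) _ e20.
  exists c1 => // x x1 xb; have := h1 x x1 xb; rewrite !subr0 => k1.
  have -> : wronskian (fun s => c * u s) (fun s => c * du s)
     (fun s => conjc (w s)) (fun s => conjc (dw s)) x =
     c * wronskian u du (fun s => conjc (w s)) (fun s => conjc (dw s)) x.
    by rewrite /wronskian; ring.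
  rewrite NM; move: k1; rewrite ltr_pdivlMr ?ltr_wpDl ?N_ge0//.
  by rewrite mulrDr mulr1 mulrC; apply: le_lt_trans; rewrite lerDl N_ge0.
Qed.

Lemma Wsol_sub t t' z u du : t <= t' -> (t'%:E < b)%E -> Wsol t z u du -> Wsol t' z u du.
Proof.
move=> tt tb [u1 u2 u3]; split => //; first exact: rep_sub u1.
exact: L2_near_sub u2.
Qed.

(** A negative value of [J] persists to the right, since [J] decreases, so |W(u, conj u)| stays away
    from 0. With [u] square integrable this forces the limit-circle case, where the boundary
    condition makes it impossible. *)
Lemma Wsol_J_ge0 t z u du x : 0 < complex.Im z -> a <= t -> Wsol t z u du ->
  t <= x -> (x%:E < b)%E -> 0 <= J u du x.
Proof.
move=> z0 at_ [su [c0 [tc0 c0b] Lu] bc] tx xb; rewrite leNgt; apply/negP => Jx.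
pose c := - 2 * J u du x.
have c_gt0 : 0 < c by rewrite /c mulNr oppr_gt0 pmulr_rlt0.
have hc y : x <= y -> (y%:E < b)%E ->
    c <= N (wronskian u du (fun s => conjc (u s)) (fun s => conjc (du s)) y).
  move=> xy yb; rewrite wronskian_conj.
  have -> : N (0 +i* (- 2 * J u du y)) = `|- 2 * J u du y|.
    by rewrite /= expr0n/= add0r sqrtr_sqr.
  apply: le_trans (ler_norm _); rewrite /c !mulNr lerN2 ler_pM2l//.
  rewrite (J_decrease su tx xy yb) gerBl; apply: mulr_ge0; first exact: ltW.
  by apply: RI_ge0 => s _ _; exact: sqr_ge0.
have lc : limit_circle chi.
  exact: (limit_point_contra at_ su tc0 c0b Lu c_gt0 xb hc).
apply: (limit_circle_contra (hw lc) at_ su tc0 c0b _ _ (bc lc) c_gt0 xb hc).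
  exact: L2_L2b.
exact/L2bZ/L2_L2b.
Qed.

Lemma CI_cst (c : R[i]) x y : x <= y -> CI leb (fun=> c) x y = c * (y - x)%:C.
Proof.
by move=> xy; apply: complex_ext; rewrite ?ReCI ?ImCI RI_cst fine_leb_itvco// (cReM, cImM) /=; ring.
Qed.

(** Uniqueness by positivity: [J] vanishes at [t] and is nonnegative later, so the integral of |u|^2
    is 0 and [u] vanishes to the right of [t]. Then [du] is constant there, an atom at [t]
    contributing nothing as [u t = 0], and the constant must be 0. *)
Lemma Wsol_eq0 t z u du : 0 < complex.Im z -> a <= t -> (t%:E < b)%E ->
  Wsol t z u du -> u t = 0 -> du t = 0.
Proof.
move=> z0 at_ tb Wu ut; have [su _ _] := Wu.
have [y0 ty0 y0b] := lt_dense tb.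
have Iz y : t <= y -> (y%:E < b)%E -> RI leb (fun s => N (u s) ^+ 2) t y <= 0.
  move=> ty yb; have := Wsol_J_ge0 z0 at_ Wu ty yb.
  rewrite (J_decrease su (lexx t) ty yb).
  have -> : J u du t = 0 by rewrite /J ut conjc0 mulr0.
  by rewrite sub0r oppr_ge0 pmulr_rle0.
have [au bu] := su y0 (ltW ty0) y0b.
have [M M0 hM] := acrep_lip au.
have us s : t <= s -> s < y0 -> u s = 0.
  move=> ts sy; apply/eqP/negP => /negP/N_gt0 e0.
  set e := N (u s) in e0.
  (* With Lipschitz constant [M], the modulus of [u] stays above [e / 2] on [[s, s + del[]. *)
  pose del := Num.min (y0 - s) (e / 2 / (M + 1)).
  have del0 : 0 < del by rewrite lt_min subr_gt0 sy divr_gt0 ?divr_gt0// ltr_wpDl.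
  pose y := s + del.
  have sy' : s <= y by rewrite lerDl ltW.
  have yy0 : y <= y0.
    have : del <= y0 - s by rewrite ge_min lexx.
    by rewrite /y; flra.
  have Mdel : M * del <= e / 2.
    have : del <= e / 2 / (M + 1) by rewrite ge_min lexx orbT.
    rewrite ler_pdivlMr ?ltr_wpDl// mulrDr mulr1 mulrC; apply: le_trans.
    by rewrite lerDl ltW.
  have yb : (y%:E < b)%E by apply: le_lt_trans y0b; rewrite lee_fin.
  have ty : t <= y := le_trans ts sy'.
  have bu2 : leb.-integrable `[t, y[ (EFin \o (fun r => N (u r) ^+ 2)).
    have bb := bmeas_sub (lexx t) yy0 (acrep_bmeas au).
    have [i1 _] := leb_cI (bmeasM bb (bmeasJ bb)).
    by apply: eq_integrable_itvco i1 => r _ _; rewrite mulcJ.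
  have := Iz y ty yb; apply/negP; rewrite -ltNge (RI_add ts sy' bu2) ltr_wpDl//.
    by apply: RI_ge0 => r _ _; exact: sqr_ge0.
  apply: (@lt_le_trans _ _ (RI leb (fun=> (e / 2) ^+ 2) s y)).
    rewrite RI_cst fine_leb_itvco// /y addrC addKr mulr_gt0// exprn_gt0//.
    by rewrite divr_gt0.
  apply: le_RI.
  - exact: cst_integrable (@leb_lf R) _ _ _.
  - by apply: integrable_itvcoS bu2.
  move=> r sr ry; rewrite ler_pXn2r ?nnegrE ?N_ge0 ?divr_ge0 ?(ltW e0)//.
  have := hM s r ts sr (le_trans (ltW ry) yy0).
  have : M * (r - s) <= M * del.
    by apply: ler_wpM2l => //; rewrite lerBlDl; exact: ltW.
  have := N_geB (u s) (u r); rewrite (NBC (u s)) -/e.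
  move: (M * (r - s)) (M * del) Mdel (N (u r - u s)) (N (u r)) => *; flra.
have du_cst s : t <= s -> s < y0 -> du s = du t.
  move=> ts sy; rewrite (bvrepE bu (lexx t) ts (ltW sy)).
  rewrite (eq_SI _ _ (g := fun=> 0)) ?SI_0; last first.
    by move=> r tr rs; rewrite us// (lt_trans rs).
  rewrite (eq_CI _ (g := fun=> 0)) ?CI_cst// ?mul0r ?subr0 ?addr0//.
  by move=> r tr rs; rewrite us ?mulr0// (lt_trans rs).
pose y := (t + y0) / 2.
have ty : t < y by rewrite /y; flra.
have yy0 : y < y0 by rewrite /y; flra.
have := acrepE au (lexx t) (ltW ty) (ltW yy0).
rewrite ut us ?(ltW ty)// add0r (eq_CI _ (g := fun=> du t)); last first.
  by move=> r tr ry; apply: du_cst => //; exact: lt_trans yy0.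
rewrite CI_cst ?(ltW ty)// => /esym/eqP; rewrite mulf_eq0 => /orP[/eqP //|].
by rewrite eq_complex /= subr_eq0 gt_eqF.
Qed.

(** The second solution [s] is retained because its Wronskian with [u] equals 1 at [t]; a common
    zero of [u] and [du] is thereby excluded later. *)
Lemma weyl_number_Wsol t z M : a <= t -> (t%:E < b)%E -> is_weyl_number chi w dw z t M ->
  exists u du, [/\ Wsol t z u du, u t = 1, du t = M &
    exists s ds, [/\ isol chi t z s ds, s t = 0 & ds t = 1]].
Proof.
move=> at_ tb [c [dc [s [ds [[sc c1 c0] [ss s0 s1] L bc]]]]].
have rc : isol chi t z c dc by move=> d td db; apply: solution_ode.
have rs : isol chi t z s ds by move=> d td db; apply: solution_ode.
exists (fun x => c x + M * s x), (fun x => dc x + M * ds x); split.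
- split => // d td db; have [h1 h2] := repD rc (repZ M rs) td db.
  have e : (fun x => z * (c x + M * s x)) = (fun x => z * c x + M * (z * s x)).
    by apply/funext => x; ring.
  by split => //; rewrite e.
- by rewrite c1 s0 mulr0 addr0.
- by rewrite c0 s1 mulr1 add0r.
- by exists s, ds.
Qed.

(** The condition at [b] does not depend on the left endpoint. For the Weyl solution v at [t], the
    combination u(t) v - u vanishes at [t], hence so does its derivative, which gives u'(t) = u(t)
    m(z, t). If u(t) were 0, so would be u'(t), against the constancy of the Wronskian with [s]. *)
Lemma weyl_solution (m : R[i] -> R -> R[i]) z : (a%:E < b)%E ->
  is_weyl_function chi w dw m -> 0 < complex.Im z ->
  exists u du, [/\ isol chi a z u du,
    forall t, a <= t -> (t%:E < b)%E -> u t != 0 /\ m z t = du t / u t &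
    forall x y, a <= x -> x <= y -> (y%:E < b)%E ->
      complex.Im z * RI leb (fun s => N (u s) ^+ 2) x y <= J u du x].
Proof.
move=> ab hm z0.
have zn0 : complex.Im z != 0 by rewrite gt_eqF.
have [u [du [Wu ua dua [s [ds [ss sa dsa]]]]]] :=
  weyl_number_Wsol (lexx a) ab (hm z a zn0 (conj (lexx a) ab)).
have [su _ _] := Wu.
exists u, du; split => //.
- move=> t at_ tb.
  have [v [dv [Wv vt dvt _]]] := weyl_number_Wsol at_ tb (hm z t zn0 (conj at_ tb)).
  have Wut := Wsol_sub at_ tb Wu.
  have e : du t = u t * m z t.
    have := Wsol_eq0 z0 at_ tb (WsolD (WsolZ (u t) Wv) (WsolZ (-1) Wut)).
    rewrite vt dvt mulr1 !mulN1r subrr => /(_ erefl)/eqP.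
    by rewrite subr_eq0 => /eqP.
  have ut0 : u t != 0.
    apply/negP => /eqP ut.
    have := wronskian_ode (su t at_ tb) (ss t at_ tb) (lexx a) at_ (lexx t).
    rewrite /wronskian e ut ua dua sa dsa !mul0r subrr mulr0 mulr1 subr0 sub0r.
    rewrite (eq_CI _ (g := fun=> 0)); last by move=> r _ _; ring.
    rewrite CI_cst// mul0r => /eqP; rewrite oppr_eq0 oner_eq0 //.
  by split => //; rewrite e mulrC mulKf.
- move=> x y ax xy yb.
  have := Wsol_J_ge0 z0 (lexx a) Wu (le_trans ax xy) yb.
  by rewrite (J_decrease su ax xy yb) subr_ge0.
Qed.

End weyl_function.

(** * Smooth functions and the complex exponential *)

Section smooth.
Context (R : realType).
Notation leb := (@lebesgue_measure R).

Lemma continuous_meas (x y : R) (f : R -> R) : continuous f -> meas x y f.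
Proof.
by move=> cf; apply: (measurable_funS _ _ (continuous_measurable_fun cf)).
Qed.

Lemma continuous_bounded (x y : R) (f : R -> R) : continuous f ->
  exists M, forall s, x <= s -> s <= y -> `|f s| <= M.
Proof.
move=> cf; have [xy|yx] := leP x y; last by exists 0 => s h1 h2; flra.
have cn : continuous (fun s => `|f s|).
  by move=> s; apply: cvg_norm; exact: cf.
have [c _ hc] := EVT_max xy (continuous_subspaceT cn).
by exists `|f c| => s xs sy; apply: hc; rewrite in_itv/= xs sy.
Qed.

Lemma RI_FTC (f f' : R -> R) x y : (forall s : R, is_derive s (1 : R) f (f' s)) ->
  continuous f' -> x <= y -> RI leb f' x y = f y - f x.
Proof.
move=> df cf'; rewrite le_eqVlt => /orP[/eqP ->|xy]; first by rewrite RI0 subrr.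
have cf : continuous f.
  move=> s; apply: differentiable_continuous; apply/derivable1_diffP.
  by have [] := df s.
have [M hM] := continuous_bounded x y cf'.
have fi : leb.-integrable `[x, y[ (EFin \o f').
  apply: (meas_bounded_integrable (mu := leb) (@leb_lf R) (M := M)).
    exact: continuous_meas.
  by move=> s xs sy; apply: hM => //; exact: ltW.
rewrite /RI Rintegral_itv_bndo_bndc// /Rintegral (@continuous_FTC2 _ f' f)//.
- exact: continuous_subspaceT.
- split.
  + by move=> s _; have [] := df s.
  + apply: cvg_at_right_filter; exact: cf.
  + apply: cvg_at_left_filter; exact: cf.
- by move=> s _; rewrite derive1E; have [_ ->] := df s.
Qed.

Lemma acrep_smooth (F F' : R -> R[i]) t d :
  (forall s : R, is_deriv F s (F' s)) ->
  continuous (fun s => complex.Re (F' s) : R) ->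
  continuous (fun s => complex.Im (F' s) : R) -> acrep t d F F'.
Proof.
move=> dF c1 c2; split.
  split; first by split; exact: continuous_meas.
  have [M1 h1] := continuous_bounded t d c1; have [M2 h2] := continuous_bounded t d c2.
  exists (M1 + M2) => s ts sd; apply: (le_trans (N_le _)).
  by apply: lerD; [apply: h1|apply: h2] => //; exact: ltW.
move=> x tx xd; apply: complex_ext; rewrite (cReD, cImD) ?ReCI ?ImCI.
  by rewrite (RI_FTC (fun s => (dF s).1) c1 tx) addrC subrK.
by rewrite (RI_FTC (fun s => (dF s).2) c2 tx) addrC subrK.
Qed.

Definition cexp (z : R[i]) : R[i] :=
  (expR (complex.Re z))%:C * (cos (complex.Im z) +i* sin (complex.Im z)).

Lemma cexpD x y : cexp (x + y) = cexp x * cexp y.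
Proof.
by apply: complex_ext; rewrite /cexp !(cReM, cImM, cReD, cImD) /= expRD cosD sinD; ring.
Qed.

Lemma cexp0 : cexp 0 = 1.
Proof. by apply: complex_ext; rewrite /cexp !(cReM, cImM) /= expR0 cos0 sin0; ring. Qed.

Lemma N_cexp z : N (cexp z) = expR (complex.Re z).
Proof.
rewrite /cexp NM NR ger0_norm ?expR_ge0//.
have -> : N (cos (complex.Im z) +i* sin (complex.Im z)) = 1.
  by rewrite /= cos2Dsin2 sqrtr1.
by rewrite mulr1.
Qed.

Lemma cexpNM z : cexp z * cexp (- z) = 1.
Proof. by rewrite -cexpD subrr cexp0. Qed.

Lemma acrep_cst t d (c : R[i]) : acrep t d (fun=> c) (fun=> 0).
Proof.
apply: acrep_smooth.
- by move=> s; split; exact: is_derive_cst.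
- by move=> s; exact: cvg_cst.
- by move=> s; exact: cvg_cst.
Qed.

Lemma is_derive_affine (k y x : R) : is_derive x 1 (fun s => k * (s - y)) k.
Proof.
have h : is_derive x (1 : R) (fun s : R => s - y) (1 - 0) by exact: is_deriveB.
have := is_deriveZ (f := fun s : R => s - y) k h.
by rewrite subr0 /GRing.scale/= mulr1.
Qed.

Lemma affine_continuous (k y : R) : continuous (fun s : R => k * (s - y)).
Proof.
move=> x; apply: differentiable_continuous; apply/derivable1_diffP.
by have [] := is_derive_affine k y x.
Qed.

(** The exponential is split into a real exponential and a rotation, each differentiated
    componentwise, and the product rule for [acrep] joins them. *)
Lemma acrep_cexp t d k y :
  acrep t d (fun s => cexp (k * (s - y)%:C)) (fun s => k * cexp (k * (s - y)%:C)).
Proof.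
pose A (s : R) : R[i] := (expR (complex.Re k * (s - y)))%:C.
pose B (s : R) : R[i] := cos (complex.Im k * (s - y)) +i* sin (complex.Im k * (s - y)).
have ce : continuous (fun s => expR (complex.Re k * (s - y))).
  move=> s; apply: (continuous_comp (f := fun s => complex.Re k * (s - y))).
    exact: affine_continuous.
  exact: continuous_expR.
have cc : continuous (fun s => cos (complex.Im k * (s - y))).
  move=> s; apply: (continuous_comp (f := fun s => complex.Im k * (s - y))).
    exact: affine_continuous.
  exact: continuous_cos.
have cs : continuous (fun s => sin (complex.Im k * (s - y))).
  move=> s; apply: (continuous_comp (f := fun s => complex.Im k * (s - y))).
    exact: affine_continuous.
  exact: continuous_sin.
have cM (r : R) (f : R -> R) : continuous f -> continuous (fun s => r * f s).
  by move=> cf s; apply: cvgM; [exact: cvg_cst|exact: cf].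
have aA : acrep t d A (fun s => (complex.Re k)%:C * A s).
  apply: acrep_smooth.
  - move=> s; split; last first.
      by rewrite /A cImM /= mulr0 mul0r addr0; exact: is_derive_cst.
    rewrite cReM /= mulr0 subr0.
    have h : is_derive s 1 (expR \o (fun s => complex.Re k * (s - y)))
       (expR (complex.Re k * (s - y)) *: complex.Re k).
      by apply: is_derive1_comp; exact: is_derive_affine.
    by rewrite mulrC.
  - have -> : (fun s => complex.Re ((complex.Re k)%:C * A s)) =
       (fun s => complex.Re k * expR (complex.Re k * (s - y))).
      by apply/funext => s; rewrite cReM /= mulr0 subr0.
    exact: cM.
  - have -> : (fun s => complex.Im ((complex.Re k)%:C * A s)) = (fun=> 0).
      by apply/funext => s; rewrite cImM /= mulr0 mul0r addr0.
    by move=> s; exact: cvg_cst.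
have aB : acrep t d B (fun s => (0 +i* complex.Im k) * B s).
  apply: acrep_smooth.
  - move=> s; split.
      rewrite cReM /= mul0r sub0r.
      have h : is_derive s 1 (cos \o (fun s => complex.Im k * (s - y)))
         (- sin (complex.Im k * (s - y)) *: complex.Im k).
        by apply: is_derive1_comp; exact: is_derive_affine.
      by rewrite -mulNr mulrC mulrN -mulNr.
    rewrite cImM /= mul0r add0r.
    have h : is_derive s 1 (sin \o (fun s => complex.Im k * (s - y)))
       (cos (complex.Im k * (s - y)) *: complex.Im k).
      by apply: is_derive1_comp; exact: is_derive_affine.
    by rewrite mulrC.
  - have -> : (fun s => complex.Re ((0 +i* complex.Im k) * B s)) =
       (fun s => (- complex.Im k) * sin (complex.Im k * (s - y))).
      by apply/funext => s; rewrite cReM /= mul0r sub0r mulNr.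
    exact: cM.
  - have -> : (fun s => complex.Im ((0 +i* complex.Im k) * B s)) =
       (fun s => complex.Im k * cos (complex.Im k * (s - y))).
      by apply/funext => s; rewrite cImM /= mul0r add0r.
    exact: cM.
have es s : cexp (k * (s - y)%:C) = A s * B s.
  by rewrite /cexp /A /B cReM cImM /= !mulr0 subr0 add0r.
have kE : k = (complex.Re k)%:C + (0 +i* complex.Im k).
  by apply: complex_ext; rewrite /= ?addr0 ?add0r.
have dE s : (complex.Re k)%:C * A s * B s + A s * ((0 +i* complex.Im k) * B s) =
    k * cexp (k * (s - y)%:C).
  by rewrite es [X in _ = X * _]kE; ring.
have [h1 h2] := acrepM aA aB; split; first by apply: eq_bmeas h1 => s _ _.
move=> x tx xd; rewrite !es h2//; congr (_ + _).
by apply: eq_CI => s _ _.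
Qed.

End smooth.

(** * Comparison with free solutions *)

Section exponentials.
Context (R : realType).
Implicit Types (k p q z : R[i]) (y s t d : R).

Definition ex k y s : R[i] := cexp (k * (s - y)%:C).

Lemma exx k y : ex k y y = 1.
Proof. by rewrite /ex subrr mulr0 cexp0. Qed.

Lemma exV k y s : ex k y s * ex (- k) y s = 1.
Proof. by rewrite /ex mulNr cexpNM. Qed.

Lemma exC k y s : ex k y s = ex (- k) s y.
Proof. by rewrite /ex mulNr -mulrN; congr (cexp (_ * _)); rewrite -rmorphN opprB. Qed.

Lemma N_ex k y s : N (ex k y s) = expR (complex.Re k * (s - y)).
Proof. by rewrite /ex N_cexp cReM /= mulr0 subr0. Qed.

Lemma ex_neq0 k y s : ex k y s != 0.
Proof. by apply/eqP => e; have := N_ex k y s; rewrite e N0 => /esym/eqP; rewrite gt_eqF// expR_gt0. Qed.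

Lemma acrep_ex t d k y : acrep t d (ex k y) (fun s => k * ex k y s).
Proof. exact: acrep_cexp. Qed.

(* The solutions of f'' = k ^+ 2 * f. *)
Definition hyp k p q y s : R[i] := p * ex k y s + q * ex (- k) y s.
Definition dhyp k p q y s : R[i] := k * (p * ex k y s - q * ex (- k) y s).

Lemma acrep_hyp t d k p q y : acrep t d (hyp k p q y) (dhyp k p q y).
Proof.
have h := acrepD (acrepZ p (acrep_ex t d k y)) (acrepZ q (acrep_ex t d (- k) y)).
have e : (fun s => p * (k * ex k y s) + q * (- k * ex (- k) y s)) = dhyp k p q y.
  by apply/funext => s; rewrite /dhyp; ring.
by rewrite -e.
Qed.

Lemma acrep_dhyp t d k p q y : acrep t d (dhyp k p q y) (fun s => k ^+ 2 * hyp k p q y s).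
Proof.
have h := acrepD (acrepZ (k * p) (acrep_ex t d k y)) (acrepZ (- (k * q)) (acrep_ex t d (- k) y)).
have e : (fun s => k * p * (k * ex k y s) + - (k * q) * (- k * ex (- k) y s)) =
   (fun s => k ^+ 2 * hyp k p q y s).
  by apply/funext => s; rewrite /hyp; ring.
have e' : (fun s => k * p * ex k y s + - (k * q) * ex (- k) y s) = dhyp k p q y.
  by apply/funext => s; rewrite /dhyp; ring.
by rewrite -e -e'.
Qed.

Lemma N_hyp k p q y s : 0 <= complex.Re k ->
  N (hyp k p q y s) <= (N p + N q) * expR (complex.Re k * `|s - y|).
Proof.
move=> k0; apply: (le_trans (ND _ _)); rewrite (NM p) (NM q) !N_ex mulrDl.
apply: lerD; rewrite ler_wpM2l ?N_ge0// ler_expR; first by rewrite ler_wpM2l// ler_norm.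
by rewrite cReN mulNr -mulrN ler_wpM2l// -normrN ler_norm.
Qed.

Lemma expR_ge_sqr (r : R) : 0 <= r -> r ^+ 2 / 4 <= expR r.
Proof.
move=> r0; have h : r / 2 <= expR (r / 2).
  by apply: le_trans (expR_ge1Dx _); rewrite lerDr.
have -> : r = r / 2 + r / 2 by rewrite -splitr.
rewrite expRD -splitr; have -> : r ^+ 2 / 4 = (r / 2) * (r / 2) by field.
by apply: ler_pM; rewrite ?divr_ge0.
Qed.

End exponentials.

(** * The Volterra equation and the bound on reflection *)

Section perturbation.
Context (R : realType).
Notation leb := (@lebesgue_measure R).
Notation mR := (measurableTypeR R).
Variables (mu1 mu2 : {finite_measure set mR -> \bar R}).
Variables (a x1 x2 : R) (z k : R[i]) (u du : R -> R[i]).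
Hypotheses (ax1 : a <= x1) (x12 : x1 < x2).
Hypotheses (kz : k ^+ 2 = - z) (k0 : 0 < complex.Re k).
Hypotheses (au : acrep a x2 u du) (bu : bvrep mu1 mu2 a x2 du u (fun s => z * u s)).

Local Notation SI := (SI mu1 mu2).

(** The total variation of [mu1 - mu2] on [[a, x2[] when the two are Jordan parts, and an upper
    bound for it in general. *)
Definition mass : R := fine (mu1 `[a, x2[%classic) + fine (mu2 `[a, x2[%classic).

Lemma fine_mass (mu : {finite_measure set mR -> \bar R}) x y : a <= x -> y <= x2 ->
  0 <= fine (mu `[x, y[%classic) <= fine (mu `[a, x2[%classic).
Proof.
move=> ax yx; apply/andP; split; first exact: fine_ge0.
apply: fine_le.
- by apply: fin_num_measure; exact: measurable_itvco.
- by apply: fin_num_measure; exact: measurable_itvco.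
- apply: le_measure; rewrite ?inE; [exact: measurable_itvco..|].
  exact: subset_itvco.
Qed.

Lemma mass_ge0 : 0 <= mass.
Proof. by rewrite addr_ge0// fine_ge0. Qed.

Lemma N_SI_mass f M x y : a <= x -> y <= x2 -> bmeas x y f -> 0 <= M ->
  (forall s, x <= s -> s < y -> N (f s) <= M) -> N (SI f x y) <= 2 * M * mass.
Proof.
move=> ax yx bf M0 fM; apply: (le_trans (N_SI_cst _ _ bf fM)).
rewrite ler_wpM2l ?mulr_ge0// /mass.
have /andP[_ h1] := fine_mass mu1 ax yx; have /andP[_ h2] := fine_mass mu2 ax yx.
exact: lerD.
Qed.

Lemma k_neq0 : k != 0.
Proof. by apply/eqP => e; move: k0; rewrite e /= ltxx. Qed.

Lemma Nk_gt0 : 0 < N k.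
Proof. exact: N_gt0 k_neq0. Qed.

Lemma green F F' y v : a <= y -> y <= v -> v <= x2 ->
  acrep y v F F' -> acrep y v F' (fun s => k ^+ 2 * F s) ->
  F v * du v - F' v * u v - (F y * du y - F' y * u y) = SI (fun s => F s * u s) y v.
Proof.
move=> ay yv vx aF aF'.
have au' := acrep_sub ay vx au; have bu' := bvrep_sub ay vx bu.
have e1 := integration_by_parts aF bu' yv (lexx v).
have [_ e2] := acrepM aF' au'; have := e2 v yv (lexx v).
have bF := acrep_bmeas aF; have bF' := acrep_bmeas aF'.
have [bdu _] := au'; have bU := acrep_bmeas au'.
rewrite CID; last 2 first.
- by apply: leb_cI; apply: bmeasM => //; exact: bmeasZ.
- by apply: leb_cI; exact: bmeasM.
move=> /(congr1 (fun r => r - F' y * u y)); rewrite [X in _ = X -> _]addrAC subrr add0r => e3.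
have -> : F v * du v - F' v * u v - (F y * du y - F' y * u y) =
  (F v * du v - F y * du y) - (F' v * u v - F' y * u y) by ring.
rewrite e1 e3.
have -> : CI leb (fun s => F s * (z * u s)) y v = - CI leb (fun s => k ^+ 2 * F s * u s) y v.
  rewrite -CIN; first by apply: eq_CI => s _ _; rewrite kz; ring.
  by apply: leb_cI; apply: bmeasM => //; exact: bmeasZ.
ring.
Qed.

Let p := du x1 + k * u x1.
Let q := du x1 - k * u x1.

(* [p] and [q] are the amplitudes of the components of [free] that grow and
   decay to the right of [x1]. *)
Definition free : R -> R[i] := hyp k (p / (2 * k)) (- q / (2 * k)) x1.
Definition dfree : R -> R[i] := dhyp k (p / (2 * k)) (- q / (2 * k)) x1.

Lemma free_x1 : free x1 = u x1.
Proof. by rewrite /free /hyp !exx /p /q; field; exact: k_neq0. Qed.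

Lemma dfree_x1 : dfree x1 = du x1.
Proof. by rewrite /dfree /dhyp !exx /p /q; field; exact: k_neq0. Qed.

(** This is sinh (k (s - y)) / k, the free solution with value 0 and slope 1 at [y]. *)
Let sh y : R -> R[i] := hyp k (1 / (2 * k)) (- 1 / (2 * k)) y.

Lemma N2k : N (1 / (2 * k)) + N (- 1 / (2 * k)) = (N k)^-1.
Proof.
rewrite mulNr NN -mulr2n mul1r NV NM.
have -> : N (2 : R[i]) = 2.
  by rewrite (_ : 2 = (2 : R)%:C) ?NR ?ger0_norm// rmorph_nat.
by rewrite invfM mulr2n; have := Nk_gt0; move=> h; field; rewrite gt_eqF.
Qed.

Let sh_free y :  sh y x1 * du x1 - dhyp k (1 / (2 * k)) (- 1 / (2 * k)) y x1 * u x1 = - free y.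
Proof.
rewrite /sh /hyp /dhyp /free /hyp (exC k y x1) (exC (- k) y x1) opprK /p /q.
by field; exact: k_neq0.
Qed.

Let sh_diag y : sh y y = 0.
Proof. by rewrite /sh /hyp !exx; ring. Qed.

Let dsh_diag y : dhyp k (1 / (2 * k)) (- 1 / (2 * k)) y y = 1.
Proof. by rewrite /dhyp !exx; field; exact: k_neq0. Qed.

Let green_sh s y v (ay : a <= y) (yv : y <= v) (vx : v <= x2) :=
  green ay yv vx (acrep_hyp y v k (1 / (2 * k)) (- 1 / (2 * k)) s)
    (acrep_dhyp y v k (1 / (2 * k)) (- 1 / (2 * k)) s).

(** Variation of constants: [green] with [F = sh s] gives [u s] at the endpoint [s] and [- free s]
    at [x1]. *)
Lemma volterra_right s : x1 <= s -> s <= x2 ->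
  u s = free s - SI (fun r => sh s r * u r) x1 s.
Proof.
move=> xs sx; have := green_sh s ax1 xs sx.
rewrite -[hyp k _ _ s]/(sh s) sh_free sh_diag dsh_diag; move: (SI _ _ _) => I <-.
ring.
Qed.

Lemma volterra_left s : a <= s -> s <= x1 ->
  u s = free s + SI (fun r => sh s r * u r) s x1.
Proof.
move=> as_ sx; have := green_sh s as_ sx (ltW x12).
rewrite -[hyp k _ _ s]/(sh s) sh_free sh_diag dsh_diag; move: (SI _ _ _) => I <-.
ring.
Qed.

Let sigma := complex.Re k.
Let eps := 2 * mass / N k.
Let A := (N p + N q) / (2 * N k).

Lemma N_free s : N (free s) <= A * expR (sigma * `|s - x1|).
Proof.
apply: (le_trans (N_hyp _ _ _ _ (ltW k0))).
rewrite ler_wpM2r ?expR_ge0// !NM NN NV NM -mulrDl.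
have -> : N (2 : R[i]) = 2.
  by rewrite (_ : 2 = (2 : R)%:C) ?NR ?ger0_norm// rmorph_nat.
by [].
Qed.

Let bmeas_shu y x v : a <= x -> v <= x2 -> bmeas x v (fun r => sh y r * u r).
Proof.
move=> ax vx; apply: bmeasM; first exact: (acrep_bmeas (acrep_hyp _ _ _ _ _ _)).
by apply: bmeas_sub (acrep_bmeas au).
Qed.

Let weight s := expR (- (sigma * `|s - x1|)).

(** For [r] between [s] and [x1] the exponents of the kernel and of [u] add up to exactly
    [sigma * |s - x1|], so the weighted bound reproduces itself with a gain of 1 / |k|. *)
Let sh_bound M s r : weight r * N (u r) <= M ->
  `|r - s| + `|r - x1| = `|s - x1| ->
  N (sh s r * u r) <= M / N k * expR (sigma * `|s - x1|).
Proof.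
move=> wM e; rewrite NM.
apply: (@le_trans _ _ ((N k)^-1 * expR (sigma * `|r - s|) * N (u r))).
  rewrite ler_wpM2r ?N_ge0//; apply: (le_trans (N_hyp _ _ _ _ (ltW k0))).
  by rewrite N2k.
have Nu : N (u r) <= M * expR (sigma * `|r - x1|).
  have -> : N (u r) = weight r * N (u r) * expR (sigma * `|r - x1|).
    by rewrite mulrAC /weight -expRD addNr expR0 mul1r.
  by rewrite ler_wpM2r// expR_ge0.
apply: (@le_trans _ _ ((N k)^-1 * expR (sigma * `|r - s|) * (M * expR (sigma * `|r - x1|)))).
  by rewrite ler_wpM2l// mulr_ge0 ?expR_ge0// invr_ge0 N_ge0.
rewrite -e (mulrDr sigma) expRD; apply: le_of_eq.
ring.
Qed.

Let perturb_step M s (x v : R) : x <= v -> a <= x -> v <= x2 -> 0 <= M ->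
  u s = free s - SI (fun r => sh s r * u r) x v \/ u s = free s + SI (fun r => sh s r * u r) x v ->
  (forall r, x <= r -> r < v -> weight r * N (u r) <= M /\ `|r - s| + `|r - x1| = `|s - x1|) ->
  N (u s - free s) <= eps * M * expR (sigma * `|s - x1|).
Proof.
move=> xv ax vx M0 us wM.
have -> : N (u s - free s) = N (SI (fun r => sh s r * u r) x v).
  by case: us => ->; rewrite addrAC subrr add0r// NN.
apply: (le_trans (N_SI_mass (M := M / N k * expR (sigma * `|s - x1|)) ax vx _ _ _)).
- exact: bmeas_shu.
- by rewrite mulr_ge0 ?expR_ge0// divr_ge0// N_ge0.
- by move=> r xr rv; have [h1 h2] := wM r xr rv; exact: sh_bound.
- apply: le_of_eq; rewrite /eps; field.
  by rewrite gt_eqF// Nk_gt0.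
Qed.

Let A_ge0 : 0 <= A.
Proof. by rewrite divr_ge0 ?addr_ge0 ?mulr_ge0 ?N_ge0. Qed.

Let weightK s : weight s * expR (sigma * `|s - x1|) = 1.
Proof. by rewrite /weight -expRD addNr expR0. Qed.

Let bounded_u : exists2 M, 0 < M & forall s, a <= s -> s <= x2 -> weight s * N (u s) <= M.
Proof.
have [M M0 hM] := acrep_bounded au; exists M => // s as_ sx.
rewrite -[leRHS]mul1r; apply: ler_pM; rewrite ?expR_ge0 ?N_ge0 ?hM//.
by rewrite /weight -expR0 ler_expR oppr_le0 mulr_ge0// ltW.
Qed.

Let perturb_M M s : 0 <= M -> a <= s -> s <= x2 ->
  (forall r, a <= r -> r <= x2 -> weight r * N (u r) <= M) ->
  N (u s - free s) <= eps * M * expR (sigma * `|s - x1|).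
Proof.
move=> M0 as_ sx hM; have [xs|/ltW xs] := leP x1 s.
  apply: (perturb_step xs ax1 sx M0 (or_introl (volterra_right xs sx))) => r xr rs.
  split; first by apply: hM; [exact: le_trans xr|exact: ltW (lt_le_trans rs sx)].
  by rewrite ler0_norm ?ger0_norm//; lra.
apply: (perturb_step xs as_ (ltW x12) M0 (or_intror (volterra_left as_ xs))) => r sr rx.
split; first by apply: hM; [exact: le_trans sr|exact: ltW (lt_trans rx x12)].
by rewrite ger0_norm ?ler0_norm//; lra.
Qed.

(** Absorption in the supremum norm with [weight], in which the Volterra term is at most [eps] times
    the norm of [u]. *)
Lemma perturbation s : eps <= 1 / 2 -> a <= s -> s <= x2 ->
  N (u s) <= 2 * A * expR (sigma * `|s - x1|) /\
  N (u s - free s) <= eps * (2 * A) * expR (sigma * `|s - x1|).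
Proof.
move=> e2 as_ sx; have [B B0 hB] := bounded_u.
have key r : a <= r -> r <= x2 -> weight r * N (u r) <= 2 * A.
  move=> ar rx.
  apply: (@bootstrap R (fun s => a <= s <= x2) (fun s => weight s * N (u s)) A B).
  - by move=> x /andP[? ?]; exact: hB.
  - move=> M hM x /andP[ax xx].
    have M0 : 0 <= M by apply: le_trans (hM x _); rewrite ?ax// mulr_ge0 ?expR_ge0 ?N_ge0.
    have h1 := perturb_M M0 ax xx (fun r ar rx => hM r (introT andP (conj ar rx))).
    have h2 := N_free x.
    have h3 : N (u x) <= (A + M / 2) * expR (sigma * `|x - x1|).
      rewrite -[u x](subrK (free x)) addrC mulrDl; apply: (le_trans (ND _ _)).
      apply: lerD => //; apply: (le_trans h1); rewrite ler_wpM2r ?expR_ge0//.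
      by rewrite mulrC ler_wpM2l// -[_^-1]mul1r.
    apply: (@le_trans _ _ (weight x * ((A + M / 2) * expR (sigma * `|x - x1|)))).
      by rewrite ler_wpM2l// expR_ge0.
    by rewrite mulrCA weightK mulr1.
  - by rewrite ar rx.
split; last by apply: perturb_M => //; rewrite mulr_ge0.
have := key s as_ sx; rewrite -(ler_pM2r (expR_gt0 (sigma * `|s - x1|))).
by rewrite mulrAC weightK mul1r.
Qed.

Hypothesis J_ineq : complex.Im z * RI leb (fun s => N (u s) ^+ 2) x1 x2 <= J u du x1.

(* If the growing component [p] of [free] dominated, [u] would be at least of
   order [exp (sigma (s - x1))] on the right half of [x1, x2[, which is too much
   for [J_ineq]. *)
Lemma reflection_bound : 1 <= sigma -> 1 <= complex.Im z -> 10 * mass <= N k ->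
  300 < sigma * (x2 - x1) ^+ 3 -> N p <= 4 * N q.
Proof.
move=> s1 z1 mk sD; rewrite leNgt; apply/negP => pq.
have Nk0 := Nk_gt0.
have e5 : eps <= 1 / 5 by rewrite /eps ler_pdivrMr//; lra.
have e2 : eps <= 1 / 2 by lra.
have p0 : 0 < N p by apply: le_lt_trans pq; rewrite mulr_ge0// N_ge0.
set Delta := x2 - x1 in sD.
have D0 : 0 < Delta by rewrite subr_gt0.
(* In terms of [X] and [Y] below, the free part is at least (X - Y) / 2 and the perturbation at most
   (X + Y) / 5. With Y < X / 4 the difference exceeds 3 X / 10 - 7 X / 40 = X / 8. *)
pose P8 := N p / (8 * N k).
have P80 : 0 < P8 by rewrite divr_gt0// mulr_gt0.
pose X := N p / N k; pose Y := N q / N k.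
have X0 : 0 < X by rewrite divr_gt0.
have Y0 : 0 <= Y by rewrite divr_ge0// N_ge0.
have XY : 4 * Y < X by rewrite /X /Y mulrA ltr_pM2r ?invr_gt0.
have E1 : (N p - N q) / (2 * N k) = (X - Y) / 2.
  by rewrite /X /Y; field; rewrite gt_eqF.
have E2 : 2 * A = X + Y by rewrite /A /X /Y; field; rewrite gt_eqF.
have E3 : P8 = X / 8 by rewrite /P8 /X; field; rewrite gt_eqF.
have N2 : N (2 : R[i]) = 2.
  by rewrite (_ : 2 = (2 : R)%:C) ?NR ?ger0_norm// rmorph_nat.
have lower s : x1 <= s -> s <= x2 -> P8 * expR (sigma * (s - x1)) <= N (u s).
  move=> xs sx.
  have [_] := perturbation e2 (le_trans ax1 xs) sx.
  rewrite [`|s - x1|]ger0_norm ?subr_ge0// => h1.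
  have h2 : (N p - N q) / (2 * N k) * expR (sigma * (s - x1)) <= N (free s).
    rewrite /free /hyp mulNr mulNr; apply: le_trans (N_geB _ _).
    rewrite (NM (p / _)) (NM (q / _)) !N_ex (NM p) (NM q) NV NM N2 mulrBl mulrBl lerD2l lerN2.
    rewrite ler_wpM2l ?divr_ge0 ?mulr_ge0 ?N_ge0// ler_expR cReN mulNr.
    have : 0 <= sigma * (s - x1) by rewrite mulr_ge0 ?subr_ge0// ltW.
    by rewrite /sigma; lra.
  have h3 := N_geB (free s) (u s); rewrite NBC in h3.
  have h4 : (N p - N q) / (2 * N k) * expR (sigma * (s - x1)) -
      eps * (2 * A) * expR (sigma * (s - x1)) <= N (u s) by lra.
  apply: le_trans h4; rewrite -mulrBl ler_wpM2r ?expR_ge0//.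
  rewrite E1 E2 E3.
  have h5 : eps * (X + Y) <= 1 / 5 * (X + Y).
    by rewrite ler_wpM2r// addr_ge0// ltW.
  lra.
(* On the right half the exponential is at least exp (sigma Delta / 2), and squaring restores exp
   (sigma Delta). *)
pose xm := (x1 + x2) / 2.
have [x1m xm2] : x1 <= xm /\ xm <= x2 by have [] := midf_le (ltW x12).
pose c0 := P8 * expR (sigma * Delta / 2).
have c00 : 0 <= c0 by rewrite mulr_ge0 ?expR_ge0// ltW.
have bu' := bmeas_sub ax1 (lexx x2) (acrep_bmeas au).
have iu : leb.-integrable `[x1, x2[ (EFin \o (fun s => N (u s) ^+ 2)).
  have [i1 _] := leb_cI (bmeasM bu' (bmeasJ bu')).
  by apply: eq_integrable_itvco i1 => s _ _; rewrite mulcJ.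
have lowRI : c0 ^+ 2 * (Delta / 2) <= RI leb (fun s => N (u s) ^+ 2) x1 x2.
  rewrite (RI_add x1m xm2 iu).
  apply: (@le_trans _ _ (RI leb (fun s => N (u s) ^+ 2) xm x2)); last first.
    by rewrite lerDr; apply: RI_ge0 => s _ _; exact: sqr_ge0.
  have -> : c0 ^+ 2 * (Delta / 2) = RI leb (fun=> c0 ^+ 2) xm x2.
    by rewrite RI_cst fine_leb_itvco//; congr (_ * _); rewrite /Delta /xm; lra.
  apply: le_RI.
  - exact: cst_integrable (@leb_lf R) _ _ _.
  - by apply: integrable_itvcoS iu.
  move=> s ms sx; have xs := le_trans x1m ms.
  rewrite ler_pXn2r ?nnegrE ?N_ge0//; apply: le_trans (lower s xs (ltW sx)).
  rewrite ler_wpM2l ?(ltW P80)// ler_expR -mulrA ler_wpM2l//; first by lra.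
  by move: ms; rewrite /xm /Delta; lra.
have upJ : J u du x1 <= 25 / 64 * (N p * X).
  apply: (le_trans (ler_norm _)); apply: (le_trans (N_Im _)); rewrite NM NJ.
  have e1 : N (du x1) <= 5 / 8 * N p.
    have -> : du x1 = 2^-1 * (p + q) by rewrite /p /q; field.
    rewrite NM NV N2; have := ND p q; lra.
  have eu2 : N (u x1) <= 5 / 8 * X.
    have -> : u x1 = 2^-1 * k^-1 * (p - q).
      by rewrite /p /q; field; exact: k_neq0.
    rewrite !NM !NV N2 (_ : 5 / 8 * X = 2^-1 * (N k)^-1 * (5 / 4 * N p)); last first.
      by rewrite /X; field; rewrite gt_eqF.
    rewrite ler_wpM2l ?mulr_ge0 ?invr_ge0 ?N_ge0//; have := NB p q; lra.
  have -> : 25 / 64 * (N p * X) = (5 / 8 * N p) * (5 / 8 * X) by field.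
  by apply: ler_pM; rewrite ?N_ge0.
have z0 : 0 <= complex.Im z by lra.
have h1 : complex.Im z * (c0 ^+ 2 * (Delta / 2)) <= 25 / 64 * (N p * X).
  by apply: le_trans upJ; apply: le_trans J_ineq; rewrite ler_wpM2l.
have h2 : complex.Im z * (expR (sigma * Delta) * Delta) <= 50 * N k.
  have X2 : 0 < X ^+ 2 / 128 by rewrite divr_gt0// exprn_gt0.
  rewrite -(ler_pM2l X2).
  have -> : X ^+ 2 / 128 * (50 * N k) = 25 / 64 * (N p * X).
    by rewrite /X; field; rewrite gt_eqF.
  have eE : expR (sigma * Delta) = expR (sigma * Delta / 2) ^+ 2.
    by rewrite expr2 -expRD -splitr.
  apply: le_trans h1; rewrite /c0 E3 eE.
  by apply: le_of_eq; field.
have sD0 : 0 <= sigma * Delta by rewrite mulr_ge0 ?ltW//; lra.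
(* By exp r >= r^2 / 4 with r = sigma Delta, the left side of [h2] is at least Im z sigma^2 Delta^3
   / 4, and 300 / 4 = 75. *)
have h3 : complex.Im z * (75 * sigma) < 50 * N k.
  apply: lt_le_trans h2; rewrite ltr_pM2l; last by lra.
  apply: (@lt_le_trans _ _ ((sigma * Delta) ^+ 2 / 4 * Delta)); last first.
    by rewrite ler_wpM2r ?(ltW D0)// expR_ge_sqr.
  have -> : (sigma * Delta) ^+ 2 / 4 * Delta = (sigma * Delta ^+ 3) * (sigma / 4) by field.
  rewrite (_ : 75 * sigma = 300 * (sigma / 4)); last by field.
  by rewrite ltr_pM2r// divr_gt0//; lra.
(* From z = - k^2 one has Im z = 2 sigma T. As sigma and Im z are at least 1, both sigma and 2 T are
   at most sigma Im z, so 50 |k| <= 50 (sigma + T) <= 75 sigma Im z, against [h3]. *)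
pose T := - complex.Im k.
have zT : complex.Im z = 2 * (sigma * T).
  have /(congr1 (@complex.Im R)) := kz; rewrite expr2 cImM cImN => /(congr1 -%R).
  by rewrite opprK => <-; rewrite /T /sigma; ring.
have T0 : 0 < T.
  have : 0 < sigma * T by lra.
  by rewrite pmulr_rgt0//; lra.
have kT : N k <= sigma + T.
  apply: (le_trans (N_le k)); rewrite -/sigma ger0_norm; last by lra.
  by rewrite lerD2l /T -normrN ger0_norm//; exact: ltW.
have a1 : sigma <= complex.Im z * sigma by rewrite ler_peMl//; lra.
have a2 : 2 * T <= complex.Im z * sigma.
  rewrite zT (_ : 2 * (sigma * T) * sigma = 2 * T * (sigma * sigma)); last by ring.
  by rewrite ler_peMr ?mulr_ge0 ?(ltW T0)// mulr_ege1.
move: h3; rewrite mulrCA; lra.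
Qed.

End perturbation.

(** * Quotient rule and exponentially weighted tails *)

Section inverses.
Context (R : realType).
Notation leb := (@lebesgue_measure R).

(** Increments of second order add up to arbitrarily little over fine partitions. The criterion
    needs no derivative of [H]. *)
Lemma quadratic_cst (H : R -> R[i]) K t d : t <= d ->
  (forall x y, t <= x -> x <= y -> y <= d -> N (H y - H x) <= K * (y - x) ^+ 2) -> H d = H t.
Proof.
move=> td hH; apply/eqP; rewrite -subr_eq0; apply/eqP/N_eq0/eqP.
rewrite eq_le N_ge0 andbT; apply/ler_addgt0Pr => e e0; rewrite add0r.
pose e' := e / (d - t + 1).
have dt1 : 0 < d - t + 1 by rewrite ltr_wpDl// subr_ge0.
have e'0 : 0 < e' by rewrite divr_gt0.
suff : N (H d - H t) <= e' * (d - t).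
  move=> h; apply: (le_trans h); rewrite /e' mulrAC ler_pdivrMr// ler_wpM2l ?ltW//.
  by rewrite ltrDl.
apply: (@real_induction R t d (fun s => N (H s - H t) <= e' * (s - t)) td).
  by rewrite !subrr N0 mulr0.
move=> s std; exists (e' / (2 * (`|K| + 1))).
  by rewrite divr_gt0// mulr_gt0// ltr_wpDl.
move=> y w ty ys sw wd h1 h2 hy.
have yw : y <= w by exact: le_trans sw.
have -> : H w - H t = (H w - H y) + (H y - H t) by rewrite addrA subrK.
apply: (le_trans (ND _ _)).
have -> : e' * (w - t) = e' * (w - y) + e' * (y - t) by ring.
apply: lerD => //; apply: (le_trans (hH y w ty yw wd)).
rewrite expr2 mulrA ler_wpM2r ?subr_ge0//.
have K1 : 0 < `|K| + 1 by rewrite ltr_wpDl.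
apply: (@le_trans _ _ ((`|K| + 1) * (w - y))).
  by rewrite ler_wpM2r ?subr_ge0//; apply: (le_trans (ler_norm _)); rewrite lerDl.
rewrite mulrC -ler_pdivlMr//.
have e2 : e' / (`|K| + 1) = e' / (2 * (`|K| + 1)) + e' / (2 * (`|K| + 1)).
  by field; rewrite gt_eqF.
rewrite e2; move: (e' / _) h1 h2 => r h1 h2; flra.
Qed.

Lemma bmeasV x y (F : R -> R[i]) c : 0 < c -> (forall s, x <= s -> s < y -> c <= N (F s)) ->
  bmeas x y F -> bmeas x y (fun s => (F s)^-1).
Proof.
move=> c0 cF [mF _]; split; last first.
  by exists c^-1 => s xs sy; rewrite NV lef_pV2 ?posrE// ?cF//; exact: lt_le_trans (cF s xs sy).
(* Truncating at [c ^+ 2] makes the reciprocal continuous on the whole line without changing it on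
   the values of [N (F s) ^+ 2]. *)
have mi : meas x y (fun s => (Num.max (c ^+ 2) (N (F s) ^+ 2))^-1).
  have cV : continuous (fun r : R => (Num.max (c ^+ 2) r)^-1).
    move=> r; apply: cvgV; first by rewrite gt_eqF// lt_max exprn_gt0.
    exact: (continuous_max (f := fun=> c ^+ 2) (g := fun r => r) (cvg_cst _) cvg_id).
  exact: (measurableT_comp (continuous_measurable_fun cV) (meas_sqN mF)).
have e s : x <= s -> s < y -> (F s)^-1 = ((Num.max (c ^+ 2) (N (F s) ^+ 2))^-1)%:C * conjc (F s).
  move=> xs sy; have h := cF s xs sy.
  have F0 : F s != 0 by apply/eqP => F0; move: h; rewrite F0 N0 leNgt c0.
  rewrite max_r; last by rewrite ler_pXn2r// nnegrE ?N_ge0// ltW.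
  rewrite rmorphV /=; last first.
    by rewrite unitfE expf_neq0// gt_eqF// N_gt0.
  rewrite -mulcJ invfM mulrAC -mulrA mulfV ?mulr1//.
  by rewrite conjc_eq0.
apply: (@eq_cmeas _ _ _ (fun s => ((Num.max (c ^+ 2) (N (F s) ^+ 2))^-1)%:C * conjc (F s))).
  by move=> s xs sy; rewrite [RHS]e.
apply: cmeasM; last exact: cmeasJ.
by split => //; exact: measurable_cst.
Qed.

Lemma acrepV t d (F F' : R -> R[i]) c : 0 < c ->
  (forall s, t <= s -> s <= d -> c <= N (F s)) -> acrep t d F F' ->
  acrep t d (fun s => (F s)^-1) (fun s => - F' s / F s ^+ 2).
Proof.
move=> c0 cF aF; have [bF' _] := aF; have bF := acrep_bmeas aF.
have bV : bmeas t d (fun s => (F s)^-1).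
  by apply: (bmeasV c0 _ bF) => s ts sd; apply: cF => //; exact: ltW.
have bG : bmeas t d (fun s => - F' s / F s ^+ 2).
  apply: (@eq_bmeas _ _ _ (fun s => (- F' s) * ((F s)^-1 * (F s)^-1))).
    by move=> s _ _; rewrite -invfM -expr2.
  by apply: bmeasM; [exact: bmeasN|exact: bmeasM].
split => // x tx xd.
have [L L0 hL] := acrep_lip aF; have [B B0 hB] := acrep_bounded aF.
have [_ [M hM]] := bF'.
pose H y := (F y)^-1 - CI leb (fun s => - F' s / F s ^+ 2) t y.
suff /(congr1 (fun r => r + CI leb (fun s => - F' s / F s ^+ 2) t x)) : H x = H t.
  by rewrite /H subrK CI0 subr0.
apply: (@quadratic_cst H (2 * (`|M| * (2 * B * L / c ^+ 4)))) => // y v ty yv vx.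
have vd := le_trans vx xd; have tv := le_trans ty yv; have yd := le_trans yv vd.
have F0 s : t <= s -> s <= d -> F s != 0.
  by move=> ts sd; apply/eqP => e; move: (cF s ts sd); rewrite e N0 leNgt c0.
have iG := leb_cI (bmeas_sub ty vd bG).
have iF := leb_cI (bmeas_sub ty vd bF').
have -> : H v - H y = CI leb (fun s => F' s * ((F s ^+ 2)^-1 - (F y * F v)^-1)) y v.
  transitivity (CI leb (fun s => - (F y * F v)^-1 * F' s - (- F' s / F s ^+ 2)) y v); last first.
    by apply: eq_CI => s _ _; ring.
  rewrite CIB//; last exact: cIZ.
  rewrite CIZ// /H (CI_add ty yv); last by apply: leb_cI; apply: bmeas_sub bG.
  have := acrepE aF ty yv vd => e.
  have -> : CI leb F' y v = F v - F y by rewrite e addrC addKr.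
  by field; rewrite !F0.
apply: (le_trans (N_CI_cst (@leb_lf R) (M := `|M| * (2 * B * L / c ^+ 4 * (v - y))) _ _)).
- have bs := bmeas_sub ty vd (bmeasM bV bV).
  have := bmeasM (bmeas_sub ty vd bF') (bmeasB bs (bmeas_cst y v (F y * F v)^-1)).
  by move=> [+ _]; apply: eq_cmeas => s _ _; rewrite -invfM -expr2.
- move=> s ys sv; rewrite NM; apply: ler_pM; rewrite ?N_ge0//.
    by apply: le_trans (ler_norm _); apply: hM; [exact: le_trans ys|exact: lt_le_trans vd].
  have ts := le_trans ty ys; have sd := le_trans (ltW sv) vd.
  have -> : (F s ^+ 2)^-1 - (F y * F v)^-1 =
     (F y * (F v - F s) + F s * (F y - F s)) / (F s ^+ 2 * (F y * F v)).
    by field; rewrite !F0.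
  have -> : 2 * B * L / c ^+ 4 * (v - y) = (2 * B * L * (v - y)) * (c ^+ 4)^-1 by ring.
  rewrite NM NV !expr2 !NM; apply: ler_pM; rewrite ?N_ge0 ?invr_ge0 ?mulr_ge0 ?N_ge0//.
    apply: (le_trans (ND _ _)); rewrite !NM.
    have h1 : N (F v - F s) <= L * (v - y).
      apply: (le_trans (hL s v ts (ltW sv) vd)); rewrite ler_wpM2l//; flra.
    have h2 : N (F y - F s) <= L * (v - y).
      rewrite NBC; apply: (le_trans (hL y s ty ys sd)); rewrite ler_wpM2l//; flra.
    have -> : 2 * B * L * (v - y) = B * (L * (v - y)) + B * (L * (v - y)) by ring.
    by apply: lerD; apply: ler_pM; rewrite ?N_ge0 ?hB.
  have k1 := cF s ts sd; have k2 := cF y ty yd; have k3 := cF v tv vd.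
  have c0' := ltW c0.
  have -> : c ^+ 4 = c * c * (c * c) by ring.
  rewrite lef_pV2 ?posrE ?mulr_gt0//.
  - by apply: ler_pM; rewrite ?mulr_ge0//; apply: ler_pM.
  - exact: lt_le_trans k1.
  - exact: lt_le_trans k1.
  - exact: lt_le_trans k2.
  - exact: lt_le_trans k3.
- rewrite fine_leb_itvco//; apply: le_of_eq; ring.
Qed.

End inverses.

Section exponential_tails.
Context (R : realType).
Notation leb := (@lebesgue_measure R).
Notation mR := (measurableTypeR R).

Lemma is_derive_expR_scale (c y : R) : c != 0 ->
  is_derive y (1 : R) (fun s => expR (c * s) / c) (expR (c * y)).
Proof.
move=> c0; have h := is_derive_affine c 0 y.
have h1 : is_derive y (1 : R) (expR \o (fun s => c * (s - 0))) (expR (c * (y - 0)) *: c).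
  exact: is_derive1_comp.
have h2 := is_deriveZ (f := expR \o (fun s => c * (s - 0))) c^-1 h1.
have -> : (fun s => expR (c * s) / c) = c^-1 *: (expR \o (fun s => c * (s - 0))).
  by apply/funext => s; rewrite /GRing.scale/= subr0 mulrC.
have -> : expR (c * y) = c^-1 *: (expR (c * (y - 0)) *: c).
  by rewrite /GRing.scale/= subr0 mulrCA mulVf// mulr1.
exact: h2.
Qed.

(** By Fubini each point [s] receives the integral of exp (c (t - s)) over t in [a, s], which is at
    most 1 / c. Pointwise the tail is bounded by the mass only. *)
Lemma exponential_tail (mu : {finite_measure set mR -> \bar R}) (c a x : R) :
  0 < c -> a <= x ->
  let h t := RI mu (fun s => expR (c * (t - s))) t x in
  [/\ leb.-integrable `[a, x[ (EFin \o h),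
      RI leb h a x <= fine (mu `[a, x[%classic) / c &
      forall t, a <= t -> t <= x -> 0 <= h t <= fine (mu `[a, x[%classic)].
Proof.
move=> c0 ax h.
pose f t := expR (c * t); pose k s := expR (- c * s).
have cexpc (r : R) : continuous (fun s => expR (r * s)).
  move=> s; apply: (continuous_comp (f := fun s => r * s)); last exact: continuous_expR.
  by apply: cvgM; [exact: cvg_cst|exact: cvg_id].
have cint (m : {measure set mR -> \bar R}) r x0 y0 :
    (forall x y, (m `[x, y[%classic < +oo)%E) ->
    m.-integrable `[x0, y0[ (EFin \o (fun s => expR (r * s))).
  move=> lf; have [M hM] := continuous_bounded x0 y0 (cexpc r).
  apply: (meas_bounded_integrable lf (M := M)); first exact: continuous_meas.
  by move=> s s1 s2; apply: hM => //; exact: ltW.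
have fi y : leb.-integrable `[y, x[ (EFin \o f) by exact: cint (@leb_lf R).
have ki y y' : mu.-integrable `[y, y'[ (EFin \o k) by exact: cint (@finite_lf _ mu).
(* [RI_fubini] handles inner integrals that start at a fixed point, so the tail from [t] is written
   as [K x - K t]. *)
pose K t := RI mu k a t.
have hE t : a <= t -> t <= x -> h t = f t * (K x - K t).
  move=> at_ tx; rewrite /K (RI_add at_ tx (ki _ _)) addrC addKr -RIZ//.
  by apply: eq_RI => s _ _; rewrite /f /k -expRD; congr expR; ring.
have [fKi fKe] := RI_fubini (fi a) (ki a x).
have Ff y : a <= y -> y <= x -> RI leb f a y = expR (c * y) / c - expR (c * a) / c.
  move=> ay yx; apply: (RI_FTC (f := fun s => expR (c * s) / c)) => //.
    by move=> s; apply: is_derive_expR_scale; rewrite gt_eqF.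
  exact: cexpc.
have hi : leb.-integrable `[a, x[ (EFin \o h).
  apply: eq_integrable_itvco (integrableB_itvco (integrableZ_itvco (K x) (fi a)) fKi) => s as_ sx.
  by rewrite (hE s as_ (ltW sx)) /K; ring.
have hb t : a <= t -> t <= x -> 0 <= h t <= fine (mu `[a, x[%classic).
  move=> at_ tx; apply/andP; split; first by apply: RI_ge0 => s _ _; exact: expR_ge0.
  apply: (@le_trans _ _ (RI mu (fun=> 1) t x)).
    apply: le_RI.
    - apply: eq_integrable_itvco (integrableZ_itvco (f t) (ki t x)) => s _ _.
      by rewrite /f /k -expRD; congr expR; ring.
    - exact: cst_integrable (@finite_lf _ mu) _ _ _.
    - move=> s ts sx; rewrite -expR0 ler_expR.
      by rewrite mulr_ge0_le0 ?subr_le0// ltW.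
  rewrite RI_cst mul1r; have /andP[_] := fine_mass mu (a := a) (x2 := x) at_ (lexx x).
  by [].
split => //.
have -> : RI leb h a x = K x * RI leb f a x - RI leb (fun s => f s * RI mu k a s) a x.
  rewrite -RIZ// -RIB//; last exact: integrableZ_itvco.
  by apply: eq_RI => s as_ sx; rewrite (hE s as_ (ltW sx)) /K; ring.
rewrite fKe.
have rest y : a <= y -> y < x -> RI leb f y x = RI leb f a x - RI leb f a y.
  by move=> ay yx; rewrite (RI_add ay (ltW yx) (fi a)) addrC addKr.
have kf y : k y * expR (c * y) = 1 by rewrite /k -expRD mulNr addNr expR0.
pose I := RI leb f a x.
have i1 := integrableZ_itvco I (ki a x).
have i2 := integrableZ_itvco (expR (c * a) / c) (ki a x).
have i3 := cst_integrable (@finite_lf _ mu) a x c^-1.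
rewrite (eq_RI mu (g := fun y => I * k y - c^-1 + expR (c * a) / c * k y)); last first.
  move=> y ay yx; rewrite (rest y ay yx) -/I (Ff y ay (ltW yx)).
  have kc : c^-1 = k y * expR (c * y) / c by rewrite kf mul1r.
  by rewrite [X in _ = _ - X + _]kc; ring.
rewrite RID//; last exact: integrableB_itvco.
rewrite RIB// !RIZ// RI_cst -/(K x).
have K0 : 0 <= expR (c * a) / c * K x.
  apply: mulr_ge0; first by rewrite divr_ge0 ?expR_ge0// ltW.
  by apply: RI_ge0 => s _ _; exact: expR_ge0.
rewrite -subr_ge0; apply: le_trans K0 _; apply: le_of_eq.
rewrite -/I; ring.
Qed.

End exponential_tails.

(** * The logarithmic derivative of the Weyl solution against a test function *)

Section core.
Context (R : realType).
Notation leb := (@lebesgue_measure R).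
Notation mR := (measurableTypeR R).
Variables (mu1 mu2 : {finite_measure set mR -> \bar R}).
Variables (a beta x1 x2 : R) (z k : R[i]) (u du : R -> R[i]).
Hypotheses (abeta : a <= beta) (bx1 : beta < x1) (x12 : x1 < x2).
Hypotheses (kz : k ^+ 2 = - z) (k0 : 0 < complex.Re k).
Hypotheses (au : acrep a x2 u du) (bu : bvrep mu1 mu2 a x2 du u (fun s => z * u s)).
Hypothesis u0 : u x1 != 0.

Let p := du x1 + k * u x1.
Let q := du x1 - k * u x1.
Let sigma := complex.Re k.
Let m := mass mu1 mu2 a x2.
Hypothesis pq : N p <= 4 * N q.
Hypothesis mk : 80 * m <= N k.
(** Bound for |r0| to the left of [beta]: the 4 comes from [pq], the exponential from the gap
    between [beta] and [x1]. *)
Let theta := 4 * expR (- (2 * sigma * (x1 - beta))).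
Hypothesis theta2 : theta <= 1 / 2.

Local Notation SI := (SI mu1 mu2).
Local Notation fr := (free x1 k u du).
Local Notation dfr := (dfree x1 k u du).

Let kn0 : k != 0. Proof. exact: k_neq0 k0. Qed.
Let Nk0 : 0 < N k. Proof. exact: Nk_gt0 k0. Qed.
Let ax1 : a <= x1. Proof. exact: ltW (le_lt_trans abeta bx1). Qed.
Let bx2 : beta <= x2. Proof. exact: ltW (lt_trans bx1 x12). Qed.

Let q0 : q != 0.
Proof.
apply/negP => /eqP e.
have p0 : p = 0.
  by apply: N_eq0; apply/eqP; rewrite eq_le N_ge0 andbT; move: pq; rewrite e N0 mulr0.
have : u x1 = (p - q) / (2 * k) by rewrite /p /q; field.
by rewrite e p0 subrr mul0r => h; move: u0; rewrite h eqxx.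
Qed.

Let Nq0 : 0 < N q. Proof. exact: N_gt0. Qed.

Let Nn (n : nat) : N (n%:R : R[i]) = n%:R.
Proof.
have -> : (n%:R : R[i]) = (n%:R : R)%:C by rewrite rmorph_nat.
by rewrite NR ger0_norm.
Qed.

Let r0 t := p / q * ex (2 * k) x1 t.

Let ex2 y s : ex (2 * k) y s * ex (- k) y s = ex k y s.
Proof. by rewrite /ex -cexpD; congr cexp; ring. Qed.

Let freeE t : fr t = - (q / (2 * k)) * ex (- k) x1 t * (1 - r0 t).
Proof. by rewrite /free /hyp -(ex2 x1 t) /r0 -/p -/q; field; rewrite kn0 q0. Qed.

Let dfreeE t : dfr t = q / 2 * ex (- k) x1 t * (1 + r0 t).
Proof. by rewrite /dfree /dhyp -(ex2 x1 t) /r0 -/p -/q; field; rewrite kn0 q0. Qed.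

Let N_r0 t : t <= beta -> N (r0 t) <= theta.
Proof.
move=> tb; rewrite /r0 (NM (p / q)) N_ex (NM p) NV /theta; apply: ler_pM.
- by rewrite mulr_ge0 ?invr_ge0 ?N_ge0.
- exact: expR_ge0.
- by rewrite ler_pdivrMr.
have -> : complex.Re (2 * k) = 2 * sigma.
  by rewrite /sigma [2 * k]mulr_natl [2 * complex.Re k]mulr_natl !mulr2n cReD.
by rewrite ler_expR -mulrN ler_pM2l ?mulr_gt0// opprB lerD2r.
Qed.

Let theta0 : 0 <= theta. Proof. by rewrite mulr_ge0 ?expR_ge0. Qed.

Let N_1r0 t : t <= beta -> 1 / 2 <= N (1 - r0 t) /\ N (1 - r0 t) <= 3 / 2.
Proof.
move=> tb; have h := le_trans (N_r0 tb) theta2.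
have h1 := N_geB 1 (r0 t); have h2 := NB 1 (r0 t).
move: h h1 h2; rewrite N1; move: (N (r0 t)) (N (1 - r0 t)) => r s *; split; lra.
Qed.

Let e t := expR (sigma * (x1 - t)).

Let eps40 : 2 * m / N k <= 1 / 40.
Proof. by rewrite ler_pdivrMr//; move: mk; lra. Qed.

Let eps2 : 2 * m / N k <= 1 / 2.
Proof. by move: eps40; lra. Qed.

(** [X * e t / 2] is the modulus of the component of [free] that decays to the right; up to
    constants it is the size of [free] and of [u] on [[a, beta]]. *)
Let X := N q / N k.
Let X0 : 0 < X. Proof. exact: divr_gt0. Qed.

Let AX : 2 * ((N p + N q) / (2 * N k)) <= 5 * X.
Proof.
have -> : 2 * ((N p + N q) / (2 * N k)) = (N p + N q) / N k by field; rewrite gt_eqF.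
by rewrite /X mulrA ler_pM2r ?invr_gt0//; move: pq; lra.
Qed.

Let m0 : 0 <= m. Proof. exact: mass_ge0. Qed.

Let absx t : t <= x1 -> `|t - x1| = x1 - t.
Proof. by move=> tx; rewrite ler0_norm ?opprB// subr_le0. Qed.

Let u_up s : a <= s -> s <= x1 -> N (u s) <= 5 * X * e s.
Proof.
move=> as_ sx.
have [h _] := perturbation ax1 x12 kz k0 au bu eps2 as_ (le_trans sx (ltW x12)).
move: h; rewrite -/p -/q absx// => h; apply: (le_trans h).
by rewrite ler_wpM2r ?expR_ge0.
Qed.

Let fr_up s : s <= x1 -> N (fr s) <= 5 / 2 * X * e s.
Proof.
move=> sx; have h := N_free x1 u du k0 s; move: h; rewrite -/p -/q absx// => h.
apply: (le_trans h); rewrite ler_wpM2r ?expR_ge0//; move: AX; lra.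
Qed.

Let fr_lo t : t <= beta -> 1 / 4 * X * e t <= N (fr t).
Proof.
move=> tb; rewrite freeE (NM (_ * _)) (NM (- _)) N_ex NN (NM q) NV (NM 2) (Nn 2) cReN.
have -> : - complex.Re k * (t - x1) = sigma * (x1 - t) by rewrite /sigma; ring.
have [h _] := N_1r0 tb.
have -> : 1 / 4 * X * e t = N q / (2 * N k) * expR (sigma * (x1 - t)) * (1 / 2).
  by rewrite /X /e; field; rewrite gt_eqF.
by rewrite ler_wpM2l// mulr_ge0 ?expR_ge0// divr_ge0 ?mulr_ge0 ?N_ge0.
Qed.

(** The perturbation is at most 1 / 40 times 5 X e(t), which leaves half of the lower bound X e(t) /
    4 of [free]; this is where the 80 in [mk] comes from. *)
Let u_lo t : a <= t -> t <= beta -> 1 / 8 * X * e t <= N (u t).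
Proof.
move=> at_ tb; have tx : t <= x1 by exact: le_trans (ltW bx1).
have [_ h] := perturbation ax1 x12 kz k0 au bu eps2 at_ (le_trans tx (ltW x12)).
move: h; rewrite -/p -/q absx// NBC -/m -/sigma -/(e t) => h.
have h1 := fr_lo tb; have h2 := N_geB (fr t) (u t).
have e0 : 0 <= e t by exact: expR_ge0.
have h3 : 2 * m / N k * (2 * ((N p + N q) / (2 * N k))) * e t <= 1 / 40 * (5 * X) * e t.
  rewrite ler_wpM2r//; apply: ler_pM => //.
  - by rewrite divr_ge0 ?mulr_ge0// N_ge0.
  - by rewrite mulr_ge0// divr_ge0 ?addr_ge0 ?mulr_ge0 ?N_ge0.
have -> : 1 / 8 * X * e t = 1 / 4 * X * e t - 1 / 40 * (5 * X) * e t by field.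
by move: (le_trans h h3) h1 h2; move: (1 / 40 * _ * _) (1 / 4 * _ * _) => r s; lra.
Qed.

Let e_ge1 t : t <= x1 -> 1 <= e t.
Proof.
move=> tx; rewrite -expR0 ler_expR mulr_ge0 ?subr_ge0//; exact: ltW.
Qed.

Let u_lo' t : a <= t -> t <= beta -> 1 / 8 * X <= N (u t).
Proof.
move=> at_ tb; apply: le_trans (u_lo at_ tb).
by apply: ler_peMr; [rewrite mulr_ge0 ?(ltW X0)|exact: e_ge1 (le_trans tb (ltW bx1))].
Qed.

Let un0 t : a <= t -> t <= beta -> u t != 0.
Proof.
move=> at_ tb; apply/eqP => h; have := u_lo' at_ tb; rewrite h N0 leNgt mulr_gt0//.
Qed.

Let rn0 t : t <= beta -> 1 - r0 t != 0.
Proof.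
move=> tb; apply/eqP => h; have [] := N_1r0 tb; rewrite h N0; lra.
Qed.

Let frn0 t : t <= beta -> fr t != 0.
Proof.
move=> tb; apply/eqP => frt; have := fr_lo tb; rewrite frt N0 leNgt => /negP; apply.
by apply: mulr_gt0; [apply: mulr_gt0; rewrite ?divr_gt0|exact: expR_gt0].
Qed.

Let W t := fr t * du t - dfr t * u t.

Let W_SI y t : a <= y -> y <= t -> t <= x1 -> W t = W y + SI (fun s => fr s * u s) y t.
Proof.
move=> ay yt tx; have tx2 := le_trans tx (ltW x12).
have h : W t - W y = SI (fun s => fr s * u s) y t.
  exact: (green kz au bu ay yt tx2 (acrep_hyp y t k (p / (2 * k)) (- q / (2 * k)) x1)
    (acrep_dhyp y t k (p / (2 * k)) (- q / (2 * k)) x1)).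
by rewrite -h addrC subrK.
Qed.

Let W_x1 : W x1 = 0.
Proof. by rewrite /W free_x1// dfree_x1//; ring. Qed.

Let bmeas_fru : bmeas a x1 (fun s => fr s * u s).
Proof.
apply: bmeasM; first exact: (acrep_bmeas (acrep_hyp _ _ _ _ _ _)).
by apply: bmeas_sub (acrep_bmeas au) => //; exact: ltW.
Qed.

Let W_bv : bvrep mu1 mu2 a x1 W (fun s => fr s * u s) (fun=> 0).
Proof.
split; first exact: bmeas_fru.
  by apply: leb_cI; exact: bmeas_cst.
move=> x ax xx; rewrite (W_SI (lexx a) ax xx).
rewrite (_ : CI leb _ a x = 0) ?subr0//.
by apply: complex_ext; rewrite ?ReCI ?ImCI RI_cst mul0r.
Qed.

(** The mass of [mu] seen from [t] through a decaying exponential. An atom just to the right of [t]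
    counts almost fully, so [H] is bounded without being small, but its integral is O(1 / sigma). *)
Let h (mu : {finite_measure set mR -> \bar R}) t :=
  RI mu (fun s => expR (2 * sigma * (t - s))) t x1.
Let H t := h mu1 t + h mu2 t.

Let sigma2 : 0 < 2 * sigma. Proof. exact: mulr_gt0. Qed.

Let mass1 : fine (mu1 `[a, x1[%classic) + fine (mu2 `[a, x1[%classic) <= m.
Proof.
have /andP[_ h1] := fine_mass mu1 (lexx a) (ltW x12).
have /andP[_ h2] := fine_mass mu2 (lexx a) (ltW x12).
exact: lerD.
Qed.

Let H_int : leb.-integrable `[a, x1[ (EFin \o H).
Proof.
have [i1 _ _] := exponential_tail mu1 sigma2 ax1.
have [i2 _ _] := exponential_tail mu2 sigma2 ax1.
exact: integrableD_itvco.
Qed.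

Let RI_H : RI leb H a x1 <= m / (2 * sigma).
Proof.
have [i1 b1 _] := exponential_tail mu1 sigma2 ax1.
have [i2 b2 _] := exponential_tail mu2 sigma2 ax1.
rewrite /H RID//; apply: (le_trans (lerD b1 b2)).
by rewrite -mulrDl ler_pM2r ?invr_gt0.
Qed.

Let H_bound t : a <= t -> t <= x1 -> 0 <= H t <= m.
Proof.
move=> at_ tx.
have [_ _ b1] := exponential_tail mu1 sigma2 ax1.
have [_ _ b2] := exponential_tail mu2 sigma2 ax1.
have /andP[h1 h2] := b1 t at_ tx; have /andP[h3 h4] := b2 t at_ tx.
rewrite addr_ge0//=; apply: le_trans mass1; exact: lerD.
Qed.

Let exp_int (mu : {finite_measure set mR -> \bar R}) t :
  mu.-integrable `[t, x1[ (EFin \o (fun s => expR (2 * sigma * (t - s)))).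
Proof.
have cf : continuous (fun s => expR (2 * sigma * (t - s))).
  move=> s; apply: (continuous_comp (f := fun s => 2 * sigma * (t - s))); last exact: continuous_expR.
  by apply: cvgM; [exact: cvg_cst|apply: cvgB; [exact: cvg_cst|exact: cvg_id]].
have [M hM] := continuous_bounded t x1 cf.
apply: (meas_bounded_integrable (@finite_lf _ mu) (M := M)); first exact: continuous_meas.
by move=> s s1 s2; apply: hM => //; exact: ltW.
Qed.

(** [W] vanishes at [x1], hence [W t] is minus the integral of [free * u] over [[t, x1[], and e(s)^2
    = e(t)^2 exp (2 sigma (t - s)) turns the size of the integrand into the kernel of [H]. *)
Let W_bound t : a <= t -> t <= x1 -> N (W t) <= 25 * X ^+ 2 * e t ^+ 2 * H t.
Proof.
move=> at_ tx; have := W_SI at_ tx (lexx x1); rewrite W_x1 => /esym/eqP.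
rewrite addr_eq0 => /eqP ->; rewrite NN.
pose C := 25 / 2 * X ^+ 2 * e t ^+ 2.
have bs : bmeas t x1 (fun s => fr s * u s) by apply: bmeas_sub bmeas_fru.
apply: (le_trans (N_SI (g := fun s => C * expR (2 * sigma * (t - s))) bs _ _ _)).
- exact: integrableZ_itvco (exp_int _ _).
- exact: integrableZ_itvco (exp_int _ _).
- move=> s ts sx; rewrite NM.
  apply: (@le_trans _ _ ((5 / 2 * X * e s) * (5 * X * e s))).
    apply: ler_pM; rewrite ?N_ge0//; first by apply: fr_up; exact: ltW.
    by apply: u_up; [exact: le_trans ts|exact: ltW].
  have es : e s = e t * expR (sigma * (t - s)) by rewrite /e -expRD; congr expR; ring.
  have -> : expR (2 * sigma * (t - s)) = expR (sigma * (t - s)) ^+ 2.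
    by rewrite expr2 -expRD; congr expR; ring.
  by rewrite es /C; apply: le_of_eq; field.
- rewrite (RIZ C (exp_int mu1 t)) (RIZ C (exp_int mu2 t)) -/(h mu1 t) -/(h mu2 t).
  by rewrite /C /H; apply: le_of_eq; field.
Qed.

Let d t := W t / (fr t * u t).

(** The factor X^2 e(t)^2 cancels against the lower bounds of [free] and [u], and 25 / (1 / 4 * 1 /
    8) = 800. *)
Let d_bound t : a <= t -> t <= beta -> N (d t) <= 800 * H t.
Proof.
move=> at_ tb; have tx : t <= x1 by exact: le_trans (ltW bx1).
have et : 0 < e t by exact: expR_gt0.
have /andP[H0 _] := H_bound at_ tx.
rewrite /d NM NV ler_pdivrMr; last by rewrite N_gt0// mulf_neq0 ?frn0 ?un0.
apply: (le_trans (W_bound at_ tx)).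
have h1 : 1 / 4 * X * e t * (1 / 8 * X * e t) <= N (fr t * u t).
  rewrite (NM (fr t)); apply: ler_pM; [| |exact: fr_lo|exact: u_lo].
    by rewrite mulr_ge0 ?(ltW et)// mulr_ge0 ?(ltW X0).
  by rewrite mulr_ge0 ?(ltW et)// mulr_ge0 ?(ltW X0).
apply: (@le_trans _ _ (800 * H t * (1 / 4 * X * e t * (1 / 8 * X * e t)))).
  by apply: le_of_eq; field.
have c0 : 0 <= 800 * H t := mulr_ge0 (ler0n R 800) H0.
exact: (ler_wpM2l c0 h1).
Qed.

Let acrep_r0 : acrep a beta r0 (fun s => 2 * k * r0 s).
Proof.
have hh := acrepZ (p / q) (acrep_ex a beta (2 * k) x1).
by rewrite (_ : (fun s => 2 * k * r0 s) = (fun s => p / q * (2 * k * ex (2 * k) x1 s)))//;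
  apply/funext => s; rewrite /r0; ring.
Qed.

Let bmeas_r0 : bmeas a beta r0. Proof. exact: acrep_bmeas acrep_r0. Qed.

Let bmeas_1r0 : bmeas a beta (fun s => 1 - r0 s).
Proof. by apply: bmeasB => //; exact: bmeas_cst. Qed.

Let bmeas_d : bmeas a beta d.
Proof.
have bW : bmeas a beta W by apply: bmeas_sub (bvrep_bmeas W_bv) => //; exact: ltW.
have X2 : 0 < 1 / 4 * X * (1 / 8 * X) by apply: mulr_gt0; rewrite mulr_gt0.
have bfu : bmeas a beta (fun s => fr s * u s) by apply: bmeas_sub bmeas_fru => //; exact: ltW.
apply: bmeasM => //; apply: (bmeasV X2) => // s as_ sb.
rewrite (NM (fr s)); apply: ler_pM; [| | |exact: u_lo' as_ (ltW sb)].
- by rewrite mulr_ge0 ?(ltW X0).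
- by rewrite mulr_ge0 ?(ltW X0).
apply: le_trans (fr_lo (ltW sb)); apply: ler_peMr; first by rewrite mulr_ge0 ?(ltW X0).
exact: e_ge1 (le_trans (ltW sb) (ltW bx1)).
Qed.

Let log_deriv s : a <= s -> s <= beta -> du s / u s = d s - k - 2 * k * (r0 s / (1 - r0 s)).
Proof.
move=> as_ sb; have un := un0 as_ sb; have fn := frn0 sb; have rn := rn0 sb.
have -> : du s / u s = d s + dfr s / fr s by rewrite /d /W; field; rewrite un fn.
rewrite freeE dfreeE; field.
by rewrite rn ex_neq0 kn0 q0.
Qed.

Lemma bmeas_log_deriv : bmeas a beta (fun s => du s / u s).
Proof.
have X8 : 0 < 1 / 8 * X by rewrite mulr_gt0.
apply: bmeasM; first exact: bmeas_sub (lexx a) bx2 (bvrep_bmeas bu).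
apply: (bmeasV X8); last exact: bmeas_sub (lexx a) bx2 (acrep_bmeas au).
by move=> s as_ sb; exact: u_lo' as_ (ltW sb).
Qed.

Let Y (phi dphi : R -> R[i]) s :=
  (1 - r0 s) * (dphi s * d s) - (1 - r0 s) * (phi s * d s ^+ 2).

Let bmeas_Y (phi dphi : R -> R[i]) : bmeas a beta phi -> bmeas a beta dphi ->
  bmeas a beta (Y phi dphi).
Proof.
move=> b1 b2; apply: bmeasB; apply: bmeasM => //; first exact: bmeasM.
by apply: bmeasM => //; exact: bmeasM.
Qed.

(* Integration by parts against [phi * ex k x1 / u]: the factor turns the
   Wronskian [W] into a multiple of [d], the difference of the logarithmic
   derivatives of [u] and [free]. *)
Let weak (phi dphi : R -> R[i]) : acrep a beta phi dphi -> phi a = 0 -> phi beta = 0 ->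
  CI leb (fun s => 2 * k * (phi s * d s) + Y phi dphi s) a beta +
  SI (fun s => phi s * (1 - r0 s)) a beta = 0.
Proof.
move=> aphi phia phib.
have aub : acrep a beta u du by apply: acrep_sub au.
have X8 : 0 < 1 / 8 * X by rewrite mulr_gt0.
have aF := acrepM (acrepM aphi (acrep_ex a beta k x1)) (acrepV X8 u_lo' aub).
have bW : bvrep mu1 mu2 a beta W (fun s => fr s * u s) (fun=> 0).
  by apply: bvrep_sub W_bv => //; exact: ltW.
have := integration_by_parts aF bW abeta (lexx beta).
rewrite phia phib !mul0r subrr.
rewrite [CI leb (fun s => _ * 0) a beta](_ : _ = 0); last first.
  rewrite (eq_CI leb (g := fun=> 0)); last by move=> s _ _; rewrite mulr0.
  by apply: complex_ext; rewrite ?ReCI ?ImCI RI_cst mul0r.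
rewrite subr0 => /esym hh.
(* By [freeE], [ex k x1 * free] equals this constant times [1 - r0]; it is the common factor of both
   integrals. *)
have kq : - (q / (2 * k)) != 0 by rewrite oppr_eq0 mulf_neq0// invr_eq0 mulf_neq0 ?pnatr_eq0.
apply: (mulfI kq); rewrite mulr0 mulrDr -[RHS]hh -CIZ; last first.
  apply: leb_cI; apply: bmeasD; last exact: bmeas_Y (acrep_bmeas aphi) aphi.1.
  by apply: bmeasZ; apply: bmeasM => //; exact: acrep_bmeas aphi.
rewrite -SIZ; last by apply: bmeasM => //; exact: acrep_bmeas aphi.
have exfr s : ex k x1 s * fr s = - (q / (2 * k)) * (1 - r0 s).
  rewrite freeE; transitivity (- (q / (2 * k)) * (ex k x1 s * ex (- k) x1 s) * (1 - r0 s)).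
    by ring.
  by rewrite exV mulr1.
congr (_ + _); [apply: eq_CI|apply: eq_SI] => s as_ sb.
- have un := un0 as_ (ltW sb); have ld := log_deriv as_ (ltW sb).
  have fn := frn0 (ltW sb); have rn := rn0 (ltW sb).
  have -> : W s = d s * fr s * u s by rewrite /d; field; rewrite un fn.
  transitivity (ex k x1 s * fr s * d s * (dphi s + phi s * k - phi s * (du s / u s))); last first.
    by field; rewrite un.
  rewrite exfr ld /Y; field.
  by rewrite rn kn0.
- have un := un0 as_ (ltW sb).
  transitivity (ex k x1 s * fr s * phi s); last by field; rewrite un.
  by rewrite exfr; field; rewrite kn0.
Qed.
Let acrep_r0X n : acrep a beta (fun s => r0 s ^+ n) (fun s => 2 * k * n%:R * r0 s ^+ n).
Proof.
elim: n => [|n IH].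
  have -> : (fun s => 2 * k * 0%:R * r0 s ^+ 0) = (fun=> 0) by apply/funext => s; rewrite mulr0 mul0r.
  exact: acrep_cst.
have hh := acrepM acrep_r0 IH.
have -> : (fun s => r0 s ^+ n.+1) = (fun s => r0 s * r0 s ^+ n) by apply/funext => s; rewrite exprS.
have -> // : (fun s => 2 * k * n.+1%:R * r0 s ^+ n.+1) =
  (fun s => 2 * k * r0 s * r0 s ^+ n + r0 s * (2 * k * n%:R * r0 s ^+ n)).
by apply/funext => s; rewrite exprS -natr1; ring.
Qed.

Let bmeas_r0X n : bmeas a beta (fun s => r0 s ^+ n).
Proof. exact: acrep_bmeas (acrep_r0X n). Qed.

Let bmeas_V : bmeas a beta (fun s => (1 - r0 s)^-1).
Proof.
have c2 : (0 : R) < 1 / 2 by rewrite divr_gt0.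
by apply: (bmeasV c2) => // s _ sb; have [] := N_1r0 (ltW sb).
Qed.

(** The derivative of r0^n is 2 k n r0^n, so one integration by parts without boundary terms trades
    a factor 2 k n for a derivative of [F]. *)
Let oscillation n (F F' : R -> R[i]) : acrep a beta F F' -> F a = 0 -> F beta = 0 ->
  2 * k * n%:R * CI leb (fun s => F s * r0 s ^+ n) a beta =
  - CI leb (fun s => F' s * r0 s ^+ n) a beta.
Proof.
move=> aF Fa Fb; have [bF' _] := aF; have bF := acrep_bmeas aF.
have [_ hh] := acrepM aF (acrep_r0X n); have := hh beta abeta (lexx beta).
have b1 := bmeasM bF (bmeas_r0X n).
rewrite Fa Fb !mul0r add0r CID; last 2 first.
- by apply: leb_cI; exact: bmeasM.
- by apply: leb_cI; apply: bmeasM => //; exact: bmeasZ.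
move=> /esym/eqP; rewrite addrC addr_eq0 => /eqP <-.
rewrite -CIZ; last exact: leb_cI.
by apply: eq_CI => s _ _; ring.
Qed.

Variables (phi dphi ddphi : R -> R[i]) (M : R).
Hypotheses (aphi : acrep a beta phi dphi) (adphi : acrep a beta dphi ddphi).
Hypotheses (phia : phi a = 0) (phib : phi beta = 0) (dphia : dphi a = 0) (dphib : dphi beta = 0).
Hypotheses (M0 : 0 <= M) (phiM : forall s, a <= s -> s < beta -> N (phi s) <= M).
Hypotheses (dphiM : forall s, a <= s -> s < beta -> N (dphi s) <= M).
Hypotheses (ddphiM : forall s, a <= s -> s < beta -> N (ddphi s) <= M).

Let bphi : bmeas a beta phi. Proof. exact: acrep_bmeas aphi. Qed.
Let bdphi : bmeas a beta dphi. Proof. exact: acrep_bmeas adphi. Qed.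
Let bddphi : bmeas a beta ddphi. Proof. by have [] := adphi. Qed.

Let Nr0X n s : s < beta -> N (r0 s ^+ n) <= theta ^+ n.
Proof.
move=> sb; elim: n => [|n IH]; first by rewrite !expr0 N1.
by rewrite !exprS (NM (r0 s)); apply: ler_pM; rewrite ?N_ge0// N_r0// ltW.
Qed.

Let I n := CI leb (fun s => 4 * k ^+ 2 * (phi s * r0 s ^+ n)) a beta.

(** No power of |k| is left in the bound, which is essential as [theta] is small in terms of Re k
    only. The leftover factor 1 / (n + 1)^2 is at most 1. *)
Let I_bound n : N (I n.+1) <= 2 * M * (beta - a) * theta ^+ n.+1.
Proof.
have bp := bmeasM bphi (bmeas_r0X n.+1).
have h2 := oscillation n.+1 aphi phia phib; have h3 := oscillation n.+1 adphi dphia dphib.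
have nn : (n.+1%:R : R[i]) != 0 by rewrite pnatr_eq0.
have e1 : I n.+1 = (n.+1%:R)^-1 ^+ 2 * CI leb (fun s => ddphi s * r0 s ^+ n.+1) a beta.
  rewrite /I CIZ; last exact: leb_cI.
  have -> : CI leb (fun s => ddphi s * r0 s ^+ n.+1) a beta =
      (2 * k * n.+1%:R) ^+ 2 * CI leb (fun s => phi s * r0 s ^+ n.+1) a beta.
    by rewrite expr2 -mulrA h2 mulrN h3 opprK.
  by move: (n.+1%:R : R[i]) nn (CI _ _ _ _) => c cn C; field.
rewrite e1 NM expr2 (NM n.+1%:R^-1) NV Nn.
have bd := bmeasM bddphi (bmeas_r0X n.+1).
have h4 : N (CI leb (fun s => ddphi s * r0 s ^+ n.+1) a beta) <= 2 * M * (beta - a) * theta ^+ n.+1.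
  apply: (le_trans (N_CI_cst (@leb_lf R) (M := M * theta ^+ n.+1) bd.1 _)).
    move=> s as_ sb; rewrite (NM (ddphi s)); apply: ler_pM; rewrite ?N_ge0//.
    - exact: ddphiM.
    - exact: Nr0X.
  by rewrite fine_leb_itvco//; apply: le_of_eq; ring.
have n1 : n.+1%:R^-1 <= (1 : R) by rewrite invf_le1 ?ler1n// ltr0n.
have n0 : (0 : R) <= n.+1%:R^-1 by rewrite invr_ge0.
apply: le_trans h4; apply: ler_piMl; first exact: N_ge0.
by apply: mulr_ile1.
Qed.

(* [4 k ^+ 2 phi r0 / (1 - r0)] is expanded in powers of [r0 = c exp(2 k s)]; in
   each term two integrations by parts remove the factor [4 k ^+ 2]. *)
Let A n := CI leb (fun s => 4 * k ^+ 2 * (phi s * r0 s ^+ n) / (1 - r0 s)) a beta.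

Let bmeas_A n : bmeas a beta (fun s => 4 * k ^+ 2 * (phi s * r0 s ^+ n) / (1 - r0 s)).
Proof.
apply: bmeasM; last exact: bmeas_V.
by apply: bmeasZ; apply: bmeasM; [exact: bphi|exact: bmeas_r0X].
Qed.

Let A_step n : A n = I n + A n.+1.
Proof.
rewrite /A /I -CID; last 2 first.
- by apply: leb_cI; apply: bmeasZ; apply: bmeasM; [exact: bphi|exact: bmeas_r0X].
- exact: leb_cI (bmeas_A n.+1).
by apply: eq_CI => s _ sb; rewrite (exprS (r0 s) n); field; exact: rn0 (ltW sb).
Qed.

(** Crude because of |k|^2, but sufficient for the tail of the expansion, where [k] is fixed and [n]
    grows. *)
Let A_bound n : N (A n) <= 16 * N k ^+ 2 * M * (beta - a) * theta ^+ n.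
Proof.
apply: (le_trans (N_CI_cst (@leb_lf R) (M := 8 * N k ^+ 2 * M * theta ^+ n) (bmeas_A n).1 _)).
  move=> s as_ sb; rewrite (NM (4 * _ * _)) (NM (4 * _)) (NM 4) (Nn 4) (NM (phi s)) NV expr2 (NM k).
  have [h2 _] := N_1r0 (ltW sb).
  have h3 : (N (1 - r0 s))^-1 <= 2.
    by rewrite -[2]invrK lef_pV2 ?posrE// ?invr_gt0//; [rewrite -[2^-1]mul1r|exact: lt_le_trans h2].
  have -> : 8 * (N k ^+ 2) * M * theta ^+ n = 4 * (N k * N k) * (M * theta ^+ n) * 2 by ring.
  apply: ler_pM => //.
  - by rewrite mulr_ge0 ?mulr_ge0 ?N_ge0.
  - by rewrite invr_ge0 N_ge0.
  rewrite ler_wpM2l ?mulr_ge0 ?N_ge0//; apply: ler_pM; rewrite ?N_ge0//.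
  - exact: phiM.
  - exact: Nr0X.
by rewrite fine_leb_itvco//; apply: le_of_eq; ring.
Qed.

(** Finite telescoping with a vanishing tail replaces summation of the series under the integral. As
    [theta <= 1 / 2] the terms are dominated by a geometric series; an excess over its sum,
    multiplied by 2^n, would stay bounded, against the Archimedean property. *)
Let A1_bound : N (A 1) <= 4 * M * (beta - a) * theta.
Proof.
have L0 : 0 <= M * (beta - a) by rewrite mulr_ge0// subr_ge0.
have th n : theta ^+ n.+1 <= theta / 2 ^+ n.
  rewrite exprS ler_wpM2l// -exprVn lerXn2r ?nnegrE ?invr_ge0//.
  by move: theta2; rewrite mul1r.
have step n : N (A 1) <= 4 * (M * (beta - a)) * theta * (1 - (2 ^+ n)^-1) + N (A n.+1).
  elim: n => [|n IH]; first by rewrite expr0 invr1 subrr mulr0 add0r.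
  apply: (le_trans IH); rewrite (A_step n.+1).
  apply: (le_trans (lerD (lexx _) (ND _ _))); rewrite addrA lerD2r -lerBrDl.
  apply: (le_trans (I_bound n)).
  have -> : 4 * (M * (beta - a)) * theta * (1 - (2 ^+ n.+1)^-1) -
     4 * (M * (beta - a)) * theta * (1 - (2 ^+ n)^-1) =
     2 * (M * (beta - a)) * (theta / 2 ^+ n).
    by rewrite exprS; field; rewrite expf_neq0.
  by rewrite -(mulrA 2 M) ler_wpM2l// mulr_ge0.
have step' n : N (A 1) - 4 * (M * (beta - a)) * theta <=
    16 * N k ^+ 2 * (M * (beta - a)) * theta / 2 ^+ n.
  have h2 := step n; have h3 := A_bound n.+1.
  have h4 : 16 * N k ^+ 2 * M * (beta - a) * theta ^+ n.+1 <=
      16 * N k ^+ 2 * (M * (beta - a)) * theta / 2 ^+ n.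
    rewrite -(mulrA _ M) -(mulrA _ theta) ler_wpM2l//.
    by apply: mulr_ge0 => //; apply: mulr_ge0; rewrite ?ler0n ?exprn_ge0 ?N_ge0.
  have h5 : 0 <= 4 * (M * (beta - a)) * theta * (2 ^+ n)^-1.
    by rewrite mulr_ge0 ?invr_ge0 ?exprn_ge0// mulr_ge0// mulr_ge0.
  move: h2; rewrite mulrBr mulr1 => h2; move: h2 h3 h4 h5.
  move: (N _) (N _) (4 * _ * _) (_ * theta ^+ _) (_ / _) (_ / _) => *; lra.
rewrite -(mulrA 4 M) -subr_le0 leNgt; apply/negP => D0.
move: step' D0; set C := 16 * _ * _ * _; move: C (N (A 1) - _) => C D step' D0.
have [C0|/ltW C0] := leP 0 C; last first.
  by have := step' 0%N; rewrite expr0 divr1 leNgt (le_lt_trans C0).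
have := archi_boundP (divr_ge0 C0 (ltW D0)); set n := Num.bound _ => nb.
have := step' n; rewrite ler_pdivlMr ?exprn_gt0// leNgt => /negP; apply.
move: nb; rewrite ltr_pdivrMr// mulrC => nb; apply: (lt_le_trans nb).
by rewrite ler_pM2l// -natrX ler_nat ltnW// ltn_expl.
Qed.

Let theta_le : theta <= 2 / (sigma * (x1 - beta)).
Proof.
have d0 : 0 < 2 * sigma * (x1 - beta) by rewrite mulr_gt0// subr_gt0.
rewrite /theta expRN ler_pdivlMr; last by rewrite mulr_gt0// subr_gt0.
rewrite mulrAC ler_pdivrMr ?expR_gt0//.
apply: (@le_trans _ _ (2 * (2 * sigma * (x1 - beta)))).
  by apply: le_of_eq; ring.
by rewrite ler_wpM2l//; apply: le_trans (expR_ge1Dx _); rewrite lerDr.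
Qed.

Let Y_bound s : a <= s -> s < beta ->
  N (Y phi dphi s) <= 3 / 2 * M * (1 + 800 * m) * 800 * H s.
Proof.
move=> as_ sb; have [_ h2] := N_1r0 (ltW sb).
have sx : s <= x1 := le_trans (ltW sb) (ltW bx1).
have /andP[H0 Hm] := H_bound as_ sx; have hd := d_bound as_ (ltW sb).
have -> : Y phi dphi s = (1 - r0 s) * (d s * (dphi s - phi s * d s)) by rewrite /Y; ring.
rewrite (NM (1 - r0 s)) (NM (d s)).
have h3 : N (dphi s - phi s * d s) <= M * (1 + 800 * m).
  apply: (le_trans (NB _ _)); rewrite (NM (phi s)) mulrDr mulr1; apply: lerD; first exact: dphiM.
  apply: ler_pM; rewrite ?N_ge0//; first exact: phiM.
  exact: le_trans hd (ler_wpM2l (ler0n R 800) Hm).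
have -> : 3 / 2 * M * (1 + 800 * m) * 800 * H s =
  3 / 2 * ((800 * H s) * (M * (1 + 800 * m))) by ring.
apply: ler_pM; [exact: N_ge0|exact: mulr_ge0 (N_ge0 _) (N_ge0 _)|exact: h2|].
by apply: ler_pM; [exact: N_ge0|exact: N_ge0|exact: hd|exact: h3].
Qed.

(** The left side is 2k times the remainder of the expansion. It splits into the integral of
    [phi * r0] against [chi] and the term [A 1], both of order [theta], and the integral of [Y], of
    order the integral of [H]. *)
Lemma remainder_bound :
  N (CI leb (fun s => 2 * k * (phi s * (du s / u s)) + 2 * k ^+ 2 * phi s) a beta + SI phi a beta)
  <= (1200 * M * (1 + 800 * m) * m + (4 * M * m + 8 * M * (beta - a)) / (x1 - beta)) / sigma.
Proof.
have bY := bmeas_Y bphi bdphi.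
have b1 : bmeas a beta (fun s => 2 * k * (phi s * d s)).
  by apply: bmeasZ; apply: bmeasM; [exact: bphi|exact: bmeas_d].
have br := bmeasM bphi bmeas_r0.
have eT : CI leb (fun s => 2 * k * (phi s * (du s / u s)) + 2 * k ^+ 2 * phi s) a beta +
    SI phi a beta = SI (fun s => phi s * r0 s) a beta - CI leb (Y phi dphi) a beta - A 1.
  have := weak aphi phia phib.
  rewrite (CID (leb_cI b1) (leb_cI bY)) (eq_SI mu1 mu2 (g := fun s => phi s - phi s * r0 s)); last first.
    by move=> s _ _; rewrite mulrBr mulr1.
  rewrite (SIB mu1 mu2 bphi br) => hw.
  have -> : CI leb (fun s => 2 * k * (phi s * (du s / u s)) + 2 * k ^+ 2 * phi s) a beta =
      CI leb (fun s => 2 * k * (phi s * d s)) a beta - A 1.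
    rewrite /A -(CIB (leb_cI b1) (leb_cI (bmeas_A 1))).
    apply: eq_CI => s as_ sb; rewrite (log_deriv as_ (ltW sb)) expr1; field.
    exact: rn0 (ltW sb).
  rewrite -[RHS]addr0 -hw; ring.
rewrite eT; apply: (le_trans (NB _ _)).
have s1 : N (SI (fun s => phi s * r0 s) a beta) <= 2 * (M * theta) * m.
  have Mt : 0 <= M * theta by rewrite mulr_ge0.
  apply: (@N_SI_mass R mu1 mu2 a x2 _ (M * theta) a beta (lexx a) bx2 br Mt).
  move=> s as_ sb; rewrite (NM (phi s)); apply: ler_pM; rewrite ?N_ge0//; first exact: phiM.
  exact: N_r0 (ltW sb).
have s2 : N (CI leb (Y phi dphi) a beta) <= 1200 * M * (1 + 800 * m) * m / sigma.
  pose c := 3 / 2 * M * (1 + 800 * m) * 800.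
  have iH : leb.-integrable `[a, beta[ (EFin \o H) by apply: integrable_itvcoS H_int => //; exact: ltW.
  apply: (le_trans (N_CI (g := fun s => c * H s) bY.1 (integrableZ_itvco c iH) Y_bound)).
  rewrite (RIZ c iH).
  have hH : RI leb H a beta <= m / (2 * sigma).
    apply: le_trans RI_H; rewrite (RI_add abeta (ltW bx1) H_int) lerDl.
    apply: RI_ge0 => s bs sx.
    by have /andP[] := H_bound (le_trans abeta bs) (ltW sx).
  have c0 : 0 <= c.
    rewrite /c; apply: mulr_ge0; last exact: ler0n.
    apply: mulr_ge0; first by apply: mulr_ge0 => //; apply: divr_ge0; exact: ler0n.
    exact: addr_ge0 ler01 (mulr_ge0 (ler0n R 800) m0).
  apply: (@le_trans _ _ (2 * (c * (m / (2 * sigma))))).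
    by apply: ler_wpM2l; [exact: ler0n|exact: ler_wpM2l].
  by rewrite /c; apply: le_of_eq; field; rewrite gt_eqF.
have s3 : 2 * (M * theta) * m + 4 * M * (beta - a) * theta <=
    (4 * M * m + 8 * M * (beta - a)) / (x1 - beta) / sigma.
  have -> : 2 * (M * theta) * m + 4 * M * (beta - a) * theta =
    (2 * M * m + 4 * M * (beta - a)) * theta by ring.
  have -> : (4 * M * m + 8 * M * (beta - a)) / (x1 - beta) / sigma =
    (2 * M * m + 4 * M * (beta - a)) * (2 / (sigma * (x1 - beta))).
    have xb : x1 - beta != 0 by rewrite subr_eq0 gt_eqF.
    have sn : sigma != 0 by rewrite gt_eqF.
    by field; rewrite ?xb ?sn.
  rewrite ler_wpM2l//; apply: addr_ge0.
    by apply: mulr_ge0 => //; apply: mulr_ge0 => //; exact: ler0n.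
  by rewrite mulr_ge0 ?subr_ge0//; apply: mulr_ge0 => //; exact: ler0n.
rewrite mulrDl; apply: le_trans (lerD s2 s3).
apply: (le_trans (lerD (NB _ _) A1_bound)).
move: s1; move: (N (SI _ _ _)) (N (CI _ _ _ _)) s2 => r1 r2 s2 s1.
move: s1 s2; move: (1200 * _ * _ * _ / _) => r3; lra.
Qed.
End core.

(** * The expansion *)

Section test_functions.
Context (R : realType).
Notation leb := (@lebesgue_measure R).
Notation mR := (measurableTypeR R).
Implicit Types (a beta : R) (b : \bar R) (phi f : R -> R[i]).

(** Vanishing near the endpoints, and not only at them, also annihilates the boundary values of the
    derivative of [phi], needed for the second integration by parts. *)
Lemma test_function_vanish a b phi : (a%:E < b)%E -> test_function a b phi ->
  exists beta, [/\ a < beta, (beta%:E < b)%E, \forall s \near a, phi s = 0,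
    \forall s \near beta, phi s = 0 & forall s, beta <= s -> phi s = 0].
Proof.
move=> ab [_ _ [K [cK Kab Kphi]]].
have clK : closed K by apply: compact_closed => //; exact: Rhausdorff.
have [c [cb cK']] : exists c, (c%:E < b)%E /\ forall s, K s -> s <= c.
  have [->|/set0P K0] := eqVneq K set0; first by exists a; split.
  have ubK : has_ubound K.
    have [M [_ hM]] := compact_bounded cK.
    exists (M + 1) => s Ks; apply: le_trans (ler_norm _) _.
    by apply: (hM (M + 1)) => //; rewrite ltrDl.
  exists (sup K); split; last by move=> s Ks; exact: ub_le_sup.
  have /Kab[] // : K (sup K).
  by move: (closure_sup K0 ubK); rewrite -(closure_id K).1.
have [beta cbeta bb] := lt_dense (lt_maxb ab cb).
have zero s : ~ K s -> \forall y \near s, phi y = 0.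
  move=> Ks; have : nbhs s (~` K) by apply: open_nbhs_nbhs; split => //; exact: closed_openC.
  by apply: filterS => y; exact: Kphi.
have [ab' cb'] : a < beta /\ c < beta by apply/andP; rewrite -gt_max.
have nK s : beta <= s -> ~ K s by move=> bs /cK' sc; have := lt_le_trans cb' (le_trans bs sc); rewrite ltxx.
exists beta; split => //.
- by apply: zero => /Kab[]; rewrite ltxx.
- by apply: zero; exact: nK.
- by move=> s bs; apply: Kphi; exact: nK.
Qed.

Definition cderive n f (s : R) : R[i] :=
  derive1n n (fun y => complex.Re (f y)) s +i* derive1n n (fun y => complex.Im (f y)) s.

Lemma cderive0 f : cderive 0 f = f.
Proof. by apply/funext => s; rewrite /cderive /=; case: (f s). Qed.

Lemma acrep_cderive n f t d :
  (forall n x, derivable (derive1n n (fun y => complex.Re (f y))) x 1) ->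
  (forall n x, derivable (derive1n n (fun y => complex.Im (f y))) x 1) ->
  acrep t d (cderive n f) (cderive n.+1 f).
Proof.
move=> d1 d2; have cd (g : R -> R) m : (forall n x, derivable (derive1n n g) x 1) ->
    continuous (derive1n m g).
  by move=> dg x; apply: differentiable_continuous; apply/derivable1_diffP; exact: dg.
have dd (g : R -> R) x : derivable (derive1n n g) x 1 ->
    is_derive x (1 : R) (derive1n n g) (derive1n n.+1 g x).
  by move=> dg; rewrite derive1nS derive1E; exact: derivableP.
by apply: acrep_smooth; [|exact: cd|exact: cd] => s; split; exact: dd.
Qed.

Lemma cderive1_near0 f s : (\forall y \near s, f y = 0) -> cderive 1 f s = 0.
Proof.
move=> f0.
have dd (g : R -> R) : (\forall y \near s, g y = 0) -> derive1n 1 g s = 0.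
  move=> g0; rewrite derive1n1 derive1E (@near_eq_derive _ _ _ _ (cst 0)) ?derive_cst//.
by apply: complex_ext; apply: dd; apply: filterS f0 => y ->.
Qed.

Lemma test_function_data a b phi : (a%:E < b)%E -> test_function a b phi ->
  exists beta dphi ddphi M,
    [/\ [/\ a < beta, (beta%:E < b)%E & forall s, beta <= s -> phi s = 0],
        [/\ acrep a beta phi dphi & acrep a beta dphi ddphi],
        [/\ phi a = 0, phi beta = 0, dphi a = 0 & dphi beta = 0] &
        0 <= M /\ forall s, a <= s -> s < beta ->
          [/\ N (phi s) <= M, N (dphi s) <= M & N (ddphi s) <= M]].
Proof.
move=> ab tphi; have [d1 d2 _] := tphi.
have [beta [abeta bb za zb phi0]] := test_function_vanish ab tphi.
have ac n : acrep a beta (cderive n phi) (cderive n.+1 phi) by exact: acrep_cderive.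
have [M0 M00 h0] := acrep_bounded (ac 0%N).
have [M1 M10 h1] := acrep_bounded (ac 1%N).
have [M2 M20 h2] := acrep_bounded (ac 2%N).
have ac0 := ac 0%N; rewrite cderive0 in ac0 h0.
exists beta, (cderive 1 phi), (cderive 2 phi), (M0 + M1 + M2); split; [by split|by split; [exact: ac0|exact: ac]| |].
- by split; [exact: nbhs_singleton za|exact: phi0|exact: cderive1_near0|exact: cderive1_near0].
split; first by rewrite !addr_ge0// ltW.
move=> s as_ /ltW sb; have := h0 s as_ sb; have := h1 s as_ sb; have := h2 s as_ sb.
move: (N _) (N _) (N _) => r1 r2 r3 *; split; lra.
Qed.

Lemma Rintegral_supp (mu : {measure set mR -> \bar R}) (D D' : set mR) (g : R -> R) :
  (forall s, D s -> ~ D' s -> g s = 0) -> (forall s, D' s -> ~ D s -> g s = 0) ->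
  \int[mu]_(s in D) g s = \int[mu]_(s in D') g s.
Proof.
move=> h1 h2; rewrite Rintegral_mkcond [RHS]Rintegral_mkcond; congr (Rintegral _ _ _).
apply/funext => s; rewrite !patchE; case: ifPn => [|/negP]; rewrite inE => Ds; case: ifPn => [|/negP];
  rewrite inE => D's //; [exact: h1|exact/esym/h2].
Qed.

Lemma oo_itv_supp a b beta (g : R -> R) : (beta%:E < b)%E -> g a = 0 ->
  (forall s, beta <= s -> g s = 0) ->
  (forall s, oo_itv a b s -> ~ (`[a, beta[%classic : set R) s -> g s = 0) /\
  (forall s, (`[a, beta[%classic : set R) s -> ~ oo_itv a b s -> g s = 0).
Proof.
move=> bb ga g0; split => s /=; rewrite in_itv/=.
  by move=> [/ltW as_ sb] /negP; rewrite as_/= -leNgt; exact: g0.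
move=> /andP[]; rewrite le_eqVlt => /orP[/eqP <-//|as_ sb nab]; exfalso; apply: nab; split => //.
by apply: lt_trans bb; rewrite lte_fin.
Qed.

Lemma leb_integral_CI a b beta f : (beta%:E < b)%E -> f a = 0 ->
  (forall s, beta <= s -> f s = 0) -> leb_integral (oo_itv a b) f = CI leb f a beta.
Proof.
move=> bb fa f0; apply: complex_ext; rewrite ?ReCI ?ImCI; apply: Rintegral_supp;
  apply oo_itv_supp; rewrite ?fa// => s bs; by rewrite f0.
Qed.

Lemma charge_Rintegral_supp (nu : {charge set mR -> \bar R}) (D D' : set mR) (g : R -> R) :
  (forall s, D s -> ~ D' s -> g s = 0) -> (forall s, D' s -> ~ D s -> g s = 0) ->
  charge_Rintegral nu D g = charge_Rintegral nu D' g.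
Proof. by move=> h1 h2; rewrite /charge_Rintegral !(Rintegral_supp _ h1 h2). Qed.

Lemma left_nbhs_proper b (c : R) : (c%:E < b)%E -> ProperFilter (left_nbhs b).
Proof.
move=> cb; apply: filter_from_proper; last first.
  by move=> x xb; have [y xy yb] := lt_dense xb; exists y.
apply: filter_from_filter; first by exists c.
move=> x y xb yb; exists (Num.max x y); first exact: lt_maxb.
by move=> s [+ sb]; rewrite gt_max => /andP[xs ys]; split.
Qed.

(** The integral is constant as soon as [c] exceeds [beta]. Replacing []a, c[] by [[a, beta[] is
    harmless even if [chi] has an atom at [a], since [g a = 0]. *)
Lemma chi_lim a b (chi : signed_measure a b) beta d (g : R -> R) (M : R) :
  a < beta -> beta <= d -> (d%:E < b)%E -> meas a beta g ->
  (forall s, a <= s -> s < beta -> `|g s| <= M) -> g a = 0 ->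
  (forall s, beta <= s -> g s = 0) ->
  lim (charge_Rintegral (chi c) `]a, c[%classic g @[c --> left_nbhs b]) =
  charge_Rintegral (chi d) `[a, beta[%classic g.
Proof.
move=> abeta bd db mg gM ga g0; have PF := left_nbhs_proper db.
apply: cvg_lim; first exact: Rhausdorff.
apply: cvg_near_cst; exists beta; first by apply: le_lt_trans db; rewrite lee_fin.
move=> c [bc cb].
have -> : charge_Rintegral (chi c) `]a, c[%classic g = charge_Rintegral (chi c) `[a, beta[%classic g.
  have [h1 h2] := @oo_itv_supp a c%:E beta g bc ga g0.
  have ooE : oo_itv a c%:E = `]a, c[%classic :> set R.
    by apply/seteqP; split => s; rewrite /oo_itv /= in_itv/= lte_fin; [move=> [-> ->]|move/andP].
  by rewrite -ooE; exact: charge_Rintegral_supp.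
have gM' s : (`[a, beta[%classic : set R) s -> `|g s| <= M.
  by rewrite /= in_itv/= => /andP[]; exact: gM.
have ac : a < c by exact: lt_trans bc.
have mI := measurable_itvco a beta.
have [cd|/ltW dc] := leP c d.
  exact: (eq_chi_Rintegral chi mI mg gM' (subset_itvco (lexx a) (ltW bc)) ac cd db).
apply/esym; exact: (eq_chi_Rintegral chi mI mg gM' (subset_itvco (lexx a) bd)
  (lt_le_trans abeta bd) dc cb).
Qed.

Lemma chi_integral_SI a b (chi : signed_measure a b) beta d f :
  a < beta -> beta <= d -> (d%:E < b)%E -> bmeas a beta f -> f a = 0 ->
  (forall s, beta <= s -> f s = 0) ->
  chi_integral chi f = SI (posm (chi d)) (negm (chi d)) f a beta.
Proof.
move=> abeta bd db [[m1 m2] [M fM]] fa f0; rewrite -charge_integral_SI /chi_integral.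
congr (_ +i* _); apply: (@chi_lim _ _ _ _ _ _ M) => //.
- by move=> s as_ sb; apply: le_trans (N_Re _) _; exact: fM.
- by rewrite fa.
- by move=> s bs; rewrite f0.
- by move=> s as_ sb; apply: le_trans (N_Im _) _; exact: fM.
- by rewrite fa.
- by move=> s bs; rewrite f0.
Qed.

End test_functions.

Section expansion.
Context (R : realType).
Notation leb := (@lebesgue_measure R).
Notation mR := (measurableTypeR R).

Lemma N_sqrtc (x : R[i]) : N x = N (sqrtc x) ^+ 2.
Proof. by rewrite expr2 -(NM (sqrtc x)) -expr2 sqr_sqrtc. Qed.

Lemma remainder_decay (a : R) (b : \bar R) (chi : signed_measure a b) (w dw : R -> R[i])
    (m : R[i] -> R -> R[i]) (phi : R -> R[i]) :
  (a%:E < b)%E -> (limit_circle chi -> boundary_function chi w dw) ->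
  is_weyl_function chi w dw m -> test_function a b phi ->
  exists C K : R, forall z, K < complex.Im z -> K < complex.Re (sqrtc (- z)) ->
    N (leb_integral (oo_itv a b) (fun t => m z t * phi t)
      - (- sqrtc (- z) * leb_integral (oo_itv a b) phi
         - 1 / (2 * sqrtc (- z)) * chi_integral chi phi))
      / (Num.sqrt (N z))^-1 <= C / complex.Re (sqrtc (- z)).
Proof.
move=> ab hw hm tphi.
have [beta [dphi [ddphi [M [[abeta bb phi0] [aphi adphi] [phia phib dphia dphib] [M0 hM]]]]]] :=
  test_function_data ab tphi.
(* The gap from [beta] to [x1] makes r0 small on [[a, beta]]; the gap from [x1] to [x2] leaves room
   for the growth that [reflection_bound] excludes. *)
have [x1 bx1 x1b] := lt_dense bb; have [x2 x12 x2b] := lt_dense x1b.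
have ax1 : a <= x1 := ltW (lt_trans abeta bx1).
have ax2 : a <= x2 := le_trans ax1 (ltW x12).
have bx2 : beta <= x2 := ltW (lt_trans bx1 x12).
pose V := mass (posm (chi x2)) (negm (chi x2)) a x2.
pose del := x1 - beta; pose Del := x2 - x1.
have d0 : 0 < del by rewrite subr_gt0.
have D0 : 0 < Del ^+ 3 by rewrite exprn_gt0// subr_gt0.
have V0 : 0 <= V by exact: mass_ge0.
(* One summand per requirement: Re k and Im z at least 1, smallness of the perturbation,
   [theta <= 1 / 2], and the growth threshold of [reflection_bound]. *)
pose K0 : R := 1 + 80 * V + 4 / del + 300 / Del ^+ 3.
(* Half the constant of [remainder_bound]: dividing by 2k and multiplying by |z|^(1/2) = |k| leaves
   a factor 1 / 2. *)
pose C := (1200 * M * (1 + 800 * V) * V + (4 * M * V + 8 * M * (beta - a)) / del) / 2.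
have [K1 [KV [Kd KD]]] : 1 <= K0 /\ 80 * V <= K0 /\ 4 / del <= K0 /\ 300 / Del ^+ 3 <= K0.
  have h1 : 0 <= 80 * V := mulr_ge0 (ler0n R 80) V0.
  have h2 : 0 <= 4 / del := divr_ge0 (ler0n R 4) (ltW d0).
  have h3 : 0 <= 300 / Del ^+ 3 := divr_ge0 (ler0n R 300) (ltW D0).
  rewrite /K0; move: (80 * V) (4 / del) (300 / Del ^+ 3) h1 h2 h3 => r1 r2 r3; clear => *.
  by split; [|split; [|split]]; lra.
exists C, K0 => z zK kK.
set k := sqrtc (- z) in kK *; set sigma := complex.Re k in kK *.
have kz : k ^+ 2 = - z by exact: sqr_sqrtc.
have s0 : 0 < sigma by apply: lt_trans kK; exact: lt_le_trans K1.
have z1 : 1 <= complex.Im z by apply: ltW; exact: le_lt_trans zK.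
have sk : sigma <= N k by apply: le_trans (N_Re k); exact: ler_norm.
have [u [du [sol mE hJ]]] := weyl_solution hw ab hm (lt_le_trans ltr01 z1).
have [au bu] := sol x2 ax2 x2b.
have Vk : 80 * V <= N k := le_trans KV (le_trans (ltW kK) sk).
have pq : N (du x1 + k * u x1) <= 4 * N (du x1 - k * u x1).
  apply: (reflection_bound ax1 x12 kz s0 au bu (hJ _ _ ax1 (ltW x12) x2b)) => //.
  - by apply: ltW; exact: le_lt_trans kK.
  - apply: le_trans Vk; apply: ler_wpM2r; first exact: V0.
    by rewrite ler_nat.
  - by rewrite -ltr_pdivrMr//; exact: le_lt_trans kK.
have [u1 _] := mE x1 ax1 x1b.
(* The exponential of 2 sigma del has to reach 8; with sigma del >= 4 already exp r >= 1 + r gives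
   9. *)
have theta2 : 4 * expR (- (2 * sigma * (x1 - beta))) <= 1 / 2.
  rewrite expRN ler_pdivrMr ?expR_gt0// mul1r ler_pdivlMl//.
  apply: (@le_trans _ _ (1 + 2 * sigma * del)); last exact: expR_ge1Dx.
  have : 4 <= sigma * del by rewrite -ler_pdivrMr//; exact: le_trans (ltW kK).
  by rewrite -mulrA; move: (sigma * del) => r; clear; lra.
have hM0 s : a <= s -> s < beta -> N (phi s) <= M by move=> h1 h2; have [] := hM s h1 h2.
have hM1 s : a <= s -> s < beta -> N (dphi s) <= M by move=> h1 h2; have [] := hM s h1 h2.
have hM2 s : a <= s -> s < beta -> N (ddphi s) <= M by move=> h1 h2; have [] := hM s h1 h2.
have := remainder_bound (ltW abeta) bx1 x12 kz s0 au bu u1 pq Vk theta2 aphi adphi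
  phia phib dphia dphib M0 hM0 hM1 hM2.
set T := (X in N X <= _); rewrite -/V -/del -/sigma => hT.
have kn : k != 0 by exact: k_neq0 s0.
have bphi := acrep_bmeas aphi.
have e1 : leb_integral (oo_itv a b) (fun t => m z t * phi t)
      - (- k * leb_integral (oo_itv a b) phi - 1 / (2 * k) * chi_integral chi phi) = T / (2 * k).
  rewrite (leb_integral_CI bb phia phi0) (chi_integral_SI chi abeta bx2 x2b bphi phia phi0).
  rewrite (@leb_integral_CI _ a b beta) //; last 2 first.
  - by rewrite phia mulr0.
  - by move=> s bs; rewrite phi0 ?mulr0.
  have bu' : bmeas a beta (fun s => du s / u s * phi s).
    apply: bmeasM bphi.
    exact: bmeas_log_deriv (ltW abeta) bx1 x12 kz s0 au bu u1 pq Vk theta2.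
  rewrite (eq_CI leb (g := fun s => du s / u s * phi s)); last first.
    move=> s as_ sb; have sb' : (s%:E < b)%E by apply: lt_trans bb; rewrite lte_fin.
    by have [_ ->] := mE s as_ sb'.
  have -> : T = 2 * k * CI leb (fun s => du s / u s * phi s) a beta + 2 * k ^+ 2 * CI leb phi a beta
     + SI (posm (chi x2)) (negm (chi x2)) phi a beta.
    rewrite -CIZ; last exact: leb_cI.
    rewrite -(CIZ (2 * k ^+ 2)); last exact: leb_cI.
    rewrite -CID; [|exact: cIZ (leb_cI _)..].
    by congr (_ + _); apply: eq_CI => s _ _; ring.
  by field.
rewrite -/k e1 (NM T) NV (NM 2) -(NN z) (N_sqrtc (- z)) -/k sqrtr_sqr ger0_norm ?N_ge0//.
rewrite invrK.
have -> : N (2 : R[i]) = 2.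
  by rewrite (_ : 2 = (2 : R)%:C) ?NR ?ger0_norm// rmorph_nat.
have -> : N T / (2 * N k) * N k = N T / 2 by field; rewrite gt_eqF// (lt_le_trans s0).
apply: (@le_trans _ _ ((C * 2) / sigma / 2)); last first.
  by apply: le_of_eq; field; rewrite gt_eqF.
rewrite ler_pM2r ?invr_gt0//; apply: le_trans hT _.
by rewrite /C divfK.
Qed.

End expansion.

Theorem theorem3p5 (R : realType) (a : R) (b : \bar R) (hab : (a%:E < b)%E)
    (chi : signed_measure a b)
    (w dw : R -> R[i])
    (hw : limit_circle chi -> boundary_function chi w dw)
    (m : R[i] -> R -> R[i]) (hm : is_weyl_function chi w dw m)
    (phi : R -> R[i]) (hphi : test_function a b phi) :
  little_o_rsqrt (@Im_to_infty R) (fun z =>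
    leb_integral (oo_itv a b) (fun t => m z t * phi t)
    - (- sqrtc (- z) * leb_integral (oo_itv a b) phi
       - 1 / (2 * sqrtc (- z)) * chi_integral chi phi)).
Proof.
have [C [K hC]] := remainder_decay hab hw hm hphi.
rewrite /little_o_rsqrt => A /nbhs_ballP[eps /= eps0 epsA].
(* The last threshold makes |C| / Re k smaller than [eps]. *)
exists (Num.max (Num.max K 0) (`|C| / eps)) => // z /=.
rewrite !gt_max => -[/andP[/andP[zK _] _] /andP[/andP[kK k0] kC]].
apply: epsA; rewrite /ball/= sub0r normrN ger0_norm; last first.
  by rewrite divr_ge0 ?N_ge0// invr_ge0 sqrtr_ge0.
apply: le_lt_trans (hC z zK kK) _.
apply: (@le_lt_trans _ _ (`|C| / complex.Re (sqrtc (- z)))).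
  by rewrite ler_pM2r ?invr_gt0// ler_norm.
by rewrite ltr_pdivrMr// mulrC -ltr_pdivrMr.
Qed.
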